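(* Let $M$ and $N$ be oriented Riemannian manifolds, $X=M\times N$ their Riemannian product, and let $L$ on $L^2(X)$, $H$ on $L^2(M)$, $K$ on $L^2(N)$ be (unbounded) selfadjoint operators such that $L$ is the sum of $H$ and $K$ in the sense defined in the context. Let $I\subseteq\mathbb{R}$ be an interval, let $a,b\ge 0$ be real, and let $\widetilde r\le r$ be exponents in $[1,\infty]$. Assume that for all $t\in I$, $t\neq 0$, $$\|e^{itH}\phi\|_{L^{r}(M)}\lesssim |t|^{-a}\|\phi\|_{L^{\widetilde r}(M)},\qquad \|e^{itK}\psi\|_{L^{r}(N)}\lesssim |t|^{-b}\|\psi\|_{L^{\widetilde r}(N)} .$$ Then for all $t\in I$, $t\ne 0$, $$\|e^{itL}f\|_{L^{r}(M\times N)}\lesssim |t|^{-a-b}\|f\|_{L^{\widetilde r}(M\times N)} .$$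
   Context: Manifolds are endowed with their canonical Riemannian volume measures, and function spaces consist of complex-valued functions. The operator $L$ is the sum of $H$ and $K$ in the following sense: there are a dense subset $D_1$ of the domain $D(H)$ and a dense subset $D_2$ of the domain $D(K)$ (dense with respect to the graph norms) such that for all $f\in D_1$ and $g\in D_2$ the function $(x,y)\mapsto f(x)g(y)$ belongs to the domain of $L$ and $$L(f(x)g(y))=(Hf)(x)\,g(y)+f(x)\,(Kg)(y).$$ The unitary groups $e^{itH},e^{itK},e^{itL}$ are defined by the spectral theorem. An estimate $\|e^{itA}\phi\|_{L^{r}}\lesssim |t|^{-c}\|\phi\|_{L^{\widetilde r}}$ means that there is a constant $C$, independent of $t$ and $\phi$, such that $\|e^{itA}\phi\|_{L^{r}}\le C|t|^{-c}\|\phi\|_{L^{\widetilde r}}$ for all $\phi\in L^2\cap L^{\widetilde r}$. *)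

(* Defs.v *)
From HB Require Import structures.
From mathcomp Require Import all_boot all_order all_algebra.
From mathcomp Require Import all_classical all_reals all_analysis.
From mathcomp Require Import complex.

Set Implicit Arguments.
Unset Strict Implicit.
Unset Printing Implicit Defensive.

Import Order.TTheory GRing.Theory Num.Theory.
Import numFieldTopology.Exports numFieldNormedType.Exports.

Local Open Scope classical_set_scope.
Local Open Scope ring_scope.

(** * Oriented Riemannian manifolds and their volume measures *)

(* Classical C^k regularity on an open set U, by iterated directional
   derivatives. *)
Fixpoint Ck_on (R : realType) (V W : normedModType R) (k : nat)
    (U : set V) (f : V -> W) : Prop :=
  (forall x, U x -> {for x, continuous f}) /\
  if k is k'.+1 then
    forall v, (forall x, U x -> derivable f x v) /\
              Ck_on k' U (fun x => 'D_v f x)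
  else True.

Definition smooth_on (R : realType) (V W : normedModType R)
    (U : set V) (f : V -> W) : Prop := forall k, Ck_on k U f.

(* An atlas on T together with the coordinate matrices of a metric: the chart
   [chart i] is defined on [src i], [param i] is its inverse, and [metric i x]
   is the Gram matrix of the metric in the coordinates of [chart i], at the
   point with coordinates x. Values outside [src i] and outside
   [chart i @` src i] are irrelevant. *)
Record riemannian_data (R : realType) (T : Type) := RiemannianData {
  dim : nat ;
  idx : Type ;
  src : idx -> set T ;
  chart : idx -> T -> 'rV[R]_dim ;
  param : idx -> 'rV[R]_dim -> T ;
  metric : idx -> 'rV[R]_dim -> 'M[R]_dim }.

Section manifold.
Context (R : realType) (T : topologicalType) (g : riemannian_data R T).

Definition overlap (i j : idx g) : set 'rV[R]_(dim g) :=
  chart i @` (src i `&` src j).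

Definition transition (i j : idx g) : 'rV[R]_(dim g) -> 'rV[R]_(dim g) :=
  chart j \o param i.

Definition is_atlas : Prop :=
  [/\ (forall x, exists i : idx g, src i x),
      (forall i : idx g, open (src i) /\ open (chart i @` src i)),
      (forall (i : idx g) x, src i x -> param i (chart i x) = x),
      (forall i : idx g, {in src i, continuous (@chart R T g i)}) &
      (forall i : idx g, {in chart i @` src i, continuous (@param R T g i)})].

Definition is_oriented_smooth_atlas : Prop :=
  is_atlas /\
  forall i j : idx g,
    smooth_on (overlap i j) (transition i j) /\
    forall x, overlap i j x -> 0 < \det (jacobian (transition i j) x).

(* In the library's row-vector convention the differential at x is
   v |-> v *m jacobian f x, whence the form of the change of coordinates. *)
Definition is_riemannian_metric : Prop :=
  [/\ (forall i : idx g, smooth_on (chart i @` src i) (@metric R T g i)),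
      (forall (i : idx g) x, (chart i @` src i) x ->
         (metric i x)^T = metric i x),
      (forall (i : idx g) x, (chart i @` src i) x ->
         forall v : 'rV[R]_(dim g), v != 0 ->
           0 < (v *m metric i x *m v^T) 0 0) &
      (forall (i j : idx g) x, overlap i j x ->
         let J := jacobian (transition i j) x in
         metric i x = J *m metric j (transition i j x) *m J^T)].

Definition oriented_riemannian_manifold : Prop :=
  [/\ hausdorff_space T, second_countable (T := T),
      is_oriented_smooth_atlas & is_riemannian_metric].

End manifold.

HB.instance Definition _ (M N : ptopologicalType) :=
  Topological.on (M * N)%type.

(* The Borel sigma-algebra. Measurable types of the library are pointed, so
   that manifolds are nonempty below. *)
Notation borel T := (g_sigma_algebraType (@open T)).

(* Lebesgue integral over R^n of a nonnegative Borel function, as an iterated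
   integral (Tonelli). *)
Fixpoint lebesgue_int (R : realType) (n : nat) :
    ('rV[R]_n -> \bar R) -> \bar R :=
  if n is n'.+1 then
    fun F => (\int[lebesgue_measure]_x
      lebesgue_int (fun v : 'rV[R]_n' =>
        F (row_mx (const_mx (x : R) : 'rV[R]_1) v)))%E
  else fun F => F 0.

(* In each chart the volume measure is sqrt(det g_ij) dx; this determines it,
   since countably many charts cover a second countable manifold. *)
Definition is_volume_measure (R : realType) (T : ptopologicalType)
    (g : riemannian_data R T) (mu : {measure set (borel T) -> \bar R}) : Prop :=
  forall (i : idx g) (A : set (borel T)), measurable A -> A `<=` src i ->
    mu A = lebesgue_int (fun x =>
      (Num.sqrt (\det (metric i x)) * \1_(chart i @` A) x)%:E).

Definition riemannian_product (R : realType) (M N : Type)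
    (g : riemannian_data R M) (h : riemannian_data R N) :
    riemannian_data R (M * N) :=
  {| dim := dim g + dim h ;
     idx := (idx g * idx h)%type ;
     src := fun k => src k.1 `*` src k.2 ;
     chart := fun k z => row_mx (chart k.1 z.1) (chart k.2 z.2) ;
     param := fun k v => (param k.1 (lsubmx v), param k.2 (rsubmx v)) ;
     metric := fun k v => block_mx (metric k.1 (lsubmx v)) 0
                                   0 (metric k.2 (rsubmx v)) |}.

(** * Complex L^p spaces and operators on L^2 *)

(* Elements of L^p are represented by functions; operators act on
   representatives and are compatible with almost everywhere equality. *)
Section complex_L2.
Context {d : measure_display} {T : measurableType d} {R : realType}.
Variable mu : {measure set T -> \bar R}.
Local Notation C := R[i].

Definition cmeasurable (f : T -> C) : Prop :=
  measurable_fun setT (fun x => complex.Re (f x)) /\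
  measurable_fun setT (fun x => complex.Im (f x)).

Definition cLnorm (p : \bar R) (f : T -> C) : \bar R :=
  Lnorm mu p (fun x => (Normc.normc (f x))%:E).

Definition cLp (p : \bar R) : set (T -> C) :=
  [set f | cmeasurable f /\ (cLnorm p f < +oo)%E].

Definition L2 : set (T -> C) := cLp 2%:E.

Definition L2dist (f h : T -> C) : \bar R :=
  cLnorm 2%:E (fun x => f x - h x).

Definition inner (f h : T -> C) : C :=
  Complex (\int[mu]_x complex.Re (f x * conjc (h x)))
          (\int[mu]_x complex.Im (f x * conjc (h x))).

Definition aeq (f h : T -> C) : Prop := ae_eq mu setT f h.

(* A is a linear operator with domain the linear subspace D of L^2. *)
Definition linear_operator (D : set (T -> C)) (A : (T -> C) -> T -> C) : Prop :=
  [/\ D `<=` L2,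
      (forall f, D f -> L2 (A f)),
      (forall f h, D f -> cmeasurable h -> aeq f h -> D h /\ aeq (A f) (A h)),
      D (fun=> 0) &
      (forall (c : C) f h, D f -> D h ->
         D (fun x => c * f x + h x) /\
         aeq (A (fun x => c * f x + h x)) (fun x => c * A f x + A h x))].

Record unbounded_operator := UnboundedOperator {
  dom : set (T -> C) ;
  app :> (T -> C) -> T -> C }.

Definition densely_defined (A : unbounded_operator) : Prop :=
  forall f (e : R), L2 f -> 0 < e ->
    exists2 h, dom A h & (L2dist f h < e%:E)%E.

Definition graph (A : unbounded_operator) (f h : T -> C) : Prop :=
  [/\ dom A f, L2 h & aeq (A f) h].

Definition adjoint_graph (A : unbounded_operator) (f h : T -> C) : Prop :=
  [/\ L2 f, L2 h & forall u, dom A u -> inner (A u) f = inner u h].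

Definition selfadjoint (A : unbounded_operator) : Prop :=
  [/\ linear_operator (dom A) A, densely_defined A &
      forall f h, graph A f h <-> adjoint_graph A f h].

Definition graph_dense (A : unbounded_operator) (D : set (T -> C)) : Prop :=
  D `<=` dom A /\
  forall f (e : R), dom A f -> 0 < e ->
    exists2 h, D h & (L2dist f h + L2dist (A f) (A h) < e%:E)%E.

(** ** Spectral theorem *)

Definition projection_valued_measure
    (E : set R -> (T -> C) -> T -> C) : Prop :=
  [/\ (forall B, measurable B -> linear_operator L2 (E B)),
      (forall B f h, measurable B -> L2 f -> L2 h ->
         inner (E B f) h = inner f (E B h)),
      (forall A B f, measurable A -> measurable B -> L2 f ->
         aeq (E (A `&` B) f) (E A (E B f))),
      (forall f, L2 f -> aeq (E setT f) f) &
      (forall (F : nat -> set R) f, (forall k, measurable (F k)) ->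
         trivIset setT F -> L2 f ->
         L2dist (fun x => \sum_(k < n) E (F k) f x) (E (\bigcup_k F k) f)
           @[n --> \oo] --> 0%E)].

(* B |-> <E(B)f, f>, a finite Borel measure when E is a projection-valued
   measure and f is in L^2. *)
Definition scalar_measure (E : set R -> (T -> C) -> T -> C) (f : T -> C) :
    set (measurableTypeR R) -> \bar R :=
  fun B => (complex.Re (inner (E B f) f))%:E.

(* A is the operator \int s dE(s): its domain consists of the f with
   \int s^2 d<E(s)f, f> finite, where <Af, f> = \int s d<E(s)f, f>. *)
Definition spectral_resolution (A : unbounded_operator)
    (E : set R -> (T -> C) -> T -> C) : Prop :=
  [/\ projection_valued_measure E,
      (forall f, dom A f <->
         L2 f /\ (\int[scalar_measure E f]_s (s ^+ 2)%:E < +oo)%E) &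
      (forall f, dom A f ->
         inner (A f) f =
         Complex (fine (\int[scalar_measure E f]_s s%:E)%E) 0)].

(* U t is the operator e^{itA} = \int e^{its} dE(s). *)
Definition is_unitary_group (A : unbounded_operator)
    (U : R -> (T -> C) -> T -> C) : Prop :=
  exists2 E, spectral_resolution A E &
    forall t, linear_operator L2 (U t) /\
      forall f, L2 f ->
        inner (U t f) f =
        Complex (fine (\int[scalar_measure E f]_s (cos (t * s))%:E)%E)
                (fine (\int[scalar_measure E f]_s (sin (t * s))%:E)%E).

Definition dispersive_estimate (U : R -> (T -> C) -> T -> C) (I : set R)
    (c : R) (p q : \bar R) : Prop :=
  exists K : R, forall t f, I t -> t != 0 -> L2 f -> cLp q f ->
    (cLnorm p (U t f) <= (K * `|t| `^ (- c))%:E * cLnorm q f)%E.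

End complex_L2.

Arguments unbounded_operator {d} T R.

Definition tensor (R : realType) (M N : Type) (f : M -> R[i]) (h : N -> R[i]) :
  M * N -> R[i] := fun z => f z.1 * h z.2.

Definition is_sum (R : realType) (M N : ptopologicalType)
    (muM : {measure set (borel M) -> \bar R})
    (muN : {measure set (borel N) -> \bar R})
    (muX : {measure set (borel (M * N)%type) -> \bar R})
    (H : unbounded_operator (borel M) R) (K : unbounded_operator (borel N) R)
    (L : unbounded_operator (borel (M * N)%type) R) : Prop :=
  exists D1 D2,
    [/\ graph_dense muM H D1, graph_dense muN K D2 &
        forall f h, D1 f -> D2 h ->
          dom L (tensor f h) /\
          aeq muX (L (tensor f h))
            (fun z => H f z.1 * h z.2 + f z.1 * K h z.2)].

(* Main.v *)
Require Import Defs.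
From HB Require Import structures.
From mathcomp Require Import all_boot all_order all_algebra.
From mathcomp Require Import all_classical all_reals all_analysis.
From mathcomp Require Import complex.
From mathcomp Require Import measurable_realfun ess_sup_inf.
From mathcomp Require Import perm.
From mathcomp Require Import ring lra.

Set Implicit Arguments.
Unset Strict Implicit.
Unset Printing Implicit Defensive.

Import Order.TTheory GRing.Theory Num.Theory.
Import numFieldTopology.Exports numFieldNormedType.Exports.

Local Open Scope classical_set_scope.
Local Open Scope ring_scope.

(** On tensors the three groups satisfy
    $e^{itL}(f\otimes g)=e^{itH}f\otimes e^{itK}g$. Given this, freeze the second
    variable of a function [F] on the product: applying $e^{itL}$ amounts to
    applying $e^{itK}$ in [y] and $e^{itH}$ in [x], so the estimate for [H] on each
    slice followed by the estimate for [K] gives the product of the two bounds.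
    The inner and outer norms are exchanged by Minkowski's inequality, which is
    where $\widetilde r\le r$ enters.

    The identity on tensors ([tensor_evolution]) is proved without a joint
    functional calculus. Because [L] is closed, the sum formula extends from the
    cores to all of the domains of [H] and [K] ([sum_tensor]). Let [f] and [g] have
    bounded spectral support. Then all powers of [L] are defined on $f\otimes g$,
    and the numbers $\langle L^k(f\otimes g),f\otimes g\rangle$ are the moments of
    the spectral measure of $f\otimes g$ ([moment]). By the binomial formula they
    are also the moments of the convolution of the spectral measures of [f] and
    [g]. Compactly supported measures with equal moments have equal Fourier
    transforms ([moments_cos_sin]), which is the identity of quadratic forms
    $\langle e^{itL}(f\otimes g),f\otimes g\rangle=
    \langle e^{itH}f,f\rangle\langle e^{itK}g,g\rangle$ ([tensor_form]).
    Polarization and density finish the argument. That moments of spectral measures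
    are inner products rests on $d\mu_{Af}=s^2d\mu_f$ ([spectral_measure_op]),
    obtained by cutting the spectrum into small pieces on each of which [A] is
    nearly a multiple of the identity.

    Fubini on the product of the manifolds needs that the volume of a rectangle is
    the product of the volumes ([volume_rectangle]); in product charts this is
    Tonelli for iterated Lebesgue integrals.

    The slice argument is carried out for grid functions, finite sums
    $\sum_i1_{A_i}\otimes b_i$ with disjoint $A_i$: their images under $e^{itL}$
    are finite sums of tensors, so measurability in each variable is evident and
    only finite sums occur in Minkowski's inequality ([estimate_finite_finite],
    with variants for infinite exponents). A general function is approximated in
    $L^2$ by grid functions whose $L^{\widetilde r}$ norm is at most twice as large
    ([approximation_finite], [approximation_infty]), and the bound passes to the
    limit by Fatou's lemma ([product_estimate]). Constants are not optimized: the
    groups are only shown to have norm at most 2, which is enough for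
    continuity. *)

(** * The Hilbert space $L^2$ *)

Section complex_numbers.
Context {R : realType}.
Implicit Types z w : R[i].
Local Notation Re := complex.Re.
Local Notation Im := complex.Im.

Lemma ReD z w : Re (z + w) = Re z + Re w. Proof. by case: z w => [? ?] [? ?]. Qed.
Lemma ImD z w : Im (z + w) = Im z + Im w. Proof. by case: z w => [? ?] [? ?]. Qed.
Lemma ReN z : Re (- z) = - Re z. Proof. by case: z. Qed.
Lemma ImN z : Im (- z) = - Im z. Proof. by case: z. Qed.
Lemma ReM z w : Re (z * w) = Re z * Re w - Im z * Im w.
Proof. by case: z w => [? ?] [? ?]. Qed.
Lemma ImM z w : Im (z * w) = Re z * Im w + Im z * Re w.
Proof. by case: z w => [? ?] [? ?]. Qed.
Lemma ReJ z : Re (conjc z) = Re z. Proof. by case: z. Qed.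
Lemma ImJ z : Im (conjc z) = - Im z. Proof. by case: z. Qed.
Lemma complex_eq z w : Re z = Re w -> Im z = Im w -> z = w.
Proof. by case: z w => [? ?] [? ?] /= -> ->. Qed.

Definition simpC := (ReD, ImD, ReN, ImN, ReM, ImM, ReJ, ImJ).

Lemma conjcM z w : conjc (z * w) = conjc z * conjc w.
Proof. by apply: complex_eq; rewrite !simpC; ring. Qed.
Lemma conjcD z w : conjc (z + w) = conjc z + conjc w.
Proof. by apply: complex_eq; rewrite !simpC; ring. Qed.
Lemma conjcN z : conjc (- z) = - conjc z.
Proof. by apply: complex_eq; rewrite !simpC; ring. Qed.
Lemma conjc1' : conjc 1 = 1 :> R[i].
Proof. by apply: complex_eq => /=; rewrite ?oppr0. Qed.

Lemma normc_ge0 z : 0 <= Normc.normc z. Proof. by case: z => ? ?; exact: sqrtr_ge0. Qed.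

Lemma sqr_normc z : Normc.normc z ^+ 2 = Re z ^+ 2 + Im z ^+ 2.
Proof. by case: z => a b /=; rewrite sqr_sqrtr// addr_ge0// sqr_ge0. Qed.

Lemma normcJ z : Normc.normc (conjc z) = Normc.normc z.
Proof. by case: z => a b /=; rewrite sqrrN. Qed.

Lemma Re_le_normc z : `|Re z| <= Normc.normc z.
Proof.
by case: z => a b /=; rewrite -sqrtr_sqr ler_wsqrtr// lerDl sqr_ge0.
Qed.

Lemma Im_le_normc z : `|Im z| <= Normc.normc z.
Proof.
by case: z => a b /=; rewrite -sqrtr_sqr ler_wsqrtr// lerDr sqr_ge0.
Qed.

End complex_numbers.

Definition lin (R : realType) (T : Type) (c : R[i]) (f g : T -> R[i]) : T -> R[i] :=
  fun x => c * f x + g x.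
Definition sub (R : realType) (T : Type) (f g : T -> R[i]) : T -> R[i] :=
  fun x => f x - g x.

Lemma subE (R : realType) (T : Type) (f g : T -> R[i]) : sub f g = lin (-1) g f.
Proof. by apply/funext => x; rewrite /sub /lin mulN1r addrC. Qed.

Section L2.
Context {d : measure_display} {T : measurableType d} {R : realType}.
Variable mu : {measure set T -> \bar R}.
Local Notation C := R[i].
Local Notation Re := complex.Re.
Local Notation Im := complex.Im.
Local Notation normc := (@Normc.normc R).
Implicit Types (f g h : T -> C) (c : C).

Lemma cmeasurable_lin c f g :
  cmeasurable f -> cmeasurable g -> cmeasurable (lin c f g).
Proof.
move=> [rf jf] [rg jg]; rewrite /lin; split.
  under eq_fun do rewrite !simpC.
  by apply: measurable_funD => //; apply: measurable_funB => //;
    apply: measurable_funM.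
under eq_fun do rewrite !simpC.
by apply: measurable_funD => //; apply: measurable_funD => //;
    apply: measurable_funM.
Qed.

Lemma cmeasurableM f g :
  cmeasurable f -> cmeasurable g -> cmeasurable (fun x => f x * g x).
Proof.
move=> [rf jf] [rg jg]; split; under eq_fun do rewrite !simpC.
  by apply: measurable_funB => //; apply: measurable_funM.
by apply: measurable_funD => //; apply: measurable_funM.
Qed.

Lemma cmeasurableJ f : cmeasurable f -> cmeasurable (fun x => conjc (f x)).
Proof.
move=> [rf jf]; split; first by under eq_fun do rewrite ReJ.
by under eq_fun do rewrite ImJ; exact: measurableT_comp.
Qed.

Lemma cmeasurable_cst c : cmeasurable (fun _ : T => c).
Proof. by split; exact: measurable_cst. Qed.

Lemma measurable_normc2 f : cmeasurable f ->
  measurable_fun setT (fun x => normc (f x) ^+ 2).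
Proof.
move=> [rf jf]; under eq_fun do rewrite sqr_normc.
by apply: measurable_funD; apply: measurable_funX.
Qed.

Lemma measurable_normc f : cmeasurable f -> measurable_fun setT (fun x => normc (f x)).
Proof.
move=> mf; under eq_fun => x do rewrite -[normc _]ger0_norm ?normc_ge0//
  -sqrtr_sqr.
apply: (measurableT_comp (f := @Num.sqrt R) _ (measurable_normc2 mf)).
exact: (continuous_measurable_fun (@sqrt_continuous R)).
Qed.

(** The squared $L^2$ norm of a function that may fail to be square integrable;
    [nrm2] below is its real version, convenient inside $L^2$. *)
Definition energy f : \bar R := (\int[mu]_x (normc (f x) ^+ 2)%:E)%E.

Lemma energy_ge0 f : (0 <= energy f)%E.
Proof. by apply: integral_ge0 => x _; rewrite lee_fin sqr_ge0. Qed.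

Lemma cLnorm2E f : cLnorm mu 2%:E f = (energy f `^ 2^-1)%E.
Proof.
rewrite /cLnorm unlock; congr (_ `^ _)%E; apply: eq_integral => x _ /=.
by rewrite ger0_norm ?normc_ge0// powR_mulrn ?normc_ge0.
Qed.

Lemma L2E f : L2 mu f <-> cmeasurable f /\ (energy f < +oo)%E.
Proof.
rewrite /L2 /cLp /= cLnorm2E; split=> -[mf h]; split => //.
  move: h; rewrite !ltey; apply: contra => /eqP ->.
  by apply/eqP/eqy_poweR; rewrite // invr_gt0.
by apply: poweR_lty.
Qed.

Lemma L2_meas f : L2 mu f -> cmeasurable f. Proof. by case. Qed.

Lemma L2_energy f : L2 mu f -> (energy f < +oo)%E. Proof. by case/L2E. Qed.

Lemma L2_int2 f : L2 mu f -> mu.-integrable setT (fun x => (normc (f x) ^+ 2)%:E).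
Proof.
move=> /L2E[mf ef]; apply/integrableP; split.
  exact/measurable_EFinP/measurable_normc2.
by under eq_integral => x _ do rewrite gee0_abs ?lee_fin ?sqr_ge0//.
Qed.

Lemma L2_dom f g : cmeasurable f -> L2 mu g ->
  (forall x, normc (f x) <= normc (g x)) -> L2 mu f.
Proof.
move=> mf /L2E[mg eg] fg; apply/L2E; split => //.
apply: le_lt_trans eg; apply: ge0_le_integral => //.
- by move=> x _; rewrite lee_fin sqr_ge0.
- exact/measurable_EFinP/measurable_normc2.
- exact/measurable_EFinP/measurable_normc2.
- by move=> x _; rewrite lee_fin ler_sqr ?nnegrE ?normc_ge0.
Qed.

Lemma L2_lin c f g : L2 mu f -> L2 mu g -> L2 mu (lin c f g).
Proof.
move=> Lf Lg; apply/L2E; split; first exact: cmeasurable_lin (L2_meas Lf) (L2_meas Lg).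
have If := integrableZl measurableT (2 * normc c ^+ 2) (L2_int2 Lf).
have Ig := integrableZl measurableT 2 (L2_int2 Lg).
have /integrableP[_] := integrableD measurableT If Ig.
apply: le_lt_trans; apply: ge0_le_integral => //.
- by move=> x _; rewrite lee_fin sqr_ge0.
- by apply/measurable_EFinP/measurable_normc2/cmeasurable_lin; exact: L2_meas.
- apply: measurableT_comp => //; apply: emeasurable_funD.
    exact: (measurable_int _ If).
  exact: (measurable_int _ Ig).
move=> x _ /=; rewrite lee_fin ger0_norm.
  apply: (@le_trans _ _ ((normc c * normc (f x) + normc (g x)) ^+ 2)).
    by rewrite ler_sqr ?nnegrE ?normc_ge0 ?addr_ge0 ?mulr_ge0 ?normc_ge0//
      /lin -Normc.normcM le_normcD.
  rewrite sqrrD exprMn.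
  have := sqr_ge0 (normc c * normc (f x) - normc (g x)); rewrite sqrrB exprMn.
  lra.
by apply: addr_ge0; rewrite !mulr_ge0 ?sqr_ge0 ?normc_ge0.
Qed.

Lemma L2_sub f g : L2 mu f -> L2 mu g -> L2 mu (sub f g).
Proof. by move=> Lf Lg; rewrite subE; exact: L2_lin. Qed.

Lemma L2_0 : L2 mu (fun=> 0).
Proof.
apply/L2E; split; first exact: cmeasurable_cst.
by rewrite /energy integral0_eq ?ltry// => x _; rewrite sqr_normc /= expr0n /= addr0.
Qed.

Lemma L2_scale c f : L2 mu f -> L2 mu (fun x => c * f x).
Proof.
move=> Lf; have := L2_lin c Lf L2_0; congr (L2 mu _); apply/funext => x.
by rewrite /lin addr0.
Qed.

(** Products of square-integrable functions are integrable since
    $2|fg|\le |f|^2+|g|^2$. *)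
Lemma L2_intM f g : L2 mu f -> L2 mu g ->
  mu.-integrable setT (fun x => (Re (f x * conjc (g x)))%:E) /\
  mu.-integrable setT (fun x => (Im (f x * conjc (g x)))%:E).
Proof.
move=> Lf Lg.
have [mr mi] := cmeasurableM (L2_meas Lf) (cmeasurableJ (L2_meas Lg)).
have I := integrableD measurableT (L2_int2 Lf) (L2_int2 Lg).
have b x : normc (f x * conjc (g x)) <= `|normc (f x) ^+ 2 + normc (g x) ^+ 2|.
  rewrite Normc.normcM normcJ ger0_norm ?addr_ge0 ?sqr_ge0//.
  have := sqr_ge0 (normc (f x) - normc (g x)); rewrite sqrrB.
  have : 0 <= normc (f x) * normc (g x) by rewrite mulr_ge0 ?normc_ge0.
  lra.
split; apply: le_integrable I => //; try exact/measurable_EFinP.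
  by move=> x _ /=; rewrite lee_fin; apply: le_trans (Re_le_normc _) _; exact: b.
by move=> x _ /=; rewrite lee_fin; apply: le_trans (Im_le_normc _) _; exact: b.
Qed.

Lemma inner_linl c f g h : L2 mu f -> L2 mu g -> L2 mu h ->
  inner mu (lin c f g) h = c * inner mu f h + inner mu g h.
Proof.
move=> Lf Lg Lh.
have [Irf Iif] := L2_intM Lf Lh; have [Irg Iig] := L2_intM Lg Lh.
have eR x : Re (lin c f g x * conjc (h x)) =
    (Re c * Re (f x * conjc (h x)) + - Im c * Im (f x * conjc (h x)))
    + 1 * Re (g x * conjc (h x)) by rewrite /lin !simpC; ring.
have eI x : Im (lin c f g x * conjc (h x)) =
    (Re c * Im (f x * conjc (h x)) + Im c * Re (f x * conjc (h x)))
    + 1 * Im (g x * conjc (h x)) by rewrite /lin !simpC; ring.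
have Z (k : R) (u : T -> R) : mu.-integrable setT (EFin \o u) ->
    mu.-integrable setT (EFin \o (fun x => k * u x)).
  by move=> Iu; have := integrableZl measurableT k Iu.
have D2 (k l : R) (u v : T -> R) : mu.-integrable setT (EFin \o u) ->
    mu.-integrable setT (EFin \o v) ->
    mu.-integrable setT (EFin \o (fun x => k * u x + l * v x)).
  by move=> Iu Iv; have := integrableD measurableT (Z k _ Iu) (Z l _ Iv).
apply: complex_eq; rewrite !simpC /inner /=.
  under eq_Rintegral do rewrite eR.
  rewrite RintegralD//; [|exact: D2|exact: Z].
  by rewrite RintegralD// ?RintegralZl// ?mul1r ?mulNr//; exact: Z.
under eq_Rintegral do rewrite eI.
rewrite RintegralD//; [|exact: D2|exact: Z].
by rewrite RintegralD// ?RintegralZl// ?mul1r//; exact: Z.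
Qed.

Lemma innerJ f h : L2 mu f -> L2 mu h -> inner mu f h = conjc (inner mu h f).
Proof.
move=> Lf Lh; have [_ I] := L2_intM Lh Lf.
apply: complex_eq; rewrite !simpC /inner /=.
  by apply: eq_Rintegral => x _; rewrite !simpC; ring.
rewrite -mulN1r -RintegralZl//.
by apply: eq_Rintegral => x _; rewrite !simpC; ring.
Qed.

Lemma inner_linr c f g h : L2 mu f -> L2 mu g -> L2 mu h ->
  inner mu h (lin c f g) = conjc c * inner mu h f + inner mu h g.
Proof.
move=> Lf Lg Lh; rewrite innerJ ?inner_linl//; last exact: L2_lin.
by rewrite conjcD conjcM -!innerJ.
Qed.

Lemma inner0l f : inner mu (fun=> 0) f = 0.
Proof.
apply: complex_eq; rewrite /inner /= /Rintegral integral0_eq// => x _;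
by rewrite mul0r.
Qed.

Definition nrm2 f : R := Re (inner mu f f).

Lemma Re_inner f : Re (inner mu f f) = nrm2 f. Proof. by []. Qed.

Lemma nrm2E f : nrm2 f = fine (energy f).
Proof.
rewrite /nrm2 /inner /= /Rintegral; congr fine; apply: eq_integral => x _.
by rewrite sqr_normc !simpC; congr EFin; ring.
Qed.

Lemma nrm2_ge0 f : 0 <= nrm2 f.
Proof. by rewrite nrm2E fine_ge0// energy_ge0. Qed.

Lemma inner_self f : L2 mu f -> inner mu f f = (nrm2 f)%:C%C.
Proof.
move=> Lf; apply: complex_eq => //=.
have := congr1 (@complex.Im R) (innerJ Lf Lf); rewrite !simpC /=; lra.
Qed.

Lemma nrm2_lin c f g : L2 mu f -> L2 mu g ->
  nrm2 (lin c f g) = normc c ^+ 2 * nrm2 f + 2 * Re (c * inner mu f g) + nrm2 g.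
Proof.
move=> Lf Lg; have Ll := L2_lin c Lf Lg.
rewrite {1}/nrm2 inner_linl// !inner_linr// (innerJ Lg Lf) !inner_self//.
by rewrite !simpC sqr_normc /=; ring.
Qed.

Lemma nrm2_sub f g : L2 mu f -> L2 mu g ->
  nrm2 (sub f g) = nrm2 f - 2 * Re (inner mu f g) + nrm2 g.
Proof.
move=> Lf Lg; rewrite subE nrm2_lin// (innerJ Lg Lf) !simpC sqr_normc /=.
by ring.
Qed.

Lemma inner_subl f g h : L2 mu f -> L2 mu g -> L2 mu h ->
  inner mu (sub f g) h = inner mu f h - inner mu g h.
Proof. by move=> *; rewrite subE inner_linl// mulN1r addrC. Qed.

Lemma inner_subr f g h : L2 mu f -> L2 mu g -> L2 mu h ->
  inner mu h (sub f g) = inner mu h f - inner mu h g.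
Proof. by move=> *; rewrite subE inner_linr// conjcN conjc1' mulN1r addrC. Qed.

(** The quadratic polynomial $t\mapsto\|g-t\overline{\langle f,g\rangle}f\|^2$ is
    nonnegative. *)
Lemma CauchySchwarz f g : L2 mu f -> L2 mu g ->
  normc (inner mu f g) ^+ 2 <= nrm2 f * nrm2 g.
Proof.
move=> Lf Lg; set z := inner mu f g.
have key (t : R) : 0 <= t ^+ 2 * normc z ^+ 2 * nrm2 f - 2 * t * normc z ^+ 2 + nrm2 g.
  have := nrm2_ge0 (lin (- t%:C%C * conjc z) f g).
  by rewrite nrm2_lin// -/z !sqr_normc !simpC /=; lra.
have [f0|f0] := eqVneq (nrm2 f) 0.
  rewrite f0 mul0r; have [->//|z0] := eqVneq (normc z ^+ 2) 0.
  have := key ((nrm2 g + 1) / (2 * normc z ^+ 2)).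
  rewrite f0 mulr0 (_ : 2 * _ * _ = nrm2 g + 1); last first.
    by field; move: z0; rewrite expf_eq0.
  lra.
have fp : 0 < nrm2 f by rewrite lt_def f0 nrm2_ge0.
have := key (nrm2 f)^-1.
rewrite (_ : _ ^+ 2 * _ * _ = normc z ^+ 2 / nrm2 f); last by field.
move=> h; have : normc z ^+ 2 / nrm2 f <= nrm2 g by lra.
by rewrite ler_pdivrMr// mulrC.
Qed.

Lemma aeq_inner f f' g : L2 mu f -> L2 mu f' -> L2 mu g ->
  aeq mu f f' -> inner mu f g = inner mu f' g.
Proof.
move=> Lf Lf' Lg ff'; apply: complex_eq; rewrite /inner /= /Rintegral; congr fine;
  apply: ae_eq_integral => //.
- exact: measurable_int (L2_intM Lf Lg).1.
- exact: measurable_int (L2_intM Lf' Lg).1.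
- by apply: filterS ff' => x /(_ I) + _ => ->.
- exact: measurable_int (L2_intM Lf Lg).2.
- exact: measurable_int (L2_intM Lf' Lg).2.
- by apply: filterS ff' => x /(_ I) + _ => ->.
Qed.

Lemma aeq_nrm2P f g : L2 mu f -> L2 mu g -> aeq mu f g <-> nrm2 (sub f g) = 0.
Proof.
move=> Lf Lg; have Ls := L2_sub Lf Lg; split => [fg|].
  have : aeq mu (sub f g) (fun=> 0).
    by apply: filterS fg => x /(_ I) fgx _; rewrite /sub fgx subrr.
  move=> /(aeq_inner Ls L2_0 Ls); rewrite {1}/nrm2 => ->.
  rewrite /inner /= /Rintegral integral0_eq// => x _.
  by rewrite mul0r.
rewrite nrm2E => /eqP; rewrite fine_eq0; last first.
  by rewrite ge0_fin_numE ?energy_ge0// L2_energy.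
move=> /eqP e0.
have : (\int[mu]_x `|(normc (sub f g x) ^+ 2)%:E| = 0)%E.
  by rewrite -e0; apply: eq_integral => x _; rewrite gee0_abs// lee_fin sqr_ge0.
move/ae_eq_integral_abs => /(_ measurableT).
move=> /(_ (measurable_int _ (L2_int2 Ls))).
apply: filterS => x /(_ I) [] /eqP + _; rewrite sqrf_eq0 => /eqP/Normc.eq0_normc/eqP.
by rewrite subr_eq0 => /eqP.
Qed.

Lemma aeq_sym f g : aeq mu f g -> aeq mu g f.
Proof. by apply: filterS => x /(_ I) e _. Qed.

Lemma aeq_refl f : aeq mu f f.
Proof. by apply: aeW. Qed.

Lemma aeq_trans g f h : aeq mu f g -> aeq mu g h -> aeq mu f h.
Proof. by move=> h1 h2; apply: filterS2 h1 h2 => x /(_ I) -> /(_ I). Qed.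

Lemma aeq_lin c f f' g g' : aeq mu f f' -> aeq mu g g' ->
  aeq mu (lin c f g) (lin c f' g').
Proof. by apply: filterS2 => x /(_ I) e1 /(_ I) e2 _; rewrite /lin e1 e2. Qed.

Lemma aeq_sub f f' g g' : aeq mu f f' -> aeq mu g g' ->
  aeq mu (sub f g) (sub f' g').
Proof. by rewrite !subE => *; exact: aeq_lin. Qed.

Lemma aeq_innerr f g g' : L2 mu f -> L2 mu g -> L2 mu g' ->
  aeq mu g g' -> inner mu f g = inner mu f g'.
Proof.
by move=> Lf Lg Lg' gg'; rewrite innerJ// [RHS]innerJ//; congr conjc; exact: aeq_inner.
Qed.

Lemma aeq_nrm2 f g : L2 mu f -> L2 mu g -> aeq mu f g -> nrm2 f = nrm2 g.
Proof. by move=> Lf Lg fg; rewrite /nrm2 (aeq_inner Lf Lg)// (aeq_innerr Lg Lf Lg). Qed.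

Lemma L2dist_nrm2 f g : L2 mu f -> L2 mu g ->
  L2dist mu f g = (Num.sqrt (nrm2 (sub f g)))%:E.
Proof.
move=> Lf Lg; have Ls := L2_sub Lf Lg.
rewrite /L2dist -/(sub f g) cLnorm2E -[energy _]fineK; last first.
  by rewrite ge0_fin_numE ?energy_ge0// L2_energy.
by rewrite -nrm2E poweR_EFin -powR12_sqrt ?nrm2_ge0.
Qed.

Lemma L2dist_lt f g (e : R) : L2 mu f -> L2 mu g -> 0 < e ->
  (L2dist mu f g < e%:E)%E <-> nrm2 (sub f g) < e ^+ 2.
Proof.
move=> Lf Lg e0; rewrite L2dist_nrm2// lte_fin -{1}[e]ger0_norm ?ltW//.
by rewrite -sqrtr_sqr ltr_sqrt ?exprn_gt0.
Qed.

Lemma energyE f : L2 mu f -> energy f = (nrm2 f)%:E.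
Proof.
by move=> Lf; rewrite nrm2E fineK// ge0_fin_numE ?energy_ge0// L2_energy.
Qed.

(** From the parallelogram law. Squared norms keep square roots out of the
    approximation arguments, at the price of a factor 2. *)
Lemma nrm2_lin_le f g c : L2 mu f -> L2 mu g ->
  nrm2 (lin c f g) <= 2 * (normc c ^+ 2 * nrm2 f) + 2 * nrm2 g.
Proof.
move=> Lf Lg; have := nrm2_ge0 (lin (-c) f g).
by rewrite !nrm2_lin// normcN mulNr !simpC; lra.
Qed.

Lemma nrm2_triangle f g h : L2 mu f -> L2 mu g -> L2 mu h ->
  nrm2 (sub f h) <= 2 * nrm2 (sub f g) + 2 * nrm2 (sub g h).
Proof.
move=> Lf Lg Lh.
rewrite (_ : sub f h = lin 1 (sub f g) (sub g h)); last first.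
  by apply/funext => x; rewrite /lin /sub mul1r; ring.
have := nrm2_lin_le 1 (L2_sub Lf Lg) (L2_sub Lg Lh).
by rewrite sqr_normc /= expr1n expr0n /= addr0 mul1r.
Qed.

Lemma nrm2_subC f g : L2 mu f -> L2 mu g -> nrm2 (sub f g) = nrm2 (sub g f).
Proof. by move=> Lf Lg; rewrite !nrm2_sub// (innerJ Lf Lg) !simpC; lra. Qed.

(** If $h\perp w$ then $\|w\|^2\le\|w-h\|^2$, which is small for suitable [h]. *)
Lemma orth_dense (D : set (T -> C)) w : L2 mu w -> D `<=` L2 mu ->
  (forall e : R, 0 < e -> exists2 h, D h & nrm2 (sub w h) < e) ->
  (forall h, D h -> inner mu w h = 0) -> nrm2 w = 0.
Proof.
move=> Lw DL dense orth; apply/eqP; rewrite eq_le nrm2_ge0 andbT.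
apply/ler_addgt0Pl => e e0; have [h Dh hw] := dense e e0.
have Lh := DL _ Dh; move: hw.
rewrite nrm2_sub// orth//= mulr0 subr0 addr0 => hw.
by have := nrm2_ge0 h; lra.
Qed.

End L2.

(** The diagonal values at $f+g$ and $f+ig$ give the real and the imaginary part
    of the value at $(f,g)$. *)
Lemma polarization (R : realType) (T : Type) (P : set (T -> R[i]))
    (B1 B2 : (T -> R[i]) -> (T -> R[i]) -> R[i]) :
  (forall c f g, P f -> P g -> P (lin c f g)) ->
  (forall c f g h, P f -> P g -> P h ->
    B1 (lin c f g) h = c * B1 f h + B1 g h) ->
  (forall c f g h, P f -> P g -> P h ->
    B1 h (lin c f g) = conjc c * B1 h f + B1 h g) ->
  (forall c f g h, P f -> P g -> P h ->
    B2 (lin c f g) h = c * B2 f h + B2 g h) ->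
  (forall c f g h, P f -> P g -> P h ->
    B2 h (lin c f g) = conjc c * B2 h f + B2 h g) ->
  (forall f, P f -> B1 f f = B2 f f) ->
  forall f g, P f -> P g -> B1 f g = B2 f g.
Proof.
move=> Plin l1 r1 l2 r2 diag f g Pf Pg.
have key (c : R[i]) : c * B1 f g + conjc c * B1 g f = c * B2 f g + conjc c * B2 g f.
  have := diag _ (Plin c _ _ Pf Pg).
  rewrite l1 ?l2 ?r1 ?r2 ?diag//; try exact: Plin.
  move=> e; have := congr1 (fun z => z - c * (conjc c * B2 f f) - B2 g g) e.
  by rewrite (_ : forall a b c d, c * (a + b) + (d + B2 g g) - c * a - B2 g g = c * b + d) 1?(_ : forall a b c d, c * (a + b) + (d + B2 g g) - c * a - B2 g g = c * b + d)//; move=> *; ring.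
have k1 := key 1; have k2 := key ('i)%C.
move: k1 k2; move: (B1 f g) (B1 g f) (B2 f g) (B2 g f) => [a a'] [b b'] [c c'] [e e'].
by rewrite /=; simpc => -[h1 h2 [h3 h4]]; congr Complex; lra.
Qed.

(* Keeps [Re (inner f g)] from being simplified to an integral. *)
#[global] Opaque inner.

(** * Spectral measures *)

Section density.
Context {d : measure_display} {T : measurableType d} {R : realType}.
Variables m1 m2 : {measure set T -> \bar R}.
Variable w : T -> R.
Hypothesis mw : measurable_fun setT w.
Hypothesis w0 : forall x, 0 <= w x.
Hypothesis m2E : forall B, measurable B -> m2 B = (\int[m1]_(x in B) (w x)%:E)%E.
Local Open Scope ereal_scope.

Import HBNNSimple.

Let emw : measurable_fun setT (EFin \o w). Proof. exact/measurable_EFinP. Qed.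

Let density_nnsfun (h : {nnsfun T >-> R}) :
  \int[m2]_x (h x)%:E = \int[m1]_x ((h x)%:E * (w x)%:E).
Proof.
transitivity (\int[m2]_x (\sum_(y \in range h) (y * \1_(h @^-1` [set y]) x)%:E)).
  by apply: eq_integral => t tE; rewrite /= fimfunE -fsumEFin.
have indich r : measurable_fun setT (fun x => (r * \1_(h @^-1` [set r]) x)%:E).
  by apply: (measurable_comp measurableT) => //; exact: measurable_funM.
rewrite ge0_integral_fsum//; last by move=> m y Ey; exact: nnfun_muleindic_ge0.
transitivity (\int[m1]_x (\sum_(y \in range h)
    (y * \1_(h @^-1` [set y]) x)%:E * (w x)%:E)); last first.
  under [LHS]eq_integral => x xE.
    rewrite -ge0_mule_fsuml => [|y]; last exact: nnfun_muleindic_ge0.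
    rewrite fsumEFin // -(fimfunE _ x); over.
  by [].
rewrite ge0_integral_fsum//; last 2 first.
  - by move=> y; apply: emeasurable_funM => //; apply: measurable_funTS.
  - by move=> m y Ey; rewrite mule_ge0 ?nnfun_muleindic_ge0 ?lee_fin ?w0.
apply: eq_fsbigr => r rhn.
under eq_integral do rewrite EFinM.
rewrite integralZl_indic_nnsfun => //.
under [RHS]eq_integral do rewrite EFinM -muleA.
rewrite ge0_integralZl//.
- under [in RHS]eq_integral do rewrite muleC.
  rewrite [in RHS](eq_integral ((EFin \o w) \_ (h @^-1` [set r]))); last first.
    by move=> x xE; rewrite epatch_indic.
  by rewrite -integral_mkcond -m2E// integral_indic// setIT.
- by apply: emeasurable_funM => //; exact/measurable_EFinP.
- by move=> t Et; rewrite mule_ge0 ?lee_fin ?w0.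
- by move: rhn; rewrite inE => -[t _ <-]; rewrite lee_fin.
Qed.

(** By definition of a density for indicators, hence for simple functions and
    their monotone limits. *)
Lemma ge0_integral_density (f : T -> \bar R) : measurable_fun setT f ->
  (forall x, 0 <= f x) ->
  \int[m2]_x f x = \int[m1]_x (f x * (w x)%:E).
Proof.
move=> mf f0; pose h := nnsfun_approx measurableT mf.
have -> : \int[m2]_x f x = lim (\int[m2]_x (h n x)%:E @[n --> \oo]).
  have fE x : f x = lim ((h n x)%:E @[n --> \oo]).
    by apply/esym/cvg_lim => //; exact: cvg_nnsfun_approx.
  under eq_integral do rewrite fE.
  apply: monotone_convergence => //.
  - by move=> n; exact/measurable_EFinP.
  - by move=> n x _; rewrite lee_fin.
  - by move=> x _ a b ab; rewrite lee_fin; exact/lefP/nd_nnsfun_approx.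
have -> : \int[m1]_x (f x * (w x)%:E) =
    lim (\int[m1]_x ((h n x)%:E * (w x)%:E) @[n --> \oo]).
  have fE x : f x * (w x)%:E = lim (((h n x)%:E * (w x)%:E) @[n --> \oo]).
    by apply/esym/cvg_lim => //; apply: cvgeZr => //; exact: cvg_nnsfun_approx.
  under eq_integral do rewrite fE.
  apply: monotone_convergence => //.
  - by move=> n; apply: emeasurable_funM => //; exact/measurable_EFinP.
  - by move=> n x _; rewrite mule_ge0 ?lee_fin ?w0.
  - move=> x _ a b ab; rewrite lee_wpmul2r ?lee_fin ?w0//.
    exact/lefP/nd_nnsfun_approx.
by congr (lim (_ @ \oo)); apply/funext => n; exact: density_nnsfun.
Qed.

Lemma integral_density (f : T -> R) : measurable_fun setT f ->
  \int[m2]_x (f x)%:E = \int[m1]_x (f x * w x)%:E.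
Proof.
move=> mf; have mEf : measurable_fun setT (EFin \o f) by exact/measurable_EFinP.
rewrite integralE [RHS]integralE !ge0_integral_density//; last 2 first.
  exact: measurable_funeneg.
  exact: measurable_funepos.
congr (_ - _); apply: eq_integral => x _.
  by rewrite !funeposE EFinM maxe_pMl ?lee_fin ?w0// mul0e.
by rewrite !funenegE EFinM maxe_pMl ?lee_fin ?w0// mul0e -!EFinN -!EFinM mulNr.
Qed.

End density.

Section spectral_measure.
Context {d : measure_display} {T : measurableType d} {R : realType}.
Variable mu : {measure set T -> \bar R}.
Local Notation C := R[i].
Local Notation Re := complex.Re.
Local Notation Im := complex.Im.
Local Notation normc := (@Normc.normc R).
Local Notation nrm2 := (nrm2 mu).
Implicit Types (f g h : T -> C) (c : C) (B : set R).

Section linear_operator.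
Variables (D : set (T -> C)) (A : (T -> C) -> T -> C).
Hypothesis linA : linear_operator mu D A.

Lemma lop_L2d f : D f -> L2 mu f. Proof. by case: linA => + _ _ _ _; apply. Qed.
Lemma lop_L2 f : D f -> L2 mu (A f). Proof. by case: linA => _ + _ _ _; apply. Qed.
Lemma lop_aeq f g : D f -> cmeasurable g -> aeq mu f g -> aeq mu (A f) (A g).
Proof. by case: linA => _ _ + _ _ Df mg fg => /(_ f g Df mg fg)[]. Qed.
Lemma lop_lind c f g : D f -> D g -> D (lin c f g).
Proof. by case: linA => _ _ _ _ + Df Dg => /(_ c f g Df Dg)[]. Qed.
Lemma lop_lin c f g : D f -> D g -> aeq mu (A (lin c f g)) (lin c (A f) (A g)).
Proof. by case: linA => _ _ _ _ + Df Dg => /(_ c f g Df Dg)[]. Qed.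
Lemma lop_sub f g : D f -> D g -> aeq mu (A (sub f g)) (sub (A f) (A g)).
Proof. by move=> *; rewrite !subE; exact: lop_lin. Qed.
Lemma lop_zerod : D (fun=> 0). Proof. by case: linA. Qed.
Lemma lop_zero : aeq mu (A (fun=> 0)) (fun=> 0).
Proof.
have -> : (fun=> 0) = sub (fun=> 0) (fun=> 0) :> (T -> C).
  by apply/funext => x; rewrite /sub subr0.
apply: (aeq_trans (lop_sub lop_zerod lop_zerod)).
by apply: aeW => x; rewrite /sub subr0 subrr.
Qed.
Lemma lop_scaled c f : D f -> D (fun x => c * f x).
Proof.
move=> Df; have := lop_lind c Df lop_zerod; congr D.
by apply/funext => x; rewrite /lin addr0.
Qed.
Lemma lop_scale c f : D f -> aeq mu (A (fun x => c * f x)) (fun x => c * A f x).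
Proof.
move=> Df; have -> : (fun x => c * f x) = lin c f (fun=> 0).
  by apply/funext => x; rewrite /lin addr0.
apply: (aeq_trans (lop_lin c Df lop_zerod)).
by apply: filterS lop_zero => x /(_ Logic.I) e _; rewrite /lin e addr0.
Qed.

End linear_operator.

Lemma normc_inner_le f g : L2 mu f -> L2 mu g ->
  normc (inner mu f g) <= Num.sqrt (nrm2 f) * Num.sqrt (nrm2 g).
Proof.
move=> Lf Lg; rewrite -sqrtrM ?nrm2_ge0// -[leLHS]ger0_norm ?normc_ge0//.
by rewrite -sqrtr_sqr ler_wsqrtr// CauchySchwarz.
Qed.

Variable E : set R -> (T -> C) -> T -> C.
Hypothesis PE : projection_valued_measure mu E.

Let linE B : measurable B -> linear_operator mu (L2 mu) (E B).
Proof. by case: PE => + _ _ _ _; apply. Qed.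

Lemma pvm_L2 B f : measurable B -> L2 mu f -> L2 mu (E B f).
Proof. by move=> mB; exact: (lop_L2 (linE mB)). Qed.
Hint Resolve pvm_L2 : core.

Lemma pvm_sym B f g : measurable B -> L2 mu f -> L2 mu g ->
  inner mu (E B f) g = inner mu f (E B g).
Proof. by case: PE => _ + _ _ _ => h mB Lf Lg; exact: h. Qed.

Lemma pvm_I (A B : set R) f : measurable A -> measurable B -> L2 mu f ->
  aeq mu (E (A `&` B) f) (E A (E B f)).
Proof. by case: PE => _ _ + _ _ => h; exact: h. Qed.

Lemma pvm_T f : L2 mu f -> aeq mu (E setT f) f.
Proof. by case: PE => _ _ _ + _; apply. Qed.

Lemma pvm_inner B f g : measurable B -> L2 mu f -> L2 mu g ->
  inner mu (E B f) g = inner mu (E B f) (E B g).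
Proof.
move=> mB Lf Lg; rewrite -pvm_sym//; last exact: pvm_L2.
apply: aeq_inner => //; [exact: pvm_L2|by apply: pvm_L2 => //; exact: pvm_L2|].
by have := pvm_I mB mB Lf; rewrite setIid.
Qed.

Lemma scalar_measureE B f : measurable B -> L2 mu f ->
  scalar_measure mu E f B = (nrm2 (E B f))%:E.
Proof. by move=> mB Lf; rewrite /scalar_measure pvm_inner// Re_inner. Qed.

(** Pair the strong convergence of the partial sums with [f]:
    $\langle E(B)f,f\rangle=\|E(B)f\|^2$ since $E(B)$ is a projection. *)
Lemma pvm_sigma_additive (F : nat -> set R) f : (forall k, measurable (F k)) ->
  trivIset setT F -> L2 mu f ->
  (fun n => \sum_(k < n) nrm2 (E (F k) f)) @ \oo --> nrm2 (E (\bigcup_k F k) f).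
Proof.
move=> mF tF Lf.
have mU : measurable (\bigcup_k F k) by exact: bigcupT_measurable.
pose S n : T -> C := fun x => \sum_(k < n) E (F k) f x.
have S0 : S 0%N = fun=> 0 by apply/funext => x; rewrite /S big_ord0.
have SS n : S n.+1 = lin 1 (E (F n) f) (S n).
  by apply/funext => x; rewrite /S /lin big_ord_recr/= mul1r addrC.
have LS n : L2 mu (S n).
  elim: n => [|n IH]; first by rewrite S0; exact: L2_0.
  by rewrite SS; apply: L2_lin => //; exact: pvm_L2.
have inS n : \sum_(k < n) nrm2 (E (F k) f) = Re (inner mu (S n) f).
  elim: n => [|n IH].
    by rewrite big_ord0 S0 inner0l.
  rewrite big_ord_recr/= IH SS inner_linl//; last exact: pvm_L2.
  by rewrite mul1r ReD addrC (pvm_inner (mF n) Lf Lf) Re_inner.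
have LU : L2 mu (E (\bigcup_k F k) f) by exact: pvm_L2.
have cv : (fun n => Num.sqrt (nrm2 (sub (S n) (E (\bigcup_k F k) f)))) @ \oo --> 0.
  case: PE => _ _ _ _ /(_ F f mF tF Lf) h.
  have : (fun n => (Num.sqrt (nrm2 (sub (S n) (E (\bigcup_k F k) f))))%:E) @ \oo
      --> 0%E.
    apply: cvg_trans h; apply: near_eq_cvg; apply: nearW => n.
    by rewrite -L2dist_nrm2.
  by move/fine_cvgP => [_].
apply/cvgrPdist_le => /= e e0.
move/cvgrPdist_lt : cv => /(_ (e / (Num.sqrt (nrm2 f) + 1))).
rewrite divr_gt0// ?ltr_wpDl ?sqrtr_ge0// => /(_ isT).
apply: filterS => n; rewrite inS sub0r normrN.
rewrite ger0_norm ?sqrtr_ge0// => h.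
have -> : nrm2 (E (\bigcup_k F k) f) = Re (inner mu (E (\bigcup_k F k) f) f).
  by rewrite pvm_inner// Re_inner.
rewrite distrC.
have -> : Re (inner mu (S n) f) - Re (inner mu (E (\bigcup_k F k) f) f) =
  Re (inner mu (sub (S n) (E (\bigcup_k F k) f)) f).
  by rewrite inner_subl ?ReD ?ReN//; exact: pvm_L2.
apply: le_trans (Re_le_normc _) _.
apply: le_trans (normc_inner_le _ Lf) _; first by apply: L2_sub => //; exact: pvm_L2.
move: h; rewrite ltr_pdivlMr ?ltr_wpDl ?sqrtr_ge0// => h.
apply: ltW; apply: le_lt_trans h; rewrite ler_wpM2l ?sqrtr_ge0//.
by rewrite lerDl.
Qed.

(** Off the Borel sets [E] is arbitrary, and so is [scalar_measure]; a
    measure must be nonnegative on every set. *)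
Let sm_fun f (B : set (measurableTypeR R)) : \bar R :=
  if `[< measurable B >] then (nrm2 (E B f))%:E else 0%E.

Lemma spectral_measure_exists f : L2 mu f ->
  exists m : {measure set (measurableTypeR R) -> \bar R},
    forall B, measurable B -> m B = (nrm2 (E B f))%:E.
Proof.
move=> Lf.
have sm_ge0 B : (0 <= sm_fun f B)%E.
  by rewrite /sm_fun; case: ifP => // _; rewrite lee_fin nrm2_ge0.
have smE (B : set (measurableTypeR R)) : measurable B ->
    sm_fun f B = (nrm2 (E B f))%:E by move=> mB; rewrite /sm_fun; case: asboolP.
have sm_sigma : semi_sigma_additive (sm_fun f).
  move=> F mF tF mUF; rewrite smE//.
  have -> : (fun n => \sum_(0 <= i < n) sm_fun f (F i))%E =
      EFin \o (fun n => \sum_(k < n) nrm2 (E (F k) f)).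
    apply/funext => n; rewrite big_mkord /= -sumEFin.
    by apply: eq_bigr => i _; rewrite smE.
  by apply: cvg_EFin; [exact: nearW|exact: pvm_sigma_additive].
have sm0 : sm_fun f set0 = 0%E.
  rewrite smE//; congr EFin.
  have := @pvm_sigma_additive (fun=> set0) f (fun=> measurable0)
    (@trivIset_set0 _ _ _) Lf.
  rewrite bigcup0//; set c := nrm2 (E set0 f) => cv.
  have : (fun n => \sum_(k < n.+1) c - \sum_(k < n) c) @ \oo --> c - c.
    by apply: cvgB => //; rewrite (cvg_shiftS (fun n => \sum_(k < n) c)).
  have -> : (fun n => \sum_(k < n.+1) c - \sum_(k < n) c) = fun=> c.
    by apply/funext => n; rewrite big_ord_recr /= addrAC subrr add0r.
  rewrite subrr => c0; apply/esym/(cvg_unique _ c0) => //; exact: cvg_cst.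
pose m := HB.pack_for {measure set (measurableTypeR R) -> \bar R} (sm_fun f)
  (isMeasure.Build _ _ _ (sm_fun f) sm0 sm_ge0 sm_sigma).
by exists m.
Qed.

End spectral_measure.

Section spectral_measure_of.
Context {d : measure_display} {T : measurableType d} {R : realType}.
Variable mu : {measure set T -> \bar R}.
Local Notation C := R[i].
Local Notation Re := complex.Re.
Local Notation Im := complex.Im.
Local Notation normc := (@Normc.normc R).
Local Notation nrm2 := (nrm2 mu).
Implicit Types (f g h : T -> C) (c : C) (A B D : set R).
Variable E : set R -> (T -> C) -> T -> C.

(** The measure $B\mapsto\|E(B)f\|^2$. Choice makes it a total function of [E]
    and [f], with the null measure as default value. *)
Definition spectral_measure f : {measure set (measurableTypeR R) -> \bar R} :=
  match pselect (exists m : {measure set (measurableTypeR R) -> \bar R},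
    forall B, measurable B -> m B = (nrm2 (E B f))%:E) with
  | left ex => projT1 (cid ex)
  | right _ => mzero
  end.

Local Notation sm := spectral_measure.

Hypothesis PE : projection_valued_measure mu E.

Let linE B : measurable B -> linear_operator mu (L2 mu) (E B).
Proof. by case: PE => + _ _ _ _; apply. Qed.

Let L2E B f : measurable B -> L2 mu f -> L2 mu (E B f).
Proof. exact: pvm_L2. Qed.

Lemma spectral_measureE f B : L2 mu f -> measurable B ->
  sm f B = (nrm2 (E B f))%:E.
Proof.
move=> Lf mB; rewrite /sm; case: pselect => [ex|]; first exact: (projT2 (cid ex)).
by have /[swap] := spectral_measure_exists PE Lf.
Qed.

Lemma spectral_measureT f : L2 mu f -> sm f setT = (nrm2 f)%:E.
Proof.
move=> Lf; rewrite spectral_measureE//; congr EFin; apply: aeq_nrm2 => //.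
  exact: L2E.
exact: (pvm_T PE Lf).
Qed.

Lemma spectral_measure_fin f : L2 mu f -> (sm f setT < +oo)%E.
Proof. by move=> Lf; rewrite spectral_measureT// ltry. Qed.

Import HBNNSimple.

(** [scalar_measure] and [spectral_measure] agree on Borel sets, hence have
    the same integrals. *)
Lemma integral_scalar_measure f (phi : R -> \bar R) : L2 mu f ->
  (\int[scalar_measure mu E f]_s phi s = \int[sm f]_s phi s)%E.
Proof.
move=> Lf.
have H (m1 m2 : set (measurableTypeR R) -> \bar R)
    (h : R -> \bar R) : (forall B : set (measurableTypeR R), measurable B -> m1 B = m2 B) ->
  [set sintegral m1 g | g in [set g : {nnsfun (measurableTypeR R) >-> R} |
     forall x, ((g x)%:E <= h x)%E]] `<=`
  [set sintegral m2 g | g in [set g : {nnsfun (measurableTypeR R) >-> R} |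
     forall x, ((g x)%:E <= h x)%E]].
  move=> m12 _ [g gh <-]; exists g => //; rewrite /sintegral.
  by apply: eq_fsbigr => x _; congr (_ * _)%E; apply/esym/m12.
have e (B : set (measurableTypeR R)) : measurable B -> scalar_measure mu E f B = sm f B.
  by move=> mB; rewrite spectral_measureE// scalar_measureE.
rewrite /integral; congr (ereal_sup _ - ereal_sup _)%E; apply/seteqP;
  split; apply: H => B mB; by rewrite e.
Qed.

Lemma spectral_measure_aeq f g : L2 mu f -> L2 mu g -> aeq mu f g ->
  forall B, measurable B -> sm f B = sm g B.
Proof.
move=> Lf Lg fg B mB; rewrite !spectral_measureE//; congr EFin.
apply: aeq_nrm2; try exact: L2E.
exact: (lop_aeq (linE mB) Lf (L2_meas Lg) fg).
Qed.

Lemma pvm_idem B f : measurable B -> L2 mu f -> aeq mu (E B (E B f)) (E B f).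
Proof.
by move=> mB Lf; apply: aeq_sym; have := pvm_I PE mB mB Lf; rewrite setIid.
Qed.

Lemma pvm_set0 f : L2 mu f -> nrm2 (E set0 f) = 0.
Proof.
by move=> Lf; apply: EFin_inj; rewrite -spectral_measureE// measure0.
Qed.

Lemma pvm_orth A B f g : measurable A -> measurable B -> A `&` B = set0 ->
  L2 mu f -> L2 mu g -> inner mu (E A f) (E B g) = 0.
Proof.
move=> mA mB AB Lf Lg.
have LA := L2E mA Lf; have LB := L2E mB Lg.
rewrite pvm_sym//.
have LAB : L2 mu (E A (E B g)) by exact: L2E.
have L0 := L2E measurable0 Lg.
have e : aeq mu (E A (E B g)) (E set0 g).
  by apply: aeq_sym; rewrite -AB; exact: pvm_I.
rewrite (aeq_innerr Lf LAB L0 e).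
apply: Normc.eq0_normc; apply/eqP; rewrite -sqrf_eq0; apply/eqP/le_anti.
rewrite sqr_ge0 andbT.
by apply: le_trans (CauchySchwarz Lf L0) _; rewrite pvm_set0// mulr0.
Qed.

Lemma spectral_measure_pvm A B f : measurable A -> measurable B -> L2 mu f ->
  sm (E A f) B = sm f (B `&` A).
Proof.
move=> mA mB Lf; rewrite !spectral_measureE//; try exact: L2E; last exact: measurableI.
congr EFin; apply: aeq_nrm2.
- by apply: L2E => //; exact: L2E.
- by apply: L2E => //; exact: measurableI.
- by apply: aeq_sym; exact: pvm_I.
Qed.

(** The spectral subspaces of disjoint sets are orthogonal, so spectral
    measures of their elements add up. *)
Lemma spectral_measure_orthD A B f g D : measurable A -> measurable B ->
  A `&` B = set0 -> L2 mu f -> L2 mu g -> aeq mu (E A f) f -> aeq mu (E B g) g ->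
  measurable D -> (sm (lin 1%R f g) D = sm f D + sm g D)%E.
Proof.
move=> mA mB AB Lf Lg fA gB mD; have Ll := L2_lin 1 Lf Lg.
have LDf := L2E mD Lf; have LDg := L2E mD Lg.
rewrite !spectral_measureE// -EFinD; congr EFin.
rewrite (aeq_nrm2 (L2E mD Ll) (L2_lin 1 LDf LDg)); last exact: (lop_lin (linE mD)).
rewrite nrm2_lin// sqr_normc /= expr1n expr0n /= addr0 !mul1r.
suff -> : inner mu (E D f) (E D g) = 0 by rewrite /= mulr0 addr0.
rewrite -(pvm_inner PE mD Lf Lg).
have mDA := measurableI _ _ mD mA.
rewrite (_ : inner mu (E D f) g = inner mu (E (D `&` A) f) (E B g)).
  by apply: pvm_orth => //; rewrite -setIA AB setI0.
have LCA := L2E mDA Lf.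
rewrite (aeq_innerr LCA (L2E mB Lg) Lg gB); apply: aeq_inner => //.
apply: aeq_sym; apply: aeq_trans (pvm_I PE mD mA Lf) _.
by apply: (lop_aeq (linE mD) _ _ fA); [exact: L2E|exact: (L2_meas Lf)].
Qed.

Lemma pvm_setC f B : L2 mu f -> measurable B ->
  aeq mu f (lin 1 (E B f) (E (~` B) f)).
Proof.
move=> Lf mB; have mBc := measurableC mB.
have LB := L2E mB Lf; have LBc := L2E mBc Lf; have Ll := L2_lin 1 LB LBc.
apply/aeq_nrm2P => //.
have e : nrm2 (E B f) + nrm2 (E (~` B) f) = nrm2 f.
  apply: EFin_inj; rewrite EFinD -!spectral_measureE// -spectral_measureT//.
  by rewrite -measureU ?setIv ?setUv// setICr.
rewrite nrm2_sub// (inner_linr _ LB LBc Lf) nrm2_lin// pvm_orth//; last exact: setICr.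
rewrite conjc1' !mul1r ReD.
rewrite (innerJ Lf LB) (innerJ Lf LBc) !ReJ (pvm_inner PE mB Lf Lf).
rewrite (pvm_inner PE mBc Lf Lf) !Re_inner.
by rewrite sqr_normc /= expr1n expr0n /=; lra.
Qed.

End spectral_measure_of.

(** * Spectral subspaces of a selfadjoint operator *)

Section spectral_operator.
Context {d : measure_display} {T : measurableType d} {R : realType}.
Variable mu : {measure set T -> \bar R}.
Local Notation C := R[i].
Local Notation Re := complex.Re.
Local Notation Im := complex.Im.
Local Notation normc := (@Normc.normc R).
Local Notation nrm2 := (nrm2 mu).
Implicit Types (f g h : T -> C) (B D : set R).
Variables (A : unbounded_operator T R) (E : set R -> (T -> C) -> T -> C).
Hypothesis saA : selfadjoint mu A.
Hypothesis resA : spectral_resolution mu A E.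

Local Notation sm := (spectral_measure mu E).

Let PE : projection_valued_measure mu E. Proof. by case: resA. Qed.
Let linA : linear_operator mu (dom A) A. Proof. by case: saA. Qed.
Let linE B : measurable B -> linear_operator mu (L2 mu) (E B).
Proof. by case: PE => + _ _ _ _; apply. Qed.
Let EL2 B f : measurable B -> L2 mu f -> L2 mu (E B f).
Proof. exact: pvm_L2. Qed.

Lemma op_L2d f : dom A f -> L2 mu f. Proof. exact: (lop_L2d linA). Qed.
Lemma op_L2 f : dom A f -> L2 mu (A f). Proof. exact: (lop_L2 linA). Qed.

Lemma op_sym f g : dom A f -> dom A g -> inner mu (A f) g = inner mu f (A g).
Proof.
move=> Df Dg; have [_ _ /(_ g (A g))[+ _]] := saA.
case; first by split => //; [exact: op_L2|exact: aeq_refl].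
by move=> _ _ /(_ f Df).
Qed.

Lemma op_dense w : L2 mu w -> (forall g, dom A g -> inner mu w g = 0) -> nrm2 w = 0.
Proof.
move=> Lw; apply: orth_dense => //; first exact: op_L2d.
move=> e e0; have [_ dd _] := saA.
have se0 : 0 < Num.sqrt e by rewrite sqrtr_gt0.
have [h Dh hh] := dd w _ Lw se0; exists h => //.
have := hh; rewrite L2dist_lt// ?sqr_sqrtr// ?ltW//; exact: op_L2d.
Qed.

Lemma op_weak_eq u v : L2 mu u -> L2 mu v ->
  (forall g, dom A g -> inner mu u g = inner mu v g) -> aeq mu u v.
Proof.
move=> Lu Lv uv; apply/aeq_nrm2P => //; apply: op_dense; first exact: L2_sub.
by move=> g Dg; rewrite inner_subl ?uv ?subrr//; exact: op_L2d.
Qed.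

Lemma op_domP f : dom A f <-> L2 mu f /\ (\int[sm f]_s (s ^+ 2)%:E < +oo)%E.
Proof.
have [_ /(_ f) h _] := resA; split.
  by move=> /h[Lf]; rewrite (integral_scalar_measure PE).
by move=> [Lf hf]; apply/h; split => //; rewrite (integral_scalar_measure PE).
Qed.

Lemma op_quad f : dom A f -> inner mu (A f) f = (\int[sm f]_s s)%:C%C.
Proof.
move=> Df; have [_ _ ->//] := resA.
by rewrite (integral_scalar_measure PE)//; exact: op_L2d.
Qed.

Let measurable_sqr : measurable_fun setT (fun s : measurableTypeR R => s ^+ 2).
Proof. exact: measurable_funX. Qed.

Lemma op_int2 f : dom A f -> (sm f).-integrable setT (fun s => (s ^+ 2)%:E).
Proof.
move=> /op_domP[Lf h]; apply/integrableP; split.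
  exact/measurable_EFinP.
by under eq_integral do rewrite gee0_abs ?lee_fin ?sqr_ge0//.
Qed.

Lemma op_int0 f (k : R) : L2 mu f -> (sm f).-integrable setT (fun s => k%:E).
Proof.
move=> Lf; apply/integrableP; split; first exact: measurable_cst.
rewrite integral_cst// lte_mul_pinfty//; exact: spectral_measure_fin.
Qed.

Lemma op_int1 f : dom A f -> (sm f).-integrable setT (fun s => s%:E).
Proof.
move=> Df; have := integrableD measurableT (op_int0 1 (op_L2d Df)) (op_int2 Df).
apply: le_integrable => //; first exact/measurable_EFinP.
move=> s _ /=; rewrite lee_fin [leRHS]ger0_norm ?addr_ge0 ?sqr_ge0//.
by rewrite -[s ^+ 2]real_normK ?num_real//; have := sqr_ge0 (`|s| - 1);
  have := normr_ge0 s; nra.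
Qed.


Lemma op_pvm_le f B : L2 mu f -> measurable B ->
  (\int[sm (E B f)]_s (s ^+ 2)%:E = \int[sm f]_s (s ^+ 2 * \1_B s)%:E)%E.
Proof.
move=> Lf mB.
apply: (@integral_density _ _ _ (sm f) (sm (E B f)) \1_B _ _ _
  (fun s : measurableTypeR R => s ^+ 2)) => //.
move=> D mD; rewrite spectral_measure_pvm//.
by rewrite integral_indic// setIC.
Qed.

Lemma op_dom_pvm f B : dom A f -> measurable B -> dom A (E B f).
Proof.
move=> Df mB; have [Lf h] := (op_domP f).1 Df.
apply/op_domP; split; first exact: EL2.
rewrite op_pvm_le//; apply: le_lt_trans h; apply: ge0_le_integral => //.
- by move=> s _; rewrite lee_fin mulr_ge0 ?sqr_ge0.
- by apply/measurable_EFinP/measurable_funM.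
- exact/measurable_EFinP.
- by move=> s _; rewrite lee_fin ler_piMr ?sqr_ge0// indicE lern1 leq_b1.
Qed.

(** Spectral subspaces of disjoint sets are orthogonal for the quadratic form
    of [A]: the spectral measure of a sum is the sum of the spectral measures,
    so the form is additive on such sums, which kills the cross terms. *)
Let op_orth_Re B D f g : measurable B -> measurable D -> B `&` D = set0 ->
  dom A f -> dom A g -> aeq mu (E B f) f -> aeq mu (E D g) g ->
  Re (inner mu (A f) g) = 0.
Proof.
move=> mB mD BD Df Dg fB gD.
have Lf := op_L2d Df; have Lg := op_L2d Dg.
have LAf := op_L2 Df; have LAg := op_L2 Dg.
have Dl := lop_lind linA 1 Df Dg; have Ll := op_L2d Dl.
have e1 : \int[sm (lin 1 f g)]_s s = \int[sm f]_s s + \int[sm g]_s s.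
  rewrite /Rintegral (eq_measure_integral (measure_add (sm f) (sm g))); last first.
    move=> F mF _; rewrite (spectral_measure_orthD PE mB mD BD Lf Lg fB gD mF).
    exact/esym/measure_addE.
  have [If Ig] := (op_int1 Df, op_int1 Dg).
  rewrite (integral_measure_add measurableT If Ig)//.
  by rewrite fineD//; apply: (integrable_fin_num measurableT).
have := congr1 (@complex.Re R) (op_quad Dl).
rewrite (aeq_inner (op_L2 Dl) (L2_lin 1 LAf LAg) Ll (lop_lin linA 1 Df Dg)).
rewrite inner_linl// !inner_linr// conjc1' !mul1r.
rewrite (op_sym Dg Df) (innerJ Lg LAf) (op_quad Df) (op_quad Dg) !simpC /= e1.
move=> {e1}; move: (\int[sm f]_s s) (\int[sm g]_s s) (inner mu (A f) g) => x y z; lra.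
Qed.

Lemma op_orth B D f g : measurable B -> measurable D -> B `&` D = set0 ->
  dom A f -> dom A g -> aeq mu (E B f) f -> aeq mu (E D g) g ->
  inner mu (A f) g = 0.
Proof.
move=> mB mD BD Df Dg fB gD.
have Lf := op_L2d Df; have Lg := op_L2d Dg.
have LAf := op_L2 Df; have LAg := op_L2 Dg.
apply: complex_eq; first exact: (op_orth_Re mB mD BD Df Dg fB gD).
pose i : C := ('i)%C.
have Dif := lop_scaled linA i Df.
have fiB : aeq mu (E B (fun x => i * f x)) (fun x => i * f x).
  apply: aeq_trans (lop_scale (linE mB) i Lf) _.
  by apply: filterS fB => x /(_ Logic.I) -> _.
have := op_orth_Re mB mD BD Dif Dg fiB gD.
rewrite (aeq_inner (op_L2 Dif) (L2_scale i LAf) Lg (lop_scale linA i Df)).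
have -> : (fun x => i * A f x) = lin i (A f) (fun=> 0).
  by apply/funext => x; rewrite /lin addr0.
rewrite inner_linl//; last exact: L2_0.
by rewrite inner0l addr0 ReM /= mul0r mul1r sub0r => /eqP; rewrite oppr_eq0 => /eqP.
Qed.

(** By [op_orth] the pieces of a vector over [B] and over its complement do not
    interact under the form of [A], so both sides have the same inner product
    with every vector of the domain. *)
Lemma op_commute f B : dom A f -> measurable B -> aeq mu (A (E B f)) (E B (A f)).
Proof.
move=> Df mB; have mBc := measurableC mB.
have DB := op_dom_pvm Df mB; have DBc := op_dom_pvm Df mBc.
have Lf := op_L2d Df; have LAf := op_L2 Df.
have LB := EL2 mB Lf; have LBc := EL2 mBc Lf.
have LAB := op_L2 DB; have LABc := op_L2 DBc.
apply: op_weak_eq => //; first exact: EL2.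
move=> g Dg; have Lg := op_L2d Dg.
have DgB := op_dom_pvm Dg mB; have DgBc := op_dom_pvm Dg mBc.
have LgB := EL2 mB Lg; have LgBc := EL2 mBc Lg.
rewrite (aeq_innerr LAB Lg (L2_lin 1 LgB LgBc) (pvm_setC PE Lg mB)).
rewrite inner_linr// conjc1' mul1r.
rewrite (op_orth mB mBc (setICr B) DB DgBc (pvm_idem PE mB Lf) (pvm_idem PE mBc Lg)).
rewrite addr0 pvm_sym//.
have Dl := lop_lind linA 1 DB DBc.
have fl := pvm_setC PE Lf mB.
rewrite (aeq_inner LAf (op_L2 Dl) LgB); last first.
  by apply: (lop_aeq linA Df _ fl); exact: (L2_meas (op_L2d Dl)).
rewrite (aeq_inner (op_L2 Dl) (L2_lin 1 LAB LABc) LgB (lop_lin linA 1 DB DBc)).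
rewrite inner_linl// mul1r.
rewrite (op_orth mBc mB _ DBc DgB (pvm_idem PE mBc Lf) (pvm_idem PE mB Lg)).
  by rewrite addr0.
by rewrite setIC setICr.
Qed.

Definition concentrated B f := L2 mu f /\ aeq mu (E B f) f.

Lemma conc_pvm B f : measurable B -> L2 mu f -> concentrated B (E B f).
Proof. by move=> mB Lf; split; [exact: EL2|exact: (pvm_idem PE)]. Qed.

Lemma conc_lin B c f g : measurable B -> concentrated B f -> concentrated B g ->
  concentrated B (lin c f g).
Proof.
move=> mB [Lf fB] [Lg gB]; split; first exact: L2_lin.
by apply: aeq_trans (lop_lin (linE mB) c Lf Lg) _; exact: aeq_lin.
Qed.

Lemma conc_null B f : measurable B -> concentrated B f ->
  {ae sm f, forall s, B s}.
Proof.
move=> mB [Lf fB]; exists (~` B); split => //; first exact: measurableC.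
have mBc := measurableC mB.
rewrite -(spectral_measure_aeq PE (EL2 mB Lf) Lf fB mBc) spectral_measure_pvm//.
by rewrite setIC setICr measure0.
Qed.

Lemma conc_int B f (phi : R -> R) (k : R) : 0 <= k -> measurable B -> concentrated B f ->
  measurable_fun setT phi -> (forall s, B s -> `|phi s| <= k) ->
  (sm f).-integrable setT (EFin \o phi) /\ `|\int[sm f]_s phi s| <= k * nrm2 f.
Proof.
move=> k0 mB cf mphi phik; have Lf := cf.1.
have le : (\int[sm f]_s `|(phi s)%:E| <= (k * nrm2 f)%:E)%E.
  apply: (@le_trans _ _ (\int[sm f]_s k%:E)%E); last first.
    by rewrite integral_cst// EFinM spectral_measureT.
  apply: ae_ge0_le_integral => //.
  - by apply/measurable_EFinP; exact: measurableT_comp.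
  - have [N [mN N0 NB]] := conc_null mB cf; exists N; split => // s hs.
    by apply: NB => Bs; apply: hs => _; rewrite lee_fin phik.
have I : (sm f).-integrable setT (EFin \o phi).
  apply/integrableP; split; first exact/measurable_EFinP.
  by apply: le_lt_trans le _; rewrite ltry.
split => //; rewrite -lee_fin; apply: le_trans le.
rewrite EFin_normr_Rintegral//; apply: le_abse_integral => //.
exact/measurable_EFinP.
Qed.

End spectral_operator.

Section spectral_moments.
Context {d : measure_display} {T : measurableType d} {R : realType}.
Variable mu : {measure set T -> \bar R}.
Local Notation C := R[i].
Local Notation Re := complex.Re.
Local Notation Im := complex.Im.
Local Notation normc := (@Normc.normc R).
Local Notation nrm2 := (nrm2 mu).
Implicit Types (f g h : T -> C) (B D : set R).
Variables (A : unbounded_operator T R) (E : set R -> (T -> C) -> T -> C).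
Hypothesis saA : selfadjoint mu A.
Hypothesis resA : spectral_resolution mu A E.

Local Notation sm := (spectral_measure mu E).
Local Notation conc := (concentrated mu E).

Let PE : projection_valued_measure mu E. Proof. by case: resA. Qed.
Let linA : linear_operator mu (dom A) A. Proof. by case: saA. Qed.
Let linE B : measurable B -> linear_operator mu (L2 mu) (E B).
Proof. by case: PE => + _ _ _ _; apply. Qed.
Let EL2 B f : measurable B -> L2 mu f -> L2 mu (E B f).
Proof. exact: pvm_L2. Qed.
Let opL2d f : dom A f -> L2 mu f. Proof. exact: (op_L2d saA). Qed.
Let opL2 f : dom A f -> L2 mu (A f). Proof. exact: (op_L2 saA). Qed.

Let measurable_sqr : measurable_fun setT (fun s : measurableTypeR R => s ^+ 2).
Proof. exact: measurable_funX. Qed.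

(** The integral of $s^2$ is finite when the spectral support is bounded. *)
Lemma conc_dom B f (k : R) : 0 <= k -> measurable B -> (forall s, B s -> `|s| <= k) ->
  conc B f -> dom A f.
Proof.
move=> k0 mB Bk cf; apply/(op_domP resA); split; first exact: cf.1.
have [|I _] := conc_int resA (sqr_ge0 k) mB cf measurable_sqr.
  by move=> s /Bk sk; rewrite ger0_norm ?sqr_ge0// -real_normK ?num_real// ler_sqr ?nnegrE.
have := integrable_lty measurableT I; exact.
Qed.

Lemma conc_op B f : measurable B -> dom A f -> conc B f -> conc B (A f).
Proof.
move=> mB Df [Lf fB]; split; first exact: opL2.
apply: aeq_trans (aeq_sym (op_commute saA resA Df mB)) _.
have DB := op_dom_pvm resA Df mB.
exact: (lop_aeq linA DB (L2_meas Lf) fB).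
Qed.

(** For [f] with spectral support in an interval around [c] of radius [dl], the
    symmetric operator [A - c] is bounded by [dl] on the spectral subspace,
    because its quadratic form is. *)
Lemma near_eigen B f (c dl : R) : 0 < dl -> measurable B ->
  (forall s, B s -> `|s - c| <= dl) -> conc B f -> dom A f ->
  nrm2 (lin (- c%:C%C) f (A f)) <= dl ^+ 2 * nrm2 f.
Proof.
move=> dl0 mB Bc cf Df; have dl0' := ltW dl0.
pose c' : C := - c%:C%C.
have [S SE] : {S : (T -> C) -> T -> C | forall h, S h = lin c' h (A h)}.
  by exists (fun h => lin c' h (A h)).
rewrite -SE.
have Bk s : B s -> `|s| <= `|c| + dl.
  by move=> /Bc sc; rewrite -[s](subrK c) addrC (le_trans (ler_normD _ _))// lerD2l.
have cdom h : conc B h -> dom A h.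
  by apply: (conc_dom _ mB Bk); rewrite addr_ge0.
have quadS h : conc B h -> `|Re (inner mu (S h) h)| <= dl * nrm2 h.
  move=> ch; have Dh := cdom _ ch; have Lh := ch.1.
  have mphi : measurable_fun setT (fun s : measurableTypeR R => s - c).
    by apply: measurable_funB => //; exact: measurable_cst.
  have [I le] := conc_int resA dl0' mB ch mphi Bc.
  rewrite SE inner_linl//; last exact: opL2.
  rewrite (op_quad saA resA Dh) inner_self// !simpC /=.
  move: le; rewrite RintegralB//; last 2 first.
    exact: (op_int1 saA resA Dh).
    exact: (op_int0 resA).
  rewrite Rintegral_cst// spectral_measureT//=.
  by rewrite (_ : - c * nrm2 h - - 0 * 0 + _ = \int[sm h]_s s - c * nrm2 h)//; ring.
have LS h : dom A h -> L2 mu (S h).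
  by move=> Dh; rewrite SE; apply: L2_lin; [exact: opL2d|exact: opL2].
have cS h : conc B h -> conc B (S h).
  by move=> ch; rewrite SE; apply: (conc_lin resA) => //; apply: conc_op => //; exact: cdom.
have symS h h' : dom A h -> dom A h' -> inner mu (S h) h' = inner mu h (S h').
  move=> Dh Dh'; have [Lh Lh'] := (opL2d Dh, opL2d Dh').
  have [LAh LAh'] := (opL2 Dh, opL2 Dh').
  rewrite !SE inner_linl// inner_linr// (op_sym saA)//; congr (_ * _ + _).
  by rewrite /c' conjcN conjc_real.
set w := S f.
have cw : conc B w by exact: cS.
have Dw := cdom _ cw; have Lw := cw.1; have Lf := cf.1.
have linS a : aeq mu (S (lin a w f)) (lin a (S w) (S f)).
  have := lop_lin linA a Dw Df; apply: filterS => x /(_ Logic.I) e _.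
  by rewrite !SE /lin in e *; rewrite e; ring.
have expand (t : R) : Re (inner mu (S (lin t%:C%C w f)) (lin t%:C%C w f)) =
    t ^+ 2 * Re (inner mu (S w) w) + 2 * t * nrm2 w + Re (inner mu (S f) f).
  have Dl := lop_lind linA t%:C%C Dw Df.
  rewrite (aeq_inner (LS _ Dl) (L2_lin _ (LS _ Dw) (LS _ Df)) (opL2d Dl) (linS _)).
  rewrite inner_linl ?inner_linr//; try exact: LS; try exact: L2_lin.
  rewrite conjc_real (symS w f)// -/w !ReD !ReM !ReD !ReM !ImD !ImM /=.
  rewrite -!Re_inner; move: (inner mu (S w) w) (inner mu w w) (inner mu (S f) f) => z1 z2 z3.
  by clear; ring.
have b (t : R) : `|t ^+ 2 * Re (inner mu (S w) w) + 2 * t * nrm2 w + Re (inner mu (S f) f)| <=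
    dl * (normc t%:C%C ^+ 2 * nrm2 w + 2 * Re (t%:C%C * inner mu w f) + nrm2 f).
  by rewrite -expand -(nrm2_lin _ Lw Lf); apply: quadS; exact: (conc_lin resA).
have := b (dl^-1); have := b (- dl^-1).
rewrite !sqr_normc !simpC /=.
rewrite !ler_norml => /andP[b1 _] /andP[_ b2].
have h : 4 * dl^-1 * nrm2 w <= 2 * dl * nrm2 f + 2 * dl^-1 * nrm2 w.
  have e : dl * dl^-1 = 1 by rewrite divff// gt_eqF.
  move: b1 b2; rewrite sqrrN expr0n /= !addr0 !mulrDr.
  have -> : dl * (dl^-1 ^+ 2 * nrm2 w) = dl^-1 * nrm2 w by rewrite expr2 !mulrA e mul1r.
  lra.
have {}h : dl^-1 * nrm2 w <= dl * nrm2 f by lra.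
by move: h; rewrite ler_pdivrMl// expr2 mulrA.
Qed.

(** By [near_eigen], both $\|(A-c)f\|^2$ and $\int(s-c)^2d\mu_f$ lie between 0 and
    $dl^2\|f\|^2$, and the first moments agree. *)
Let star_local B f (c dl : R) : 0 < dl -> measurable B ->
  (forall s, B s -> `|s - c| <= dl) -> conc B f -> dom A f ->
  `|nrm2 (A f) - \int[sm f]_s (s ^+ 2)| <= dl ^+ 2 * nrm2 f.
Proof.
move=> dl0 mB Bc cf Df; have Lf := cf.1; have LAf := opL2 Df.
have w1 := near_eigen dl0 mB Bc cf Df.
have w0 := nrm2_ge0 mu (lin (- c%:C%C) f (A f)).
have we : nrm2 (lin (- c%:C%C) f (A f)) =
    c ^+ 2 * nrm2 f - 2 * c * \int[sm f]_s s + nrm2 (A f).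
  rewrite nrm2_lin// (innerJ Lf LAf) (op_quad saA resA Df) sqr_normc !simpC /=.
  by ring.
have mphi : measurable_fun setT (fun s : measurableTypeR R => (s - c) ^+ 2).
  by apply: measurable_funX; apply: measurable_funB => //; exact: measurable_cst.
have [|I le] := conc_int resA (sqr_ge0 dl) mB cf mphi.
  move=> s /Bc sc; rewrite ger0_norm ?sqr_ge0// -real_normK ?num_real//.
  by rewrite ler_sqr ?nnegrE// ltW.
have I0 := op_int0 resA.
have I1 := op_int1 saA resA Df; have I2 := op_int2 resA Df.
have v0 : 0 <= \int[sm f]_s ((s - c) ^+ 2).
  by apply: Rintegral_ge0 => s _; exact: sqr_ge0.
have ve : \int[sm f]_s ((s - c) ^+ 2) =
    \int[sm f]_s (s ^+ 2) - 2 * c * \int[sm f]_s s + c ^+ 2 * nrm2 f.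
  have J1 : (sm f).-integrable setT (EFin \o (fun s => (2 * c) * s)).
    by have := integrableZl measurableT (2 * c) I1.
  have e s : (s - c) ^+ 2 = s ^+ 2 - (2 * c) * s + c ^+ 2 by ring.
  under eq_Rintegral do rewrite e.
  rewrite RintegralD//; [|by have := integrableB measurableT I2 J1|exact: I0].
  by rewrite RintegralB// RintegralZl// Rintegral_cst// spectral_measureT.
move: le; rewrite ger0_norm// => le.
rewrite ler_norml; apply/andP; split; lra.
Qed.

(** The measure $B\mapsto\|E(B)Af\|^2$ has density $s^2$: on small pieces
    of [B] this holds up to a relative error that tends to 0 with the mesh. *)
Lemma spectral_measure_op f B : dom A f -> measurable B ->
  (sm (A f) B = \int[sm f]_(s in B) (s ^+ 2)%:E)%E.
Proof.
move=> Df mB; have Lf := opL2d Df; have LAf := opL2 Df.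
have I2 := op_int2 resA Df.
suff H dl : 0 < dl -> (sm (A f) B <= \int[sm f]_(s in B) (s ^+ 2)%:E +
      (dl ^+ 2)%:E * sm f B)%E /\ (\int[sm f]_(s in B) (s ^+ 2)%:E <= sm (A f) B +
      (dl ^+ 2)%:E * sm f B)%E.
  have eps (e : R) : 0 < e -> exists2 dl : R, 0 < dl &
      ((dl ^+ 2)%:E * sm f B <= e%:E)%E.
    move=> e0; have k0 : 0 < nrm2 f + 1 by rewrite ltr_wpDl ?nrm2_ge0.
    exists (Num.sqrt (e / (nrm2 f + 1))); first by rewrite sqrtr_gt0 divr_gt0.
    rewrite sqr_sqrtr; last by rewrite divr_ge0 ?ltW.
    apply: (@le_trans _ _ ((e / (nrm2 f + 1))%:E * sm f setT)%E).
      by rewrite lee_pmul2l ?lte_fin ?divr_gt0//; apply: le_measure => //; rewrite inE.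
    rewrite spectral_measureT// -EFinM lee_fin mulrAC ler_pdivrMr//.
    by rewrite ler_pM2l// lerDl.
  apply/eqP; rewrite eq_le; apply/andP; split; apply/lee_addgt0Pr => e /eps[dl /H[h1 h2] h3].
    by apply: le_trans h1 _; rewrite leeD2l.
  by apply: le_trans h2 _; rewrite leeD2l.
move=> dl0.
pose F n := B `&` [set s : R | pickle (Num.floor (s / dl)) = n].
have mF n : measurable (F n).
  apply: measurableI => //.
  have [[s0 h0]|no] := pselect (exists s0, pickle (Num.floor (s0 / dl)) = n).
    set k := Num.floor (s0 / dl) in h0.
    rewrite (_ : [set _ | _] = `[k%:~R * dl, (k + 1)%:~R * dl[%classic)//.
    apply/seteqP; split => s /=; rewrite in_itv/=.
      rewrite -h0 => /(pcan_inj (@pickleK int))/eqP; rewrite floor_eq => /andP[h1 h2].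
      by rewrite -ler_pdivlMr// h1 -ltr_pdivrMr.
    rewrite -ler_pdivlMr// -ltr_pdivrMr// => h; rewrite -h0; congr pickle.
    by apply/eqP; rewrite floor_eq.
  rewrite (_ : [set _ | _] = set0)//.
  by apply/seteqP; split => s //= h; apply: no; exists s.
have tF : trivIset setT F.
  by apply/trivIsetP => i j _ _ ij; apply/seteqP; split => // s /= [[_ hi] [_ hj]];
    move: ij; rewrite -hi -hj eqxx.
have UF : \bigcup_n F n = B.
  apply/seteqP; split => [s [n _ []]//|s Bs].
  by exists (pickle (Num.floor (s / dl))).
have loc n : (sm (A f) (F n) <= \int[sm f]_(s in F n) (s ^+ 2)%:E +
      (dl ^+ 2)%:E * sm f (F n))%E /\ (\int[sm f]_(s in F n) (s ^+ 2)%:E <= sm (A f) (F n) +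
      (dl ^+ 2)%:E * sm f (F n))%E.
  have [[s0 [Bs0 h0]]|no] := pselect (exists s0, F n s0); last first.
    have -> : F n = set0 by apply/seteqP; split => s // Fs; apply: no; exists s.
    by rewrite !measure0 integral_set0 mule0 adde0.
  have Fc s : F n s -> `|s - s0| <= dl.
    move=> [_]; rewrite /= -h0 => /(pcan_inj (@pickleK int)) h.
    have : Num.floor (s / dl) == Num.floor (s0 / dl) by rewrite h.
    rewrite floor_eq => /andP[h1 h2].
    have : Num.floor (s0 / dl) == Num.floor (s0 / dl) by [].
    rewrite {1}floor_eq => /andP[h3 h4].
    have d1 : (s - s0) / dl < 1 by rewrite mulrBl; move: h2 h3; rewrite intrD; lra.
    have d2 : - 1 < (s - s0) / dl by rewrite mulrBl; move: h1 h4; rewrite intrD; lra.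
    rewrite ler_norml; apply/andP; split; apply: ltW.
      by move: d2; rewrite ltr_pdivlMr// mulN1r.
    by move: d1; rewrite ltr_pdivrMr// mul1r.
  have cf := conc_pvm resA (mF n) Lf; have DF := op_dom_pvm resA Df (mF n).
  have LF := EL2 (mF n) Lf.
  have := star_local dl0 (mF n) Fc cf DF.
  have -> : \int[sm (E (F n) f)]_s (s ^+ 2) = \int[sm f]_(s in F n) (s ^+ 2).
    rewrite /Rintegral (op_pvm_le resA)// [in RHS]integral_mkcond; congr fine.
    apply: eq_integral => s _; rewrite patchE indicE; case: ifP => _.
      by rewrite mulr1.
    by rewrite mulr0.
  have -> : (\int[sm f]_(s in F n) (s ^+ 2)%:E)%E =
      (\int[sm f]_(s in F n) (s ^+ 2))%:E.
    have mFn : @measurable _ (measurableTypeR R) (F n) by exact: mF.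
    rewrite /Rintegral fineK//; apply: (integrable_fin_num mFn).
    exact: (integrableS measurableT mFn (@subsetT _ _) I2).
  rewrite (aeq_nrm2 (opL2 DF) (EL2 (mF n) LAf) (op_commute saA resA Df (mF n))).
  rewrite !spectral_measureE// -!EFinM -!EFinD !lee_fin ler_norml => /andP[? ?].
  by split; lra.
have IU : (\int[sm f]_(s in \bigcup_n F n) (s ^+ 2)%:E =
    \sum_(0 <= n <oo) \int[sm f]_(s in F n) (s ^+ 2)%:E)%E.
  apply: (@ge0_integral_bigcup _ (measurableTypeR R)) => //.
    by apply/measurable_funTS/measurable_EFinP.
  by move=> s _; rewrite lee_fin sqr_ge0.
rewrite -UF IU !measure_bigcup//; [|by move=> i _; exact: mF..].
have S0 n : (0 <= \int[sm f]_(s in F n) (s ^+ 2)%:E)%E.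
  by apply: integral_ge0 => s _; rewrite lee_fin sqr_ge0.
have sumT (u : nat -> \bar R) : (\sum_(0 <= i <oo | i \in setT) u i = \sum_(0 <= i <oo) u i)%E.
  by apply: eq_eseriesl => i; rewrite in_setT.
rewrite !sumT -nneseriesZl//.
split; rewrite -nneseriesD//; try by move=> *; rewrite mule_ge0 ?lee_fin ?sqr_ge0.
  by apply: lee_nneseries => // n _; exact: (loc n).1.
by apply: lee_nneseries => // n _; exact: (loc n).2.
Qed.

Section moments.
Variable v : nat -> T -> C.
Hypothesis Dv : forall k, dom A (v k).
Hypothesis vS : forall k, aeq mu (A (v k)) (v k.+1).

Let Lv k : L2 mu (v k). Proof. exact: opL2d. Qed.

Let mX (k : nat) : measurable_fun setT (fun s : measurableTypeR R => s ^+ k).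
Proof. exact: measurable_funX. Qed.

Let evenX_ge0 (s : R) j : 0 <= s ^+ (j.*2).
Proof. by rewrite -mul2n exprM exprn_ge0// sqr_ge0. Qed.

Lemma spectral_measure_iter j B : measurable B ->
  (sm (v j) B = \int[sm (v 0%N)]_(s in B) (s ^+ j.*2)%:E)%E.
Proof.
elim: j B => [|j IH] B mB.
  under eq_integral do rewrite expr0.
  by rewrite integral_cst// mul1e.
rewrite -(spectral_measure_aeq PE (opL2 (Dv j)) (Lv j.+1) (vS j) mB).
rewrite (spectral_measure_op (Dv j) mB) integral_mkcond.
rewrite (@ge0_integral_density _ _ _ (sm (v 0%N)) (sm (v j)) (fun s => s ^+ j.*2))//.
- rewrite [in RHS]integral_mkcond; apply: eq_integral => s _.
  rewrite !patchE; case: ifP => _; last by rewrite mul0e.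
  by rewrite -EFinM -exprD doubleS.
- by apply/(measurable_restrictT _ _).1 => //; apply/measurable_funTS/measurable_EFinP.
- by move=> s; rewrite patchE; case: ifP => // _; rewrite lee_fin sqr_ge0.
Qed.

Lemma inner_shift i j : inner mu (v (i + j)%N) (v 0%N) = inner mu (v i) (v j).
Proof.
elim: j i => [|j IH] i; first by rewrite addn0.
rewrite addnS -addSn IH -(aeq_inner (opL2 (Dv i)) (Lv i.+1) (Lv j) (vS i)).
rewrite (op_sym saA)// (aeq_innerr (Lv i) (opL2 (Dv j)) (Lv j.+1))//.
Qed.

Let moment_even j : (\int[sm (v 0%N)]_s (s ^+ j.*2)%:E = (nrm2 (v j))%:E)%E.
Proof. by rewrite -spectral_measure_iter// spectral_measureT. Qed.

Let moment_int_even j : (sm (v 0%N)).-integrable setT (fun s => (s ^+ j.*2)%:E).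
Proof.
apply/integrableP; split; first exact/measurable_EFinP.
under eq_integral do rewrite gee0_abs ?lee_fin ?evenX_ge0//.
by rewrite moment_even ltry.
Qed.

Lemma moment_integrable k : (sm (v 0%N)).-integrable setT (fun s => (s ^+ k)%:E).
Proof.
have := integrableD measurableT (moment_int_even k./2) (moment_int_even k./2.+1).
apply: le_integrable => //; first exact/measurable_EFinP.
move=> s _ /=; rewrite lee_fin [leRHS]ger0_norm ?addr_ge0 ?evenX_ge0//.
rewrite normrX -[k in leLHS]odd_double_half -!mul2n !exprM -[s ^+ 2]real_normK ?num_real//.
rewrite exprD exprM; have : 0 <= (`|s| ^+ 2) ^+ k./2 by rewrite !exprn_ge0.
rewrite [_ ^+ k./2.+1]exprS; set y := (_ ^+ 2) ^+ _ => y0.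
have s0 := normr_ge0 s; case: (odd k) => /=; rewrite ?expr0 ?expr1; last first.
  by rewrite mul1r lerDl mulr_ge0// exprn_ge0.
have : 0 <= y * (`|s| - 1) ^+ 2 by rewrite mulr_ge0// sqr_ge0.
have : 0 <= y * `|s| by rewrite mulr_ge0.
by lra.
Qed.

(** Half of the factors [A] can be moved to the other side of the inner product,
    where [spectral_measure_iter] turns them into powers of [s]. *)
Lemma moment k : \int[sm (v 0%N)]_s (s ^+ k) = Re (inner mu (v k) (v 0%N)).
Proof.
rewrite -[k]odd_double_half; case: (odd k) => /=; last first.
  by rewrite add0n -addnn inner_shift addnn Re_inner /Rintegral moment_even.
rewrite add1n -addnn -addSn inner_shift addSn addnn.
set j := k./2; rewrite -(aeq_inner (opL2 (Dv j)) (Lv j.+1) (Lv j) (vS j)).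
rewrite (op_quad saA resA (Dv j)) /= /Rintegral; congr fine.
have := @integral_density _ _ _ (sm (v 0%N)) (sm (v j)) (fun s => s ^+ j.*2)
  _ _ _ (fun s => s).
move=> ->//.
- by under [RHS]eq_integral do rewrite -exprS.
- by move=> B mB; exact: spectral_measure_iter.
Qed.

Lemma moment_Im k : Im (inner mu (v k) (v 0%N)) = 0.
Proof.
have := inner_shift 0 k; rewrite add0n (innerJ (Lv 0%N) (Lv k)).
by move/(congr1 (@complex.Im R)); rewrite ImJ; lra.
Qed.

End moments.

End spectral_moments.

(** * Finite measures on the line and their moments *)

Section bounded_functions.
Context {d : measure_display} {X : measurableType d} {R : realType}.
Variable m : {measure set X -> \bar R}.
Hypothesis mT : (m setT < +oo)%E.

Lemma ae_bounded_integrable (u : X -> R) (k : R) : measurable_fun setT u ->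
  {ae m, forall x, `|u x| <= k} -> m.-integrable setT (EFin \o u).
Proof.
move=> mu uk; apply/integrableP; split; first exact/measurable_EFinP.
apply: (@le_lt_trans _ _ (\int[m]_x (`|k|)%:E)%E).
  apply: ae_ge0_le_integral => //.
    by apply/measurable_EFinP; exact: measurableT_comp.
  by apply: filterS uk => x ux _; rewrite lee_fin (le_trans ux) ?ler_norm.
by rewrite integral_cst// lte_mul_pinfty.
Qed.

Lemma bounded_integrable (u : X -> R) (k : R) : measurable_fun setT u ->
  (forall x, `|u x| <= k) -> m.-integrable setT (EFin \o u).
Proof. by move=> mu uk; apply: (@ae_bounded_integrable _ k) => //; exact: aeW. Qed.

Lemma ae_bounded_Rintegral (u : X -> R) (k : R) : 0 <= k -> measurable_fun setT u ->
  {ae m, forall x, `|u x| <= k} -> `|\int[m]_x u x| <= k * fine (m setT).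
Proof.
move=> k0 mu uk; have I := ae_bounded_integrable mu uk.
rewrite -lee_fin EFin_normr_Rintegral//.
apply: le_trans (le_abse_integral _ _ (measurable_int _ I)) _ => //.
rewrite EFinM fineK ?ge0_fin_numE// -(integral_cst m measurableT k%:E).
apply: ae_ge0_le_integral => //.
  by apply/measurable_EFinP; exact: measurableT_comp.
by apply: filterS uk => x ux _; rewrite lee_fin.
Qed.

Variables (c : nat -> R) (phi : R -> R).
Hypothesis mphi : measurable_fun setT phi.
Hypothesis phi_cvg : forall x, (fun n => \sum_(k < n) c k * x ^+ k) @ \oo --> phi x.
Hypothesis c_le : forall k, `|c k| <= (k`!%:R)^-1.

Let partial_le x n : `|\sum_(k < n) c k * x ^+ k| <= expR `|x|.
Proof.
apply: (@le_trans _ _ (series (exp_coeff `|x|) n)).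
  rewrite /series /= big_mkord; apply: le_trans (ler_norm_sum _ _ _) _.
  apply: ler_sum => k _; rewrite normrM normrX /exp_coeff /= mulrC.
  by rewrite ler_wpM2l ?exprn_ge0.
rewrite /expR; apply: nondecreasing_cvgn_le; last exact: is_cvg_series_exp_coeff.
apply/nondecreasing_seqP => k; rewrite /series /= big_nat_recr//= lerDl.
exact: exp_coeff_ge0.
Qed.

(** By dominated convergence: the partial sums of the series of [phi] are at most
    $e^{|t|\rho}$ almost everywhere. *)
Lemma series_integral_cvg (u : X -> R) (rho t : R) : measurable_fun setT u ->
  {ae m, forall x, `|u x| <= rho} ->
  (fun n => \sum_(k < n) c k * t ^+ k * \int[m]_x (u x ^+ k)) @ \oo -->
    \int[m]_x phi (t * u x).
Proof.
move=> mu urho.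
have mtu : measurable_fun setT (fun x => t * u x).
  by apply: measurable_funM => //; exact: measurable_cst.
have Iu k : m.-integrable setT (EFin \o (fun x => u x ^+ k)).
  apply: (@ae_bounded_integrable _ (rho ^+ k)); first exact: measurable_funX.
  apply: filterS urho => x ux; rewrite normrX lerXn2r ?nnegrE//.
  exact: le_trans (normr_ge0 _) ux.
have mp n : measurable_fun setT (fun x => \sum_(k < n) c k * (t * u x) ^+ k).
  apply: measurable_sum => k; apply: measurable_funM; first exact: measurable_cst.
  exact: measurable_funX.
have sumE n : \int[m]_x (\sum_(k < n) c k * (t * u x) ^+ k) =
    \sum_(k < n) c k * t ^+ k * \int[m]_x (u x ^+ k).
  have I n' : m.-integrable setT (EFin \o (fun x => \sum_(k < n') c k * (t * u x) ^+ k)).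
    apply: (@ae_bounded_integrable _ (expR `|t * rho|)); first exact: mp.
    apply: filterS urho => x ux; apply: le_trans (partial_le _ _) _.
    rewrite ler_expR !normrM ler_wpM2l//; apply: le_trans ux _; exact: ler_norm.
  elim: n => [|n IH].
    rewrite big_ord0 /Rintegral integral0_eq// => x _; by rewrite big_ord0.
  rewrite big_ord_recr/= -IH.
  have e x : \sum_(k < n.+1) c k * (t * u x) ^+ k =
      \sum_(k < n) c k * (t * u x) ^+ k + c n * t ^+ n * u x ^+ n.
    by rewrite big_ord_recr/= exprMn mulrA.
  under eq_Rintegral do rewrite e.
  rewrite RintegralD// ?RintegralZl//.
  exact: (integrableZl measurableT (c n * t ^+ n) (Iu n)).
under eq_fun do rewrite -sumE.
have [|||||_ _ h] := @dominated_convergence _ _ _ m setT measurableT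
  (fun n x => (\sum_(k < n) c k * (t * u x) ^+ k)%:E) (fun x => (phi (t * u x))%:E)
  (fun x => (expR `|t * rho|)%:E).
- by move=> n; apply/measurable_EFinP; exact: mp.
- by apply/measurable_EFinP; exact: measurableT_comp.
- apply: aeW => x _; apply: cvg_EFin; first exact: nearW.
  exact: phi_cvg.
- apply: (@bounded_integrable _ `|expR `|t * rho| |) => //; exact: measurable_cst.
- apply: filterS urho => x ux n _; rewrite lee_fin; apply: le_trans (partial_le _ _) _.
  by rewrite ler_expR !normrM ler_wpM2l//; apply: le_trans ux _; exact: ler_norm.
have I : m.-integrable setT (EFin \o (fun x => phi (t * u x))).
  apply: (@ae_bounded_integrable _ (expR `|t * rho|)); first exact: measurableT_comp.
  apply: filterS urho => x ux.
  have := @phi_cvg (t * u x) => /cvg_norm /cvg_lim <- //.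
  apply: limr_le; first by apply/cvg_ex; eexists; apply: cvg_norm; exact: phi_cvg.
  apply: nearW => n; apply: le_trans (partial_le _ _) _.
  by rewrite ler_expR !normrM ler_wpM2l//; apply: le_trans ux _; exact: ler_norm.
rewrite -[X in _ --> X]fineK in h; last exact: (integrable_fin_num measurableT I).
exact: (fine_cvg h).
Qed.

End bounded_functions.

Section cos_sin.
Context {R : realType}.

Let cosc (n : nat) : R := (~~ odd n)%:R * (-1) ^+ n./2 / n`!%:R.
Let sinc (n : nat) : R := (odd n)%:R * (-1) ^+ n.-1./2 / n`!%:R.

Let cosc_le n : `|cosc n| <= (n`!%:R)^-1.
Proof.
rewrite /cosc !normrM normrX normrN normr1 expr1n mulr1 normfV !ger0_norm ?ler0n//.
by rewrite ler_piMl ?invr_ge0 ?ler0n// lern1 leq_b1.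
Qed.

Let sinc_le n : `|sinc n| <= (n`!%:R)^-1.
Proof.
rewrite /sinc !normrM normrX normrN normr1 expr1n mulr1 normfV !ger0_norm ?ler0n//.
by rewrite ler_piMl ?invr_ge0 ?ler0n// lern1 leq_b1.
Qed.

Let cos_cvg (x : R) : (fun n => \sum_(k < n) cosc k * x ^+ k) @ \oo --> cos x.
Proof.
have -> : (fun n => \sum_(k < n) cosc k * x ^+ k) = series (cos_coeff x).
  apply/funext => n; rewrite /series /= big_mkord; apply: eq_bigr => k _.
  by rewrite /cosc /cos_coeff /= -!mulrA [_ / _]mulrC.
rewrite unlock; exact: is_cvg_series_cos_coeff.
Qed.

Let sin_cvg (x : R) : (fun n => \sum_(k < n) sinc k * x ^+ k) @ \oo --> sin x.
Proof.
have -> : (fun n => \sum_(k < n) sinc k * x ^+ k) = series (sin_coeff x).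
  apply/funext => n; rewrite /series /= big_mkord; apply: eq_bigr => k _.
  by rewrite /sinc /sin_coeff /= -!mulrA [_ / _]mulrC.
rewrite unlock; exact: is_cvg_series_sin_coeff.
Qed.

Lemma measurable_cos : measurable_fun setT (@cos R).
Proof. exact: (continuous_measurable_fun (@continuous_cos R)). Qed.

Lemma measurable_sin : measurable_fun setT (@sin R).
Proof. exact: (continuous_measurable_fun (@continuous_sin R)). Qed.

(** The two Fourier transforms are power series in [t] whose coefficients are the
    moments. *)
Lemma moments_cos_sin {d1 d2} {X1 : measurableType d1} {X2 : measurableType d2}
    (m1 : {measure set X1 -> \bar R}) (m2 : {measure set X2 -> \bar R})
    (u1 : X1 -> R) (u2 : X2 -> R) (rho t : R) :
  (m1 setT < +oo)%E -> (m2 setT < +oo)%E ->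
  measurable_fun setT u1 -> measurable_fun setT u2 ->
  {ae m1, forall x, `|u1 x| <= rho} -> {ae m2, forall x, `|u2 x| <= rho} ->
  (forall k, \int[m1]_x (u1 x ^+ k) = \int[m2]_x (u2 x ^+ k)) ->
  \int[m1]_x cos (t * u1 x) = \int[m2]_x cos (t * u2 x) /\
  \int[m1]_x sin (t * u1 x) = \int[m2]_x sin (t * u2 x).
Proof.
move=> f1 f2 mu1 mu2 b1 b2 mom.
have H (c : nat -> R) (phi : R -> R) : measurable_fun setT phi ->
    (forall x, (fun n => \sum_(k < n) c k * x ^+ k) @ \oo --> phi x) ->
    (forall k, `|c k| <= (k`!%:R)^-1) ->
    \int[m1]_x phi (t * u1 x) = \int[m2]_x phi (t * u2 x).
  move=> mphi cphi cle.
  have h1 := series_integral_cvg f1 mphi cphi cle (t := t) mu1 b1.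
  have h2 := series_integral_cvg f2 mphi cphi cle (t := t) mu2 b2.
  apply: (cvg_unique _ h1) => //; apply: cvg_trans h2.
  by apply: near_eq_cvg; apply: nearW => n; apply: eq_bigr => k _; rewrite mom.
split; first exact: (H cosc _ measurable_cos).
exact: (H sinc _ measurable_sin).
Qed.

End cos_sin.

(** Chebyshev's inequality bounds the mass of $|s|>\rho+1$ by
    $M(\rho/(\rho+1))^{2k}$ for every [k]. *)
Lemma moments_support {R : realType}
    (m : {measure set (measurableTypeR R) -> \bar R}) (rho M : R) :
  0 <= rho -> (forall k, (\int[m]_s (s ^+ k.*2)%:E <= (M * rho ^+ k.*2)%:E)%E) ->
  {ae m, forall s : R, `|s| <= rho + 1}.
Proof.
move=> rho0 mom; pose B := [set s : measurableTypeR R | rho + 1 < `|s|].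
have mabs : measurable_fun setT (fun s : measurableTypeR R => `|s|).
  exact: measurableT_comp.
have mB : measurable B.
  rewrite /B; have := mabs measurableT `]rho + 1, +oo[%classic (measurable_itv _).
  rewrite setTI; congr measurable; apply/seteqP; split => s /=;
  by rewrite in_itv/= andbT.
have r1 : 0 < rho + 1 by lra.
have evenX_ge0 (s : R) j : 0 <= s ^+ (j.*2).
  by rewrite -mul2n exprM exprn_ge0// sqr_ge0.
exists B; split => //; last first.
  by move=> s /= /negP; rewrite -ltNge.
pose q := (rho / (rho + 1)) ^+ 2.
have le k : (m B <= (M * q ^+ k)%:E)%E.
  have e : (M * q ^+ k)%:E = (((rho + 1) ^+ k.*2)^-1%:E * (M * rho ^+ k.*2)%:E)%E.
    by rewrite -EFinM /q -exprM mul2n expr_div_n; congr EFin; ring.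
  rewrite e; apply: (@le_trans _ _ (((rho + 1) ^+ k.*2)^-1%:E *
    \int[m]_s (s ^+ k.*2)%:E)%E); last first.
    by rewrite lee_pmul2l// lte_fin invr_gt0 exprn_gt0.
  rewrite -ge0_integralZl_EFin ?invr_ge0 ?evenX_ge0//; last 2 first.
    by move=> s _; rewrite lee_fin.
    by apply/measurable_EFinP; exact: measurable_funX.
  rewrite -(setIT B) -integral_indic//; apply: ge0_le_integral => //.
  - by apply/measurable_EFinP.
  - by apply/measurable_EFinP/measurable_funM => //; exact: measurable_funX.
  - move=> s _; rewrite -EFinM lee_fin indicE.
    case: (boolP (s \in B)) => [|_]; last by rewrite mulr_ge0// ?invr_ge0.
    rewrite inE /B /= => hs.
    rewrite ler_pdivlMl ?exprn_gt0// mulr1 -!mul2n !exprM -(real_normK (num_real s)).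
    rewrite lerXn2r ?nnegrE ?sqr_ge0// ler_sqr ?nnegrE// ltW//.
have q0 : 0 <= q by exact: sqr_ge0.
have q1 : `|q| < 1.
  rewrite ger0_norm// /q expr_lt1//; last by rewrite divr_ge0// ltW.
  by rewrite ltr_pdivrMr// mul1r ltrDl.
apply/eqP; rewrite eq_le measure_ge0 andbT.
have cv : (fun k => (M * q ^+ k)%:E) @ \oo --> (M * 0)%:E.
  apply: cvg_EFin; first exact: nearW.
  by apply: cvgM; [exact: cvg_cst|exact: cvg_expr].
rewrite -[leRHS]/(0%R%:E) -(mulr0 M) -(cvg_lim _ cv)//.
by apply: lime_ge; [apply/cvg_ex; eexists; exact: cv|exact: nearW].
Qed.

Section product_moments.
Context {R : realType}.
Variables m1 m2 : {finite_measure set (measurableTypeR R) -> \bar R}.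
Variable rho : R.
Local Notation m12 := (product_measure1 m1 m2).
Hypothesis rho0 : 0 <= rho.
Hypothesis b1 : {ae m1, forall s : R, `|s| <= rho}.
Hypothesis b2 : {ae m2, forall s : R, `|s| <= rho}.

Let m1T : (m1 setT < +oo)%E.
Proof. by rewrite -ge0_fin_numE//; exact: fin_num_measure. Qed.
Let m2T : (m2 setT < +oo)%E.
Proof. by rewrite -ge0_fin_numE//; exact: fin_num_measure. Qed.

Let m12T : (m12 setT < +oo)%E.
Proof.
rewrite -setXTT; have -> : (m12 (setT `*` setT) = m1 setT * m2 setT)%E.
  by apply: product_measure1E.
by rewrite lte_mul_pinfty// fin_num_measure.
Qed.

Let mfst : measurable_fun setT (fun z : measurableTypeR R * measurableTypeR R => (z.1 : R)).
Proof. exact: measurable_fst. Qed.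
Let msnd : measurable_fun setT (fun z : measurableTypeR R * measurableTypeR R => (z.2 : R)).
Proof. exact: measurable_snd. Qed.

Let F12 : Filter (nbhs (almost_everywhere m12)).
Proof. exact: (ae_filter_ringOfSetsType m12). Qed.
#[local] Existing Instance F12.
Let F1 : Filter (nbhs (almost_everywhere m1)).
Proof. exact: (ae_filter_ringOfSetsType m1). Qed.
#[local] Existing Instance F1.
Let F2 : Filter (nbhs (almost_everywhere m2)).
Proof. exact: (ae_filter_ringOfSetsType m2). Qed.
#[local] Existing Instance F2.

Let b12 : {ae m12, forall z, `|(z.1 : R)| <= rho /\ `|(z.2 : R)| <= rho}.
Proof.
have [N1 [mN1 N10 h1]] := b1; have [N2 [mN2 N20 h2]] := b2.
exists ((N1 `*` setT) `|` (setT `*` N2)); split.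
- by apply: measurableU; exact: measurableX.
- apply: null_set_setU => //; try exact: measurableX.
    apply: (eq_trans (product_measure1E _ _ mN1 measurableT)).
    by apply/eqP; rewrite mule_eq0; apply/orP; left; apply/eqP.
  apply: (eq_trans (product_measure1E _ _ measurableT mN2)).
  by apply/eqP; rewrite mule_eq0; apply/orP; right; apply/eqP.
move=> [x y] /= /not_andP[] h; [left|right]; split => //; first exact: h1.
exact: h2.
Qed.

Let b12D : {ae m12, forall z, `|(z.1 + z.2 : R)| <= rho + rho}.
Proof.
by apply: filterS b12 => z [h1 h2]; rewrite (le_trans (ler_normD _ _))// lerD.
Qed.

Let mf12 (k i j : nat) : measurable_fun setT
  (fun z : measurableTypeR R * measurableTypeR R =>
    (z.1 + z.2 : R) ^+ k * (z.1 : R) ^+ i * (z.2 : R) ^+ j).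
Proof.
apply: measurable_funM; last exact: measurable_funX.
apply: measurable_funM; last exact: measurable_funX.
by apply: measurable_funX; exact: measurable_funD.
Qed.

Let I12 (k i j : nat) : m12.-integrable setT
  (EFin \o (fun z => (z.1 + z.2) ^+ k * z.1 ^+ i * z.2 ^+ j)).
Proof.
apply: (@ae_bounded_integrable _ _ _ _ m12T _ ((rho + rho) ^+ k * rho ^+ i * rho ^+ j)).
  exact: mf12.
apply: filterS2 b12 b12D => z [h1 h2] h3.
rewrite !normrM !normrX !ler_pM ?mulr_ge0 ?exprn_ge0// lerXn2r ?nnegrE ?addr_ge0//.
Qed.

Let fubini_prod (u v : R -> R) (k : R) : measurable_fun setT u ->
  measurable_fun setT v ->
  {ae m1, forall x, `|u x| <= k} -> {ae m2, forall x, `|v x| <= k} ->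
  {ae m12, forall z, `|u z.1 * v z.2| <= k * k} ->
  \int[m12]_z (u z.1 * v z.2) = (\int[m1]_x u x) * (\int[m2]_y v y).
Proof.
move=> mu mv uk vk uvk.
have Iu := ae_bounded_integrable m1T mu uk.
have Iv := ae_bounded_integrable m2T mv vk.
have muv : measurable_fun setT (fun z : measurableTypeR R * measurableTypeR R =>
    u z.1 * v z.2).
  by apply: measurable_funM; exact: measurableT_comp.
have I := ae_bounded_integrable m12T muv uvk.
rewrite {1}/Rintegral -(integral12_prod_meas1 I) /fubini_F /=.
have e x : (\int[m2]_y (u x * v y)%:E)%E = (u x * \int[m2]_y v y)%:E.
  under eq_integral do rewrite EFinM.
  rewrite integralZl// EFinM /Rintegral fineK//.
  exact: (integrable_fin_num measurableT Iv).
under eq_integral do rewrite e mulrC EFinM.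
rewrite integralZl// fineM//; last exact: (integrable_fin_num measurableT Iu).
by rewrite mulrC.
Qed.

Variables (mL : {measure set (measurableTypeR R) -> \bar R}) (N : nat -> nat -> nat -> R).
Hypothesis mLT : (mL setT < +oo)%E.
Hypothesis IL : forall k, mL.-integrable setT (fun s => (s ^+ k)%:E).
Hypothesis momL : forall k, \int[mL]_s (s ^+ k) = N k 0%N 0%N.
Hypothesis NS : forall k i j, N k.+1 i j = N k i.+1 j + N k i j.+1.
Hypothesis N0 : forall i j,
  N 0%N i j = (\int[m1]_x (x ^+ i)) * (\int[m2]_y (y ^+ j)).

Let NE k i j : \int[m12]_z ((z.1 + z.2) ^+ k * z.1 ^+ i * z.2 ^+ j) = N k i j.
Proof.
elim: k i j => [|k IH] i j.
  under eq_Rintegral do rewrite expr0 mul1r.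
  rewrite N0 (@fubini_prod (fun x => x ^+ i) (fun y => y ^+ j)
    (Num.max (rho ^+ i) (rho ^+ j)))//.
  - by apply: filterS b1 => x h; rewrite normrX le_max lerXn2r ?nnegrE.
  - by apply: filterS b2 => x h; rewrite normrX le_max orbC lerXn2r ?nnegrE.
  - apply: filterS b12 => z [h1 h2]; rewrite normrM ler_pM// normrX le_max.
      by rewrite lerXn2r ?nnegrE.
    by rewrite orbC lerXn2r ?nnegrE.
rewrite NS -!IH -RintegralD//.
by apply: eq_Rintegral => z _; rewrite !exprS; ring.
Qed.

Let bL : {ae mL, forall s : R, `|s| <= rho + rho + 1}.
Proof.
apply: (@moments_support _ _ (rho + rho) (fine (m12 setT))).
  by rewrite addr_ge0.
move=> k; have -> : (\int[mL]_s (s ^+ k.*2)%:E = (\int[mL]_s (s ^+ k.*2))%:E)%E.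
  by rewrite /Rintegral fineK//; exact: (integrable_fin_num measurableT (IL _)).
rewrite lee_fin momL -NE mulrC.
apply: le_trans (ler_norm _) _.
apply: (ae_bounded_Rintegral m12T).
- by rewrite -mul2n exprM exprn_ge0 ?sqr_ge0.
- exact: mf12.
- by apply: filterS b12D => z h; rewrite !expr0 !mulr1 normrX lerXn2r ?nnegrE ?addr_ge0.
Qed.

Let addm : measurable_fun setT (fun z : measurableTypeR R * measurableTypeR R => z.1 + z.2 : R).
Proof. exact: measurable_funD. Qed.

(** The recursion [NS] with the initial values [N0] is the one satisfied by the
    integrals of $(x+y)^kx^iy^j$ against the product of [m1] and [m2]. So [mL]
    has the moments of the convolution of [m1] and [m2]; these measures being
    compactly supported, it has the same Fourier transform. *)
Lemma convolution_cos_sin (t : R) :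
  \int[mL]_s cos (t * s) = (\int[m1]_s cos (t * s)) * (\int[m2]_s cos (t * s)) -
     (\int[m1]_s sin (t * s)) * (\int[m2]_s sin (t * s)) /\
  \int[mL]_s sin (t * s) = (\int[m1]_s sin (t * s)) * (\int[m2]_s cos (t * s)) +
     (\int[m1]_s cos (t * s)) * (\int[m2]_s sin (t * s)).
Proof.
have bS : {ae m12, forall z, `|(z.1 + z.2 : R)| <= rho + rho + 1}.
  by apply: filterS b12D => z h; lra.
have mom k : \int[mL]_s (s ^+ k) = \int[m12]_z ((z.1 + z.2) ^+ k).
  by rewrite momL -NE; apply: eq_Rintegral => z _; rewrite !expr0 !mulr1.
have mid : measurable_fun setT (fun x : measurableTypeR R => x : R).
  exact: measurable_id.
have [-> ->] := moments_cos_sin t mLT m12T mid addm bL bS mom.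
have mt : measurable_fun setT (fun x : R => t * x).
  by apply: measurable_funM => //; exact: measurable_cst.
have mc : measurable_fun setT (fun x : R => cos (t * x)).
  by apply: measurableT_comp mt; exact: measurable_cos.
have ms : measurable_fun setT (fun x : R => sin (t * x)).
  by apply: measurableT_comp mt; exact: measurable_sin.
have c1 (x : R) : `|cos x| <= 1 by rewrite ler_norml cos_geN1 cos_le1.
have s1 (x : R) : `|sin x| <= 1 by rewrite ler_norml sin_geN1 sin_le1.
have H (u v : R -> R) : measurable_fun setT u -> measurable_fun setT v ->
    (forall x, `|u x| <= 1) -> (forall x, `|v x| <= 1) ->
    \int[m12]_z (u z.1 * v z.2) = (\int[m1]_x u x) * (\int[m2]_y v y) /\
    m12.-integrable setT (EFin \o (fun z => u z.1 * v z.2)).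
  move=> mu mv u1 v1.
  have uv1 z : `|u z.1 * v z.2| <= 1 * 1 by rewrite normrM ler_pM.
  split; first by apply: (@fubini_prod _ _ 1) => //; exact: aeW.
  apply: (bounded_integrable m12T _ uv1).
  by apply: measurable_funM; exact: measurableT_comp.
have [cc Icc] := H _ _ mc mc (fun=> c1 _) (fun=> c1 _).
have [ss Iss] := H _ _ ms ms (fun=> s1 _) (fun=> s1 _).
have [cs Ics] := H _ _ mc ms (fun=> c1 _) (fun=> s1 _).
have [sc Isc] := H _ _ ms mc (fun=> s1 _) (fun=> c1 _).
split.
  rewrite -cc -ss -RintegralB//; apply: eq_Rintegral => z _.
  by rewrite mulrDr cosD.
rewrite -sc -cs -RintegralD//; apply: eq_Rintegral => z _.
by rewrite mulrDr sinD.
Qed.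

End product_moments.

(** * Borel sets of a product space *)

Lemma second_countable_enum (T : topologicalType) : second_countable (T := T) ->
  exists e : nat -> set T, (forall n, open (e n)) /\
    forall x A, nbhs x A -> exists n, e n x /\ e n `<=` A.
Proof.
move=> [B /countable_injP[f inj] [Bo Bx]].
pose e n := \bigcup_(U in [set U | B U /\ f U = n]) U.
have eE U : B U -> e (f U) = U.
  move=> BU; apply/seteqP; split => x; last by move=> Ux; exists U.
  by move=> [V [BV fV] Vx]; rewrite -(inj V U) ?inE.
exists e; split=> [n|x A /Bx [U [BU Ux] UA]].
  by apply: bigcup_open => U [BU _]; exact: Bo.
by exists (f U); rewrite eE.
Qed.

Section borel_product.
Variables M N : ptopologicalType.
Hypotheses (scM : second_countable (T := M)) (scN : second_countable (T := N)).
Local Notation P := (borel M * borel N)%type.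

Lemma open_measurable_borel (T : ptopologicalType) (A : set T) : open A ->
  @measurable _ (borel T) A.
Proof. by move=> oA; exact: sub_sigma_algebra. Qed.

Lemma continuous_preimage_borel (S T : ptopologicalType) (f : S -> T) (A : set T) :
  continuous f -> @measurable _ (borel T) A -> @measurable _ (borel S) (f @^-1` A).
Proof.
move=> cf; move: A; apply: (@smallest_sub _ _ _
  [set A | @measurable _ (borel S) (f @^-1` A)]).
  split=> [|A mA|F mF] /=.
  - by rewrite preimage_set0.
  - by rewrite setTD preimage_setC; exact: measurableC.
  - by rewrite preimage_bigcup; exact: bigcupT_measurable.
move=> A oA; apply: open_measurable_borel; apply: open_comp oA.
by move=> x _; exact: cf.
Qed.

(** Countable bases of the factors make an open set of the product a countable
    union of open rectangles. *)
Lemma open_measurable_prod (O : set (M * N)) : open O -> @measurable _ P O.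
Proof.
move=> oO.
have [e [eo ex]] := second_countable_enum scM.
have [e' [eo' ex']] := second_countable_enum scN.
pose F (p : nat * nat) : set P := [set z | e p.1 `*` e' p.2 `<=` O /\ (e p.1 `*` e' p.2) z].
have -> : O = \bigcup_n (\bigcup_m F (n, m)).
  apply/seteqP; split => [[x y] Oxy|[x y] [n _ [m _ [FO Fxy]]]]; last exact: FO.
  have : nbhs (x, y) O by exact: open_nbhs_nbhs.
  move=> [[U V] /= [Ux Vy] UVO].
  have [n [enx nU]] := ex x U Ux; have [m [emy mV]] := ex' y V Vy.
  by exists n => //; exists m => //; split => // -[x' y'] [/= ? ?]; apply: UVO;
    split; [exact: nU|exact: mV].
apply: bigcupT_measurable => n; apply: bigcupT_measurable => m.
have [sub|nsub] := pselect (e n `*` e' m `<=` O).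
  rewrite (_ : F (n, m) = e n `*` e' m); last by apply/seteqP; split => z // [].
  by apply: measurableX; exact: open_measurable_borel.
by rewrite (_ : F (n, m) = set0)//; apply/seteqP; split => z // [].
Qed.

Lemma measurable_borel_prod (A : set (M * N)) :
  @measurable _ (borel (M * N)%type) A <-> @measurable _ P A.
Proof.
split.
  apply: smallest_sub; last by move=> O; exact: open_measurable_prod.
  by split; [exact: measurable0|move=> B mB; rewrite setTD; exact: measurableC|
    move=> F mF; exact: bigcupT_measurable].
rewrite measurable_prod_measurableType.
apply: smallest_sub; first by split; [exact: measurable0|move=> B mB; rewrite setTD;
  exact: measurableC|move=> F mF; exact: bigcupT_measurable].
move=> _ [U mU [V mV <-]].
have -> : U `*` V = (fst @^-1` U) `&` (snd @^-1` V) by [].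
by apply: measurableI; apply: continuous_preimage_borel => // z; [exact: cvg_fst|exact: cvg_snd].
Qed.

Lemma measurable_fun_borel_prod d (Y : measurableType d) (f : M * N -> Y) :
  measurable_fun [set: borel (M * N)%type] f <-> measurable_fun [set: P] f.
Proof.
by split => mf _ B mB; apply/measurable_borel_prod; exact: mf.
Qed.

End borel_product.

(** A named copy of [mu], so that a proof of sigma-finiteness can be registered as
    a structure on it. *)
Definition sigma_finite_bundle d (T : measurableType d) (R : realType)
    (mu : {measure set T -> \bar R}) (h : sigma_finite setT mu) : set T -> \bar R := mu.

HB.instance Definition _ d (T : measurableType d) (R : realType)
    (mu : {measure set T -> \bar R}) (h : sigma_finite setT mu) :=
  Measure.on (sigma_finite_bundle h).
HB.instance Definition _ d (T : measurableType d) (R : realType)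
    (mu : {measure set T -> \bar R}) (h : sigma_finite setT mu) :=
  Measure_isSigmaFinite.Build d T R (sigma_finite_bundle h) h.

Section tonelli.
Variables (R : realType) (M N : ptopologicalType).
Hypotheses (scM : second_countable (T := M)) (scN : second_countable (T := N)).
Local Notation P := (borel M * borel N)%type.
Local Notation X := (borel (M * N)%type).
Variables (muM : {measure set (borel M) -> \bar R})
  (muN : {measure set (borel N) -> \bar R}) (muX : {measure set X -> \bar R}).
Hypotheses (sfM : sigma_finite setT muM) (sfN : sigma_finite setT muN).
Hypothesis rect : forall (A : set M) (B : set N),
  @measurable _ (borel M) A -> @measurable _ (borel N) B ->
  muX (A `*` B : set (M * N)) = (muM A * muN B)%E.

Let idXP : measurable_fun [set: X] (id : X -> P).
Proof. by move=> _ B mB; rewrite setTI; apply/(measurable_borel_prod scM scN). Qed.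

(** A sigma-finite product measure is determined by its values on rectangles, so
    [muX] is the product measure. *)
Lemma borel_tonelli (f : M * N -> \bar R) : measurable_fun [set: X] f ->
  (forall z, 0 <= f z)%E ->
  [/\ measurable_fun setT (fun x : borel M => \int[muN]_y f (x, y))%E,
      measurable_fun setT (fun y : borel N => \int[muM]_x f (x, y))%E,
      (\int[muX]_z f z = \int[muM]_x \int[muN]_y f (x, y))%E &
      (\int[muX]_z f z = \int[muN]_y \int[muM]_x f (x, y))%E].
Proof.
move=> /(measurable_fun_borel_prod scM scN) mf f0.
pose mM : {sigma_finite_measure set (borel M) -> \bar R} := sigma_finite_bundle sfM.
pose mN : {sigma_finite_measure set (borel N) -> \bar R} := sigma_finite_bundle sfN.
have e : (\int[muX]_z f z = \int[product_measure1 mM mN]_z f z)%E.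
  transitivity (\int[pushforward muX (id : X -> P)]_z f z)%E.
    apply/esym.
    by apply: (eq_trans (ge0_integral_pushforward idXP muX measurableT mf _)) => // z _.
  apply: eq_measure_integral => A mA _; apply/esym.
  by apply: product_measure_unique => // B D mB mD; exact: rect.
split.
- exact: (@measurable_fun_fubini_tonelli_F _ _ (borel M) (borel N) _ mN f mf f0).
- exact: (@measurable_fun_fubini_tonelli_G _ _ (borel M) (borel N) _ mM f mf f0).
- by rewrite e (@fubini_tonelli1 _ _ (borel M) (borel N) _ mM mN f mf f0).
- by rewrite e (@fubini_tonelli2 _ _ (borel M) (borel N) _ mM mN f mf f0).
Qed.

End tonelli.

(** * Volume measures *)

Section nonneg_integral.
Context d (T : measurableType d) (R : realType) (mu : {measure set T -> \bar R}).
Local Open Scope ereal_scope.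
Import HBNNSimple.

(** For nonnegative functions monotonicity and homogeneity of the integral hold
    without measurability, the integral being a supremum over simple functions. *)
Lemma nonneg_integral_le (f g : T -> \bar R) : (forall x, 0 <= f x) ->
  (forall x, f x <= g x) -> \int[mu]_x f x <= \int[mu]_x g x.
Proof.
move=> f0 fg; have g0 x : 0 <= g x by exact: le_trans (fg x).
rewrite !ge0_integralTE//; apply: le_ereal_sup => _ [h hf <-]; exists h => // x.
exact: le_trans (fg x).
Qed.

Let scale_le (c : R) (f : T -> \bar R) : (0 < c)%R -> (forall x, 0 <= f x) ->
  c%:E * \int[mu]_x f x <= \int[mu]_x (c%:E * f x).
Proof.
move=> c0 f0; rewrite -lee_pdivlMl// ge0_integralTE//; apply: ge_ereal_sup => _ [h hf <-].
rewrite lee_pdivlMl// -sintegralrM ge0_integralTE; last first.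
  by move=> x; rewrite mule_ge0// lee_fin ltW.
apply: ereal_sup_ubound; exists (scale_nnsfun h (ltW c0)) => // x /=.
by rewrite EFinM lee_pmul2l.
Qed.

Lemma nonneg_integralZl (c : R) (f : T -> \bar R) : (0 <= c)%R -> (forall x, 0 <= f x) ->
  \int[mu]_x (c%:E * f x) = c%:E * \int[mu]_x f x.
Proof.
rewrite le_eqVlt => /predU1P[<-|c0] f0.
  by rewrite mul0e integral0_eq// => x _; rewrite mul0e.
apply/eqP; rewrite eq_le scale_le// andbT -lee_pdivrMl//.
have ci0 : (0 < c^-1)%R by rewrite invr_gt0.
have /(scale_le ci0) : forall x, 0 <= c%:E * f x.
  by move=> x; rewrite mule_ge0// lee_fin ltW.
move=> /le_trans; apply; apply: nonneg_integral_le => x.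
  by rewrite !mule_ge0// lee_fin ltW.
by rewrite muleA -EFinM mulVf ?gt_eqF// mul1e.
Qed.

End nonneg_integral.

Section lebesgue_int.
Context {R : realType}.
Local Open Scope ereal_scope.

Lemma lebesgue_int_ge0 n (F : 'rV[R]_n -> \bar R) : (forall v, 0 <= F v) ->
  0 <= lebesgue_int F.
Proof.
elim: n F => [|n IH] F F0 //=; apply: integral_ge0 => x _.
by apply: IH => v; exact: F0.
Qed.

Lemma lebesgue_int_le n (F G : 'rV[R]_n -> \bar R) : (forall v, 0 <= F v) ->
  (forall v, F v <= G v) -> lebesgue_int F <= lebesgue_int G.
Proof.
elim: n F G => [|n IH] F G F0 FG //=; apply: nonneg_integral_le => x.
  by apply: lebesgue_int_ge0 => v; exact: F0.
by apply: IH => v; [exact: F0|exact: FG].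
Qed.

Lemma lebesgue_intZl n (c : R) (F : 'rV[R]_n -> \bar R) : (0 <= c)%R ->
  (forall v, 0 <= F v) ->
  lebesgue_int (fun v => c%:E * F v) = c%:E * lebesgue_int F.
Proof.
elim: n F => [|n IH] F c0 F0 //=.
rewrite -nonneg_integralZl//; last first.
  by move=> x; apply: lebesgue_int_ge0 => v; exact: F0.
by apply: eq_integral => x _; rewrite IH.
Qed.

Let rV_head n : 'I_n.+1 := lshift n (ord0 : 'I_1).

Let rV_indP n (i : 'I_n.+1) : i = rV_head n \/ exists j : 'I_n, i = rshift 1 j.
Proof.
case: (unliftP ord0 i) => [j|] ->; last by left; apply: val_inj.
by right; exists j; apply: val_inj.
Qed.

Let rV_tail n (j : 'I_n) : 'I_n.+1 := rshift 1 j.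

Let cons_head n (x : R) (v : 'rV[R]_n) :
  (row_mx (const_mx x : 'rV[R]_1) v : 'rV[R]_n.+1) 0%R (rV_head n) = x.
Proof. exact: (eq_trans (row_mxEl _ _ _ _) (mxE _ _ _ _)). Qed.

Let cons_tail n (x : R) (v : 'rV[R]_n) (j : 'I_n) :
  (row_mx (const_mx x : 'rV[R]_1) v : 'rV[R]_n.+1) 0%R (rV_tail j) = v 0%R j.
Proof. exact: row_mxEr. Qed.

Definition box n (p : 'rV[R]_n) (e : R) : set 'rV[R]_n :=
  [set v | forall i, `|v 0%R i - p 0%R i| < e]%R.

Lemma lebesgue_int_box n (p : 'rV[R]_n) (e : R) : (0 < e)%R ->
  lebesgue_int (fun v => (\1_(box p e) v)%:E) < +oo.
Proof.
move=> e0; suff : exists2 k : R, (0 <= k)%R & 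
    lebesgue_int (fun v => (\1_(box p e) v)%:E) = k%:E.
  by move=> [k _ ->]; rewrite ltry.
elim: n p => [|n IH] p /=; first by eexists; last reflexivity.
pose p' : 'rV[R]_n := \row_i p 0%R (rshift 1 i).
pose p0 := p 0%R (rV_head n).
have [k k0 kE] := IH p'.
exists (k * (e *+ 2))%R; first by rewrite mulr_ge0// mulrn_wge0// ltW.
have E (x : R) (v : 'rV[R]_n) :
    (\1_(box p e) (row_mx (const_mx x : 'rV[R]_1) v))%:E =
    (\1_(ball p0 e) x)%:E * (\1_(box p' e) v)%:E :> \bar R.
  rewrite -EFinM; congr EFin.
  have mE : (row_mx (const_mx x : 'rV[R]_1) v \in box p e) =
      (x \in (ball p0 e : set R)) && (v \in box p' e) :> bool.
    apply/idP/andP => [|[]]; rewrite !inE.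
      move=> h; split.
        have := h (rV_head n).
        by rewrite cons_head -ball_normE /= distrC.
      by move=> i; have := h (rV_tail i); rewrite cons_tail /p' mxE.
    rewrite -ball_normE /= => h1 h2 i; have [->|[j ->]] := rV_indP i.
      by rewrite cons_head distrC.
    by have := h2 j; rewrite -/(rV_tail j) cons_tail /p' mxE.
  rewrite /indic mE.
  by case: (_ \in _); case: (_ \in _); rewrite /= ?mulr0 ?mulr1.
under eq_integral => x _.
  rewrite (_ : (fun _ => _) = fun v => (\1_(ball p0 e) x)%:E * (\1_(box p' e) v)%:E); last first.
    by apply/funext => v; exact: E.
  rewrite lebesgue_intZl; [|by rewrite indicE|by move=> v; rewrite lee_fin indicE].
  rewrite kE muleC; over.
rewrite nonneg_integralZl//.
rewrite integral_indic//; last exact: measurable_ball.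
rewrite setIT; exact: (congr1 (mule k%:E) (lebesgue_measure_ball p0 (ltW e0))).
Qed.

Lemma lebesgue_int_prod m n (a : 'rV[R]_m -> R) (b : 'rV[R]_n -> R) (c : R) :
  (forall v, 0 <= a v)%R -> (forall v, 0 <= b v)%R ->
  lebesgue_int (fun v => (b v)%:E) = c%:E ->
  lebesgue_int (fun u : 'rV[R]_(m + n) => (a (lsubmx u) * b (rsubmx u))%:E) =
  lebesgue_int (fun v => (a v)%:E) * c%:E.
Proof.
move=> a0 b0 bc; have c0 : (0 <= c)%R.
  by rewrite -lee_fin -bc; apply: lebesgue_int_ge0 => v; rewrite lee_fin.
elim: m a a0 => [|m IH] a a0 /=.
  have -> : (fun u : 'rV[R]_(0 + n) => (a (lsubmx u) * b (rsubmx u))%:E) =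
      (fun u : 'rV[R]_n => (a 0%R)%:E * (b u)%:E).
    apply/funext => u; rewrite EFinM; congr (_%:E * (b _)%:E); last first.
      by apply/rowP => j; rewrite mxE; congr (u _ _); apply: val_inj.
    by congr a; apply/rowP => -[].
  by rewrite lebesgue_intZl// -bc.
rewrite muleC -nonneg_integralZl//; last first.
  by move=> x; apply: lebesgue_int_ge0 => v; rewrite lee_fin.
apply: eq_integral => x _.
have := IH (fun v => a (row_mx (const_mx x : 'rV[R]_1) v)) (fun v => a0 _).
rewrite muleC => <-; congr lebesgue_int; apply/funext => v.
congr (a _ * b _)%:E; apply/rowP => j; rewrite [LHS]mxE.
  have [->|[k ->]] := rV_indP j.
    rewrite (_ : lshift n _ = (rV_head (m + n) : 'I_(m.+1 + n))); last exact: val_inj.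
    by apply: (eq_trans (cons_head _ _)); rewrite cons_head.
  rewrite (_ : lshift n _ = (rV_tail (lshift n k) : 'I_(m.+1 + n))); last exact: val_inj.
  by apply: (eq_trans (cons_tail _ _ _)); rewrite -/(rV_tail k) cons_tail mxE.
rewrite (_ : rshift m.+1 j = (rV_tail (rshift m j) : 'I_(m.+1 + n))); last exact: val_inj.
by apply: (eq_trans (cons_tail _ _ _)); rewrite mxE.
Qed.

End lebesgue_int.

(** Otherwise, the determinant of $(1-s)I+sG$ being a polynomial in [s] that is 1
    at $s=0$, some positive definite matrix on the segment would be singular. *)
Lemma posdef_det_ge0 {R : realType} n (G : 'M[R]_n) :
  (forall v : 'rV[R]_n, v != 0 -> 0 < (v *m G *m v^T) 0 0) -> 0 <= \det G.
Proof.
move=> pos; rewrite leNgt; apply/negP => det0.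
pose Q : 'M[{poly R}]_n := map_mx polyC 1%:M + 'X *: map_mx polyC (G - 1%:M).
have QE s : (\det Q).[s] = \det (1%:M + s *: (G - 1%:M)).
  rewrite -[_.[s]]/(horner_eval s _) -det_map_mx; congr (\det _).
  apply/matrixP => i j; by rewrite !mxE /= /horner_eval !hornerE.
have [s /andP[s0 s1] /rootP] : exists2 s, 0 <= s <= 1 & root (- \det Q) s.
  apply: poly_ivt => //; rewrite !hornerN !QE scale0r addr0 det1 scale1r.
  by rewrite addrC subrK; apply/andP; split; lra.
rewrite hornerN QE => /eqP; rewrite oppr_eq0 => /det0P[v v0 vM].
have := pos v v0; set q := (v *m G *m v^T) 0 0 => q0.
have : (v *m (1%:M + s *: (G - 1%:M)) *m v^T) 0 0 = 0 by rewrite vM mul0mx mxE.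
have -> : v *m (1%:M + s *: (G - 1%:M)) *m v^T =
    (1 - s) *: (v *m v^T) + s *: (v *m G *m v^T).
  rewrite mulmxDr -scalemxAr mulmxBr mulmx1 mulmxDl -scalemxAl mulmxBl.
  move: (v *m v^T) (v *m G *m v^T) => u w.
  by apply/matrixP => i j; rewrite !mxE; ring.
have w0 : 0 < (v *m v^T) 0 0.
  have /rV0Pn[k vk] := v0.
  rewrite mxE (bigD1 k)//= mxE ltr_wpDr//.
    by apply: sumr_ge0 => j _; rewrite mxE -expr2 sqr_ge0.
  by rewrite -expr2 lt_def sqr_ge0 sqrf_eq0 vk.
rewrite mxE [X in X + _]mxE [X in _ + X]mxE -/q; set w := (v *m v^T) 0 0 in w0 *.
have h1 : 0 <= (1 - s) * w by apply: mulr_ge0; [rewrite subr_ge0|exact: ltW].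
have [s_gt0|s_le0] := ltP 0 s.
  by move=> e; have := mulr_gt0 s_gt0 q0; lra.
have -> : s = 0 by apply/le_anti; rewrite s0 s_le0.
by rewrite subr0 mul1r mul0r addr0 => e; rewrite e ltxx in w0.
Qed.

Section volume_measure.
Variable R : realType.
Local Open Scope ereal_scope.

Lemma det_bound n (A : 'M[R]_n) (k : R) : (forall i j, `|A i j| <= k)%R ->
  (\det A <= (#|{perm 'I_n}|)%:R * k ^+ n)%R.
Proof.
move=> Ak; apply: le_trans (ler_norm _) _; apply: le_trans (ler_norm_sum _ _ _) _.
apply: (@le_trans _ _ (\sum_(s : 'S_n) k ^+ n)%R); last first.
  by rewrite mulr_natl -sumr_const.
apply: ler_sum => s _; rewrite normrM normrX normrN1 expr1n mul1r normr_prod.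
rewrite -[n in X in (_ <= X)%R]card_ord -prodr_const.
by apply: ler_prod => i _; rewrite normr_ge0 Ak.
Qed.

Section locally_finite.
Variables (T : ptopologicalType) (g : riemannian_data R T).
Variable mu : {measure set (borel T) -> \bar R}.
Hypotheses (atlas : is_atlas g) (met : is_riemannian_metric g).
Hypothesis vol : is_volume_measure g mu.

(** Near a point the metric coefficients are bounded by continuity, hence so is
    the density $\sqrt{\det g}$, and coordinate boxes have finite measure. *)
Lemma volume_locally_finite (x : T) :
  exists U, [/\ open U, U x, exists i : idx g, U `<=` src i & mu U < +oo].
Proof.
have [cover chart_open pK chart_cont _] := atlas.
have [i ix] := cover x; have [so io] := chart_open i.
have [smooth _ _ _] := met.
pose p := chart i x.
have ip : (chart i @` src i) p by exists x.
have [/(_ p ip) cont _] := smooth i 0%N.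
pose k := (`|metric i p| + 1)%R.
have near1 : \forall q \near p, forall j l, (`|metric i q j l| <= k)%R.
  have : nbhs p (metric i @^-1` (ball (metric i p) 1)).
    by apply: cont; exact: nbhsx_ballx.
  apply: filterS => q [_ pq] j l; have := pq j l; rewrite -ball_normE /= => h.
  rewrite /k -[metric i q j l](subrK (metric i p j l)).
  apply: le_trans (ler_normD _ _) _; rewrite addrC lerD//; last first.
    by rewrite distrC ltW.
  rewrite [leRHS]/Num.norm /= mx_normrE.
  by apply: (le_bigmax _ (fun ij => `|metric i p ij.1 ij.2|%R) (j, l)).
have [e /= e0 eB] : exists2 e : R, (0 < e)%R & ball p e `<=` [set q | forall j l, (`|metric i q j l| <= k)%R].
  by have /nbhs_ballP[e e0 h] := near1; exists e.
pose U := src i `&` chart i @^-1` ball p e.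
have oU : open U.
  rewrite openE => y [iy yb]; rewrite /interior.
  apply: filterI; first exact: open_nbhs_nbhs.
  have := @chart_cont i y (mem_set iy); apply.
  by apply: open_nbhs_nbhs; split => //; exact: ball_open.
exists U; split => //; [by split => //; exact: ballxx|by exists i => y []|].
have sU : U `<=` src i by move=> y [].
rewrite (vol (open_measurable_borel oU) sU).
pose c := Num.sqrt ((#|{perm 'I_(Defs.dim g)}|)%:R * k ^+ Defs.dim g)%R.
have c0 : (0 <= c)%R by exact: sqrtr_ge0.
apply: (@le_lt_trans _ _ (lebesgue_int (fun q => c%:E * (\1_(box p e) q)%:E))).
  apply: lebesgue_int_le => q.
    by rewrite lee_fin mulr_ge0 ?sqrtr_ge0// indicE.
  rewrite -EFinM lee_fin.
  have [/set_mem [y [iy yb] <-]|nq] := boolP (q \in chart i @` U); last first.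
    by rewrite indicE (negbTE nq) mulr0 mulr_ge0// indicE.
  have yB : box p e (chart i y).
    by move=> j; case: yb => _ /(_ 0%R j); rewrite -ball_normE /= distrC.
  rewrite !indicE (mem_set yB) mem_set ?mulr1; last by exists y.
  by apply: ler_wsqrtr; apply: det_bound => j l; exact: (eB _ yb).
rewrite lebesgue_intZl//.
by rewrite lte_mul_pinfty// lebesgue_int_box.
Qed.

Hypothesis sc : second_countable (T := T).

Lemma volume_cover : exists F : nat -> set T, [/\ (forall n, open (F n)),
  \bigcup_n F n = setT, (forall n, F n = set0 \/ exists i : idx g, F n `<=` src i) &
  forall n, mu (F n) < +oo].
Proof.
have [e [eo ex]] := second_countable_enum sc.
pose good n := (exists i : idx g, e n `<=` src i) /\ mu (e n) < +oo.
pose F n := if pselect (good n) then e n else set0.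
exists F; split=> [n||n|n].
- by rewrite /F; case: pselect => h //=; exact: open0.
- apply/seteqP; split => // x _; have [U [oU Ux [i Ui] mU]] := volume_locally_finite x.
  have [n [enx enU]] := ex x U (open_nbhs_nbhs (conj oU Ux)).
  exists n => //; rewrite /F; case: pselect => //= h; exfalso; apply: h; split.
    by exists i; exact: subset_trans enU Ui.
  apply: le_lt_trans mU; apply: le_measure => //; rewrite inE;
    exact: open_measurable_borel.
- by rewrite /F; case: pselect => h /=; [right; exact: h.1|left].
- by rewrite /F; case: pselect => h /=; [exact: h.2|rewrite measure0].
Qed.

Lemma volume_sigma_finite : sigma_finite setT mu.
Proof.
have [F [oF UF _ mF]] := volume_cover; exists F => // n; split => //.
exact: open_measurable_borel.
Qed.

End locally_finite.

Lemma measure_partition d (T : measurableType d) (mu : {measure set T -> \bar R})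
    (D : nat -> set T) (A : set T) : (forall n, measurable (D n)) ->
  trivIset setT D -> \bigcup_n D n = setT -> measurable A ->
  mu A = \sum_(0 <= n <oo) mu (A `&` D n).
Proof.
move=> mD tD UD mA; rewrite -{1}(setIT A) -UD setI_bigcupr measure_semi_bigcup//.
- by move=> n; exact: measurableI.
- exact: trivIset_setIl.
- by apply: bigcupT_measurable => n; exact: measurableI.
Qed.

Section rectangles.
Variables (M N : ptopologicalType) (gM : riemannian_data R M) (gN : riemannian_data R N).
Variables (muM : {measure set (borel M) -> \bar R})
  (muN : {measure set (borel N) -> \bar R})
  (muX : {measure set (borel (M * N)%type) -> \bar R}).
Hypotheses (manM : oriented_riemannian_manifold gM)
  (manN : oriented_riemannian_manifold gN).
Hypotheses (volM : is_volume_measure gM muM) (volN : is_volume_measure gN muN)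
  (volX : is_volume_measure (riemannian_product gM gN) muX).

Let scM : second_countable (T := M). Proof. by case: manM. Qed.
Let scN : second_countable (T := N). Proof. by case: manN. Qed.
Let atM : is_atlas gM. Proof. by case: manM => _ _ []. Qed.
Let atN : is_atlas gN. Proof. by case: manN => _ _ []. Qed.
Let metM : is_riemannian_metric gM. Proof. by case: manM. Qed.
Let metN : is_riemannian_metric gN. Proof. by case: manN. Qed.

Let measurable_rect (A : set M) (B : set N) : @measurable _ (borel M) A ->
  @measurable _ (borel N) B -> @measurable _ (borel (M * N)%type) (A `*` B).
Proof.
move=> mA mB; apply/(measurable_borel_prod scM scN).
exact: (@measurableX _ _ (borel M) (borel N)).
Qed.

(** In a product chart the Gram matrix is block diagonal, so the density is the
    product of the densities of the factors. *)
Let rect_small (i : idx gM) (j : idx gN) (A : set M) (B : set N) :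
  @measurable _ (borel M) A -> @measurable _ (borel N) B ->
  A `<=` src i -> B `<=` src j -> muN B < +oo ->
  muX (A `*` B : set (M * N)) = muM A * muN B.
Proof.
move=> mA mB Ai Bj mBoo.
rewrite (volM mA Ai) (volN mB Bj).
have ABij : (A `*` B : set (M * N)) `<=` @src R _ (riemannian_product gM gN) (i, j).
  by move=> [x y] [/= Ax By]; split; [exact: Ai|exact: Bj].
rewrite (volX (measurable_rect mA mB) ABij).
set F := fun v : 'rV_(Defs.dim gN) => _.
have F0 v : 0 <= F v by rewrite lee_fin mulr_ge0 ?sqrtr_ge0// indicE.
have FE : lebesgue_int F = (fine (lebesgue_int F))%:E.
  by rewrite fineK// ge0_fin_numE ?lebesgue_int_ge0// /F -(volN mB Bj).
pose fa v := (Num.sqrt (\det (metric i v)) * \1_(chart i @` A) v)%R.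
pose fb v := (Num.sqrt (\det (metric j v)) * \1_(chart j @` B) v)%R.
have fa0 v : (0 <= fa v)%R by rewrite mulr_ge0 ?sqrtr_ge0// indicE.
have fb0 v : (0 <= fb v)%R by rewrite mulr_ge0 ?sqrtr_ge0// indicE.
rewrite FE -(lebesgue_int_prod fa0 fb0 FE) /fa /fb.
congr lebesgue_int; apply/funext => u; congr EFin.
  rewrite /riemannian_product /=.
  have -> : (\1_[set row_mx (chart i z.1) (chart j z.2) | z in A `*` B] u : R) =
      (\1_(chart i @` A) (lsubmx u) * \1_(chart j @` B) (rsubmx u))%R.
    rewrite /indic.
    have -> : (u \in [set row_mx (chart i z.1) (chart j z.2) | z in A `*` B]) =
        (lsubmx u \in chart i @` A) && (rsubmx u \in chart j @` B) :> bool.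
      apply/idP/andP => [/set_mem[[x y] [/= Ax By] <-]|[/set_mem[x Ax xu] /set_mem[y By yu]]].
        by rewrite row_mxKl row_mxKr; split; apply/mem_set; [exists x|exists y].
      by apply/mem_set; exists (x, y) => //=; rewrite xu yu hsubmxK.
    by case: (_ \in _); case: (_ \in _); rewrite /= ?mulr0 ?mulr1.
  have [/set_mem[x Ax xu]|] := boolP (lsubmx u \in chart i @` A); last first.
    by move=> nA; rewrite {1 3}/indic (negbTE nA) !(mul0r, mulr0).
  rewrite det_ublock sqrtrM; first by ring.
  have [_ _ pos _] := metM.
  apply: posdef_det_ge0 => v v0; apply: pos => //; exists x => //; exact: Ai.
Qed.

(** Cut both sides of the rectangle along countable partitions into sets that lie
    in a chart and have finite volume. *)
Lemma volume_rectangle (A : set M) (B : set N) :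
  @measurable _ (borel M) A -> @measurable _ (borel N) B ->
  muX (A `*` B : set (M * N)) = muM A * muN B.
Proof.
move=> mA mB.
have sfM := volume_sigma_finite atM metM volM scM.
have sfN := volume_sigma_finite atN metN volN scN.
pose mM : {sigma_finite_measure set (borel M) -> \bar R} := sigma_finite_bundle sfM.
pose mN : {sigma_finite_measure set (borel N) -> \bar R} := sigma_finite_bundle sfN.
pose mP : {measure set (borel M * borel N)%type -> \bar R} := product_measure1 mM mN.
have mPE (A' : set (borel M)) (B' : set (borel N)) : measurable A' -> measurable B' ->
    mP (A' `*` B') = muM A' * muN B' by move=> mA' mB'; exact: product_measure1E.
have [F [oF UF Fsrc Foo]] := volume_cover atM metM volM scM.
have [F' [oF' UF' Fsrc' Foo']] := volume_cover atN metN volN scN.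
pose D : nat -> set (borel M) := seqDU F; pose D' : nat -> set (borel N) := seqDU F'.
have mF n : @measurable _ (borel M) (F n) by exact: open_measurable_borel.
have mF' n : @measurable _ (borel N) (F' n) by exact: open_measurable_borel.
have mD n : measurable (D n).
  by apply: measurableD => //; apply: bigsetU_measurable => k _.
have mD' n : measurable (D' n).
  by apply: measurableD => //; apply: bigsetU_measurable => k _.
have UD : \bigcup_n D n = setT by rewrite -seqDU_bigcup_eq.
have UD' : \bigcup_n D' n = setT by rewrite -seqDU_bigcup_eq.
have tD : trivIset setT D by exact: trivIset_seqDU.
have tD' : trivIset setT D' by exact: trivIset_seqDU.
rewrite -mPE//.
have tX1 : trivIset setT (fun n => D n `*` [set: borel N]).
  apply/trivIsetP => m n _ _ mn; apply/seteqP; split => // -[x y] [[/= h1 _] [h2 _]].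
  by have /trivIsetP/(_ m n I I mn) := tD; move/seteqP => [/(_ x) + _]; apply; split.
have tX2 : trivIset setT (fun n => [set: borel M] `*` D' n).
  apply/trivIsetP => m n _ _ mn; apply/seteqP; split => // -[x y] [[_ /= h1] [_ h2]].
  by have /trivIsetP/(_ m n I I mn) := tD'; move/seteqP => [/(_ y) + _]; apply; split.
have UX1 : \bigcup_n (D n `*` [set: borel N]) = setT.
  apply/seteqP; split => // -[x y] _; have : setT x by [].
  by rewrite -UD => -[n _ Dn]; exists n.
have UX2 : \bigcup_n ([set: borel M] `*` D' n) = setT.
  apply/seteqP; split => // -[x y] _; have : setT y by [].
  by rewrite -UD' => -[n _ Dn]; exists n.
have split2 (S : set (M * N)) : @measurable _ (borel (M * N)%type) S ->
    muX S = \sum_(0 <= n <oo) \sum_(0 <= m <oo)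
      muX (S `&` (D n `*` setT) `&` (setT `*` D' m)).
  move=> mS; rewrite (@measure_partition _ _ muX (fun n => D n `*` setT))//; last first.
    by move=> n; exact: measurable_rect.
  apply: eq_eseriesr => n _.
  rewrite (@measure_partition _ _ muX (fun m => setT `*` D' m))//.
    by move=> m; exact: measurable_rect.
  by apply: measurableI => //; exact: measurable_rect.
have split2P (S : set (borel M * borel N)) : measurable S ->
    mP S = \sum_(0 <= n <oo) \sum_(0 <= m <oo)
      mP (S `&` (D n `*` setT) `&` (setT `*` D' m)).
  move=> mS; rewrite (@measure_partition _ _ mP (fun n => D n `*` setT))//; last first.
    by move=> n; exact: measurableX.
  apply: eq_eseriesr => n _.
  rewrite (@measure_partition _ _ mP (fun m => setT `*` D' m))//.
    by move=> m; exact: measurableX.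
  by apply: measurableI => //; exact: measurableX.
rewrite split2; last exact: measurable_rect.
rewrite split2P; last exact: measurableX.
apply: eq_eseriesr => n _; apply: eq_eseriesr => m _.
have -> : (A `*` B) `&` (D n `*` setT) `&` (setT `*` D' m) = (A `&` D n) `*` (B `&` D' m).
  by apply/seteqP; split => -[x y] /=; [move=> [[[? ?] [? ?]] [? ?]]|
    move=> [[? ?] [? ?]]].
have mAD : @measurable _ (borel M) (A `&` D n) by exact: measurableI.
have mBD : @measurable _ (borel N) (B `&` D' m) by exact: measurableI.
rewrite mPE//.
have AF : A `&` D n `<=` F n by move=> x [_ []].
have BF : B `&` D' m `<=` F' m by move=> x [_ []].
have [F0|[i Fi]] := Fsrc n.
  have -> : A `&` D n = set0 by apply/seteqP; split => // x /AF; rewrite F0.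
  by rewrite set0X !measure0 mul0e.
have [F0|[j Fj]] := Fsrc' m.
  have -> : B `&` D' m = set0 by apply/seteqP; split => // x /BF; rewrite F0.
  by rewrite setX0 !measure0 mule0.
apply: (rect_small (i := i) (j := j)) => //; try exact: subset_trans.
  exact: subset_trans AF Fi.
  exact: subset_trans BF Fj.
by apply: le_lt_trans (Foo' m); apply: le_measure => //; rewrite inE.
Qed.

End rectangles.
End volume_measure.

(** * Tensor products in $L^2$ *)

Section L2_convergence.
Context {d : measure_display} {T : measurableType d} {R : realType}.
Variable mu : {measure set T -> \bar R}.
Local Notation normc := (@Normc.normc R).

(** Dominated convergence, the squares $|f-F_n|^2$ being at most $4|f|^2$. *)
Lemma L2_dominated_cvg (F : nat -> T -> R[i]) (f : T -> R[i]) : L2 mu f ->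
  (forall n, cmeasurable (F n)) -> (forall n x, normc (F n x) <= normc (f x)) ->
  (forall x, (fun n => normc (f x - F n x)) @ \oo --> 0) ->
  (fun n => nrm2 mu (sub f (F n))) @ \oo --> 0.
Proof.
move=> Lf mF Ff cF.
have LF n : L2 mu (F n) by exact: L2_dom (mF n) Lf (Ff n).
have Ls n := L2_sub Lf (LF n).
have Ig : mu.-integrable setT (fun x => (4 * normc (f x) ^+ 2)%:E).
  by have := integrableZl measurableT 4 (L2_int2 Lf).
have [|||||_ _ h] := @dominated_convergence _ _ _ mu setT measurableT
  (fun n x => (normc (sub f (F n) x) ^+ 2)%:E) (fun=> 0%E)
  (fun x => (4 * normc (f x) ^+ 2)%:E).
- by move=> n; apply/measurable_EFinP/measurable_normc2; exact: (L2_meas (Ls n)).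
- exact: measurable_cst.
- apply: aeW => x _; apply: cvg_EFin; first exact: nearW.
  by have := cvgM (cF x) (cF x); rewrite mulr0; apply.
- exact: Ig.
- apply: aeW => x n _; rewrite lee_fin ger0_norm ?sqr_ge0//.
  have : normc (sub f (F n) x) <= 2 * normc (f x).
    rewrite /sub; apply: le_trans (le_normcD _ _) _; rewrite normcN.
    by have := Ff n x; lra.
  by have := normc_ge0 (sub f (F n) x); nra.
rewrite integral0 in h.
have e : (fun n => (nrm2 mu (sub f (F n)))%:E) =
    (fun n => \int[mu]_x (normc (sub f (F n) x) ^+ 2)%:E)%E.
  by apply/funext => n; rewrite -(energyE (Ls n)).
have : (fun n => (nrm2 mu (sub f (F n)))%:E) @ \oo --> 0%:E by rewrite e; exact: h.
by move/fine_cvgP => [].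
Qed.

Lemma L2_dominated_near (F : nat -> T -> R[i]) (f : T -> R[i]) (e : R) : L2 mu f ->
  (forall n, cmeasurable (F n)) -> (forall n x, normc (F n x) <= normc (f x)) ->
  (forall x, (fun n => normc (f x - F n x)) @ \oo --> 0) -> 0 < e ->
  exists n, nrm2 mu (sub f (F n)) < e.
Proof.
move=> Lf mF Ff cF e0; have /cvgrPdist_lt/(_ e e0)[n _ h] := L2_dominated_cvg Lf mF Ff cF.
exists n; have := h n (leqnn n).
by rewrite sub0r normrN ger0_norm ?nrm2_ge0.
Qed.

End L2_convergence.

Section tensors.
Variables (R : realType) (M N : ptopologicalType).
Hypotheses (scM : second_countable (T := M)) (scN : second_countable (T := N)).
Local Notation X := (borel (M * N)%type).
Variables (muM : {measure set (borel M) -> \bar R})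
  (muN : {measure set (borel N) -> \bar R}) (muX : {measure set X -> \bar R}).
Hypotheses (sfM : sigma_finite setT muM) (sfN : sigma_finite setT muN).
Hypothesis rect : forall (A : set M) (B : set N),
  @measurable _ (borel M) A -> @measurable _ (borel N) B ->
  muX (A `*` B : set (M * N)) = (muM A * muN B)%E.
Local Notation C := R[i].
Local Notation normc := (@Normc.normc R).
Local Notation Re := complex.Re.
Local Notation Im := complex.Im.

Lemma measurable_comp_fst d (Y : measurableType d) (u : M -> Y) :
  measurable_fun [set: borel M] u -> measurable_fun [set: X] (fun z => u z.1).
Proof.
move=> mu; apply/(measurable_fun_borel_prod scM scN).
by apply: (measurableT_comp mu); exact: measurable_fst.
Qed.

Lemma measurable_comp_snd d (Y : measurableType d) (u : N -> Y) :
  measurable_fun [set: borel N] u -> measurable_fun [set: X] (fun z => u z.2).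
Proof.
move=> mu; apply/(measurable_fun_borel_prod scM scN).
by apply: (measurableT_comp mu); exact: measurable_snd.
Qed.

Lemma cmeasurable_tensor (f : M -> C) (g : N -> C) :
  cmeasurable (f : borel M -> C) -> cmeasurable (g : borel N -> C) ->
  cmeasurable (tensor f g : X -> C).
Proof.
move=> [rf jf] [rg jg]; apply: cmeasurableM; split.
- exact: (measurable_comp_fst rf).
- exact: (measurable_comp_fst jf).
- exact: (measurable_comp_snd rg).
- exact: (measurable_comp_snd jg).
Qed.

Lemma energy_tensor (f : M -> C) (g : N -> C) : L2 muM f -> L2 muN g ->
  energy muX (tensor f g) = (energy muM f * energy muN g)%E.
Proof.
move=> Lf Lg; have mt := cmeasurable_tensor (L2_meas Lf) (L2_meas Lg).
have mE : measurable_fun [set: X] (fun z => (normc (tensor f g z) ^+ 2)%:E).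
  exact/measurable_EFinP/measurable_normc2.
have z0 z : (0 <= (normc (tensor f g z) ^+ 2)%:E)%E by rewrite lee_fin sqr_ge0.
have [_ _ eX _] := borel_tonelli scM scN sfM sfN rect mE z0.
have e x : (\int[muN]_y (normc (tensor f g (x, y)) ^+ 2)%:E =
    (normc (f x) ^+ 2)%:E * energy muN g)%E.
  rewrite /energy -nonneg_integralZl ?sqr_ge0//; last first.
    by move=> y; rewrite lee_fin sqr_ge0.
  by apply: eq_integral => y _; rewrite /tensor /= Normc.normcM exprMn EFinM.
transitivity (\int[muM]_x ((nrm2 muN g)%:E * (normc (f x) ^+ 2)%:E))%E.
  by rewrite [LHS]eX; apply: eq_integral => x _; rewrite [LHS]e (energyE Lg) muleC.
rewrite nonneg_integralZl ?nrm2_ge0//; last by move=> x; rewrite lee_fin sqr_ge0.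
by rewrite -(energyE Lg) muleC.
Qed.

Lemma L2_tensor (f : M -> C) (g : N -> C) : L2 muM f -> L2 muN g -> L2 muX (tensor f g).
Proof.
move=> Lf Lg; apply/L2E; split; first exact: cmeasurable_tensor (L2_meas Lf) (L2_meas Lg).
by rewrite energy_tensor// (energyE Lf) (energyE Lg) -EFinM ltry.
Qed.

Lemma nrm2_tensor (f : M -> C) (g : N -> C) : L2 muM f -> L2 muN g ->
  nrm2 muX (tensor f g) = nrm2 muM f * nrm2 muN g.
Proof.
by move=> Lf Lg; rewrite nrm2E energy_tensor// (energyE Lf) (energyE Lg).
Qed.

Lemma tensor_linl (c : C) (f f' : M -> C) (g : N -> C) :
  tensor (lin c f f') g = lin c (tensor f g) (tensor f' g).
Proof. by apply/funext => z; rewrite /tensor /lin; ring. Qed.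

Lemma tensor_linr (c : C) (f : M -> C) (g g' : N -> C) :
  tensor f (lin c g g') = lin c (tensor f g) (tensor f g').
Proof. by apply/funext => z; rewrite /tensor /lin; ring. Qed.

(** The norm of a product is the product of the norms, and polarization does
    the rest. *)
Lemma inner_tensor (f f' : M -> C) (g g' : N -> C) : L2 muM f -> L2 muM f' ->
  L2 muN g -> L2 muN g' ->
  inner muX (tensor f g) (tensor f' g') = inner muM f f' * inner muN g g'.
Proof.
move=> Lf Lf' Lg Lg'.
have diag h k k' : L2 muN h -> L2 muM k -> L2 muM k' ->
    inner muX (tensor k h) (tensor k' h) = inner muM k k' * inner muN h h.
  move=> Lh Lk Lk'.
  apply: (@polarization R M (L2 muM)
    (fun k k' => inner muX (tensor k h) (tensor k' h))
    (fun k k' => inner muM k k' * inner muN h h)) => //.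
  - by move=> c u v; exact: L2_lin.
  - by move=> c u v w Lu Lv Lw; rewrite tensor_linl inner_linl//; exact: L2_tensor.
  - by move=> c u v w Lu Lv Lw; rewrite tensor_linl inner_linr//; exact: L2_tensor.
  - by move=> c u v w Lu Lv Lw; rewrite inner_linl//; ring.
  - by move=> c u v w Lu Lv Lw; rewrite inner_linr//; ring.
  - move=> u Lu; rewrite !inner_self ?nrm2_tensor//; last exact: L2_tensor.
    by apply: complex_eq; rewrite !simpC /=; ring.
apply: (@polarization R N (L2 muN)
  (fun k k' => inner muX (tensor f k) (tensor f' k'))
  (fun k k' => inner muM f f' * inner muN k k')) => //.
- by move=> c u v; exact: L2_lin.
- by move=> c u v w Lu Lv Lw; rewrite tensor_linr inner_linl//; exact: L2_tensor.
- by move=> c u v w Lu Lv Lw; rewrite tensor_linr inner_linr//; exact: L2_tensor.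
- by move=> c u v w Lu Lv Lw; rewrite inner_linl//; ring.
- by move=> c u v w Lu Lv Lw; rewrite inner_linr//; ring.
- by move=> u Lu; exact: diag.
Qed.

End tensors.

(** * Grid functions *)

Import HBNNSimple.
Lemma simple_approximation d (T : measurableType d) (R : realType) (f : T -> R) :
  measurable_fun setT f -> (forall x, 0 <= f x) ->
  exists (m : nat -> nat) (c : nat -> nat -> R) (S : nat -> nat -> set T),
  [/\ forall n k, measurable (S n k),
      forall n x, 0 <= \sum_(k < m n) c n k * \1_(S n k) x <= f x &
      forall x, (fun n => \sum_(k < m n) c n k * \1_(S n k) x) @ \oo --> f x].
Proof.
move=> mf f0.
have mF : measurable_fun setT (EFin \o f) by exact/measurable_EFinP.
pose s := nnsfun_approx measurableT mF.
pose l n : seq R := finmap.enum_fset (fset_set (range (s n))).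
have sE n x : \sum_(k < size (l n)) nth 0 (l n) k * \1_(s n @^-1` [set nth 0 (l n) k]) x = s n x.
  by rewrite fimfunE fsbig_finite//= (big_nth 0) big_mkord.
exists (fun n => size (l n)), (fun n k => nth 0 (l n) k),
  (fun n k => s n @^-1` [set nth 0 (l n) k]); split.
- by move=> n k; exact: measurable_funPTI.
- move=> n x; rewrite sE; apply/andP; split; first exact: fun_ge0.
  by rewrite nnsfun_approxE -lee_fin le_approx// => t; rewrite lee_fin.
move=> x; under eq_fun do rewrite sE.
have := @cvg_nnsfun_approx _ _ _ _ measurableT _ mF (fun t _ => f0 t) x I.
by move/fine_cvgP => [].
Qed.

Section grid_functions.
Variables (R : realType) (M N : ptopologicalType).
Hypotheses (scM : second_countable (T := M)) (scN : second_countable (T := N)).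
Local Notation X := (borel (M * N)%type).
Variables (muM : {measure set (borel M) -> \bar R})
  (muN : {measure set (borel N) -> \bar R}) (muX : {measure set X -> \bar R}).
Hypotheses (sfM : sigma_finite setT muM) (sfN : sigma_finite setT muN).
Hypothesis rect : forall (A : set M) (B : set N),
  @measurable _ (borel M) A -> @measurable _ (borel N) B ->
  muX (A `*` B : set (M * N)) = (muM A * muN B)%E.
Local Notation C := R[i].
Local Notation normc := (@Normc.normc R).
Local Notation Re := complex.Re.
Local Notation Im := complex.Im.

(** Step functions on a finite grid of rectangles, supported in a rectangle of
    finite measure. Recording the cells by labels [p] and [q] makes the class
    stable under pointwise operations. *)
Definition grid (G : M * N -> C) : Prop :=
  exists (J1 J2 : finType) (p : M -> J1) (q : N -> J2) (c : J1 -> J2 -> C)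
    (A : set M) (B : set N),
  [/\ (forall i, @measurable _ (borel M) [set x | p x = i]),
      (forall j, @measurable _ (borel N) [set y | q y = j]),
      @measurable _ (borel M) A /\ (muM A < +oo)%E,
      @measurable _ (borel N) B /\ (muN B < +oo)%E &
      forall x y, G (x, y) = c (p x) (q y) /\ (G (x, y) != 0 -> A x /\ B y)].

Lemma grid_map2 (phi : C -> C -> C) (G G' : M * N -> C) : phi 0 0 = 0 ->
  grid G -> grid G' -> grid (fun z => phi (G z) (G' z)).
Proof.
move=> phi0 [J1 [J2 [p [q [c [A [B [mp mq [mA Aoo] [mB Boo] GE]]]]]]]].
move=> [K1 [K2 [p' [q' [c' [A' [B' [mp' mq' [mA' Aoo'] [mB' Boo'] GE']]]]]]]].
exists (J1 * K1)%type, (J2 * K2)%type, (fun x => (p x, p' x)), (fun y => (q y, q' y)),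
  (fun i j => phi (c i.1 j.1) (c' i.2 j.2)), (A `|` A'), (B `|` B').
have fin d (T : measurableType d) (mu : {measure set T -> \bar R}) (S S' : set T) :
    measurable S -> measurable S' -> (mu S < +oo)%E -> (mu S' < +oo)%E ->
    (mu (S `|` S') < +oo)%E.
  move=> mS mS' S1 S2; apply: le_lt_trans (measureU2 _ mS mS') _.
  exact: lte_add_pinfty.
split.
- move=> [i i']; rewrite (_ : [set _ | _] = [set x | p x = i] `&` [set x | p' x = i']).
    exact: measurableI.
  by apply/seteqP; split => x /= [-> ->].
- move=> [i i']; rewrite (_ : [set _ | _] = [set x | q x = i] `&` [set x | q' x = i']).
    exact: measurableI.
  by apply/seteqP; split => x /= [-> ->].
- by split; [exact: measurableU|exact: fin].
- by split; [exact: measurableU|exact: fin].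
move=> x y; have [-> h1] := GE x y; have [-> h2] := GE' x y; split => // h.
have [G0|/h1[]] := eqVneq (c (p x) (q y)) 0; last by move=> ? ?; split; left.
have [G0'|/h2[]] := eqVneq (c' (p' x) (q' y)) 0; last by move=> ? ?; split; right.
by move: h; rewrite G0 G0' phi0 eqxx.
Qed.

Lemma grid_lin (c : C) (G G' : M * N -> C) : grid G -> grid G' -> grid (lin c G G').
Proof. by apply: (@grid_map2 (fun z w => c * z + w)); rewrite mulr0 addr0. Qed.

Lemma grid_map (phi : C -> C) (G : M * N -> C) : phi 0 = 0 -> grid G ->
  grid (fun z => phi (G z)).
Proof. by move=> phi0 gG; exact: (@grid_map2 (fun z _ => phi z) G G phi0 gG gG). Qed.

Lemma grid_rect (A : set M) (B : set N) : @measurable _ (borel M) A ->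
  @measurable _ (borel N) B -> (muM A < +oo)%E -> (muN B < +oo)%E ->
  grid (fun z => (\1_(A `*` B) z)%:C%C).
Proof.
move=> mA mB Aoo Boo.
exists bool, bool, (fun x => x \in A), (fun y => y \in B),
  (fun i j => (i && j)%:R), A, B.
have mem_m d (T : measurableType d) (S : set T) (b : bool) : measurable S ->
    measurable [set x | (x \in S) = b].
  move=> mS; case: b.
    by rewrite (_ : [set _ | _] = S)//; apply/seteqP; split => x /=; [exact: set_mem|exact: mem_set].
  rewrite (_ : [set _ | _] = ~` S); first exact: measurableC.
  apply/seteqP; split => x /=; first by move/negbT; rewrite notin_setE.
  by move=> h; apply/negbTE; rewrite notin_setE.
split => //.
- by move=> i; exact: (@mem_m _ (borel M)).
- by move=> i; exact: (@mem_m _ (borel N)).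
move=> x y; rewrite indicE in_setX /=; split; first by case: (_ && _).
case xA: (x \in A); case yB: (y \in B) => /=; rewrite ?eqxx // => _.
by split; apply: set_mem; rewrite ?xA ?yB.
Qed.

Lemma measurable_grid (G : M * N -> C) (u : C -> R) : grid G ->
  measurable_fun [set: X] (fun z => u (G z)).
Proof.
move=> [J1 [J2 [p [q [c [A [B [mp mq _ _ GE]]]]]]]].
have -> : (fun z : M * N => u (G z)) = fun z =>
    \sum_(i : J1) \sum_(j : J2) u (c i j) * (\1_[set x | p x = i] z.1 *
      \1_[set y | q y = j] z.2).
  apply/funext => -[x y]; rewrite (GE x y).1 (bigD1 (p x))//= (bigD1 (q y))//=.
  rewrite !indicE !mem_set// !mulr1 big1 ?addr0; last first.
    by move=> j jq; rewrite [in X in _ * (_ * X)]indicE memNset ?mulr0//= => /esym/eqP;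
      rewrite (negbTE jq).
  rewrite big1 ?addr0// => i ip; rewrite big1// => j _.
  by rewrite [in X in _ * (X * _)]indicE memNset ?mul0r ?mulr0//= => /esym/eqP;
    rewrite (negbTE ip).
apply: measurable_sum => i; apply: measurable_sum => j.
apply: measurable_funM; first exact: measurable_cst.
apply: measurable_funM.
  by apply: (measurable_comp_fst scM scN); exact: measurable_indic.
by apply: (measurable_comp_snd scM scN); exact: measurable_indic.
Qed.

Lemma cmeasurable_grid (G : M * N -> C) : grid G -> cmeasurable (G : X -> C).
Proof. by move=> gG; split; exact: measurable_grid. Qed.

Lemma grid_bounded (G : M * N -> C) : grid G ->
  exists2 k : R, 0 <= k & forall z, normc (G z) <= k.
Proof.
move=> [J1 [J2 [p [q [c [A [B [mp mq _ _ GE]]]]]]]].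
exists (\sum_i \sum_j normc (c i j)).
  by apply: sumr_ge0 => i _; apply: sumr_ge0 => j _; exact: normc_ge0.
move=> [x y]; rewrite (GE x y).1 (bigD1 (p x))//= (bigD1 (q y))//= -addrA lerDl.
rewrite addr_ge0//; first by apply: sumr_ge0 => j _; exact: normc_ge0.
by apply: sumr_ge0 => i _; apply: sumr_ge0 => j _; exact: normc_ge0.
Qed.

Lemma L2_grid (G : M * N -> C) : grid G -> L2 muX G.
Proof.
move=> gG; have [k k0 Gk] := grid_bounded gG; have mG := cmeasurable_grid gG.
case: gG => [J1 [J2 [p [q [c [A [B [mp mq [mA Aoo] [mB Boo] GE]]]]]]]].
apply/L2E; split => //.
have mAB : @measurable _ X (A `*` B).
  by apply/(measurable_borel_prod scM scN); exact: (@measurableX _ _ (borel M) (borel N)).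
apply: (@le_lt_trans _ _ (\int[muX]_z ((k ^+ 2)%:E * (\1_(A `*` B) z)%:E))%E).
  apply: nonneg_integral_le => [z|[x y]]; first by rewrite lee_fin sqr_ge0.
  rewrite -EFinM lee_fin indicE.
  have [G0|/(GE x y).2[Ax By]] := eqVneq (G (x, y)) 0.
    by rewrite G0 sqr_normc /= expr0n addr0 mulr_ge0 ?sqr_ge0.
  by rewrite mem_set ?mulr1 ?ler_sqr ?nnegrE ?normc_ge0.
rewrite nonneg_integralZl ?sqr_ge0//.
rewrite integral_indic// setIT lte_mul_pinfty ?lee_fin ?sqr_ge0//.
by rewrite rect// lte_mul_pinfty// ge0_fin_numE.
Qed.

Let cl (F : M * N -> C) : Prop := L2 muX F /\
  forall e : R, 0 < e -> exists2 G, grid G & nrm2 muX (sub F G) < e.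

Let cl_grid G : grid G -> cl G.
Proof.
move=> gG; have LG := L2_grid gG; split=> // e e0; exists G => //.
by rewrite ((aeq_nrm2P LG LG).1 (aeq_refl _ _)).
Qed.

Let cl_lin c F F' : cl F -> cl F' -> cl (lin c F F').
Proof.
move=> [LF h] [LF' h']; split=> [|e e0]; first exact: L2_lin.
have k0 : 0 < normc c ^+ 2 + 1 by rewrite ltr_wpDl ?sqr_ge0.
have [G gG hG] := h (e / (4 * (normc c ^+ 2 + 1))) ltac:(by rewrite divr_gt0 ?mulr_gt0).
have [G' gG' hG'] := h' (e / 4) ltac:(by rewrite divr_gt0).
exists (lin c G G'); first exact: grid_lin.
have [LG LG'] := (L2_grid gG, L2_grid gG').
rewrite (_ : sub _ _ = lin c (sub F G) (sub F' G')); last first.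
  by apply/funext => z; rewrite /sub /lin; ring.
apply: le_lt_trans (nrm2_lin_le _ (L2_sub LF LG) (L2_sub LF' LG')) _.
have : normc c ^+ 2 * nrm2 muX (sub F G) <= e / 4 .
  move: hG; rewrite ltr_pdivlMr ?mulr_gt0// => hG.
  have := nrm2_ge0 muX (sub F G); have := sqr_ge0 (normc c); nra.
by lra.
Qed.

Let cl_cl F : L2 muX F -> (forall e : R, 0 < e -> exists2 F', cl F' & nrm2 muX (sub F F') < e) ->
  cl F.
Proof.
move=> LF h; split=> // e e0.
have [F' [LF' h'] FF'] := h (e / 4) ltac:(by rewrite divr_gt0).
have [G gG F'G] := h' (e / 4) ltac:(by rewrite divr_gt0).
exists G => //; apply: le_lt_trans (nrm2_triangle LF LF' (L2_grid gG)) _.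
by lra.
Qed.

Let cl0 : cl (fun=> 0).
Proof.
split; first exact: L2_0; move=> e e0.
exists (fun=> 0); last by rewrite ((aeq_nrm2P (L2_0 _) (L2_0 _)).1 (aeq_refl _ _)).
have -> : (fun=> 0) = (fun z : M * N => (\1_(set0 `*` set0) z)%:C%C) :> (M * N -> C).
  by apply/funext => z; rewrite set0X indicE in_set0.
by apply: grid_rect; rewrite ?measure0.
Qed.

Let cl_sum (I : Type) (s : seq I) (F : I -> M * N -> C) (c : I -> C) :
  (forall i, cl (F i)) -> cl (fun z => \sum_(i <- s) c i * F i z).
Proof.
move=> clF; elim: s => [|i s IH].
  by rewrite (_ : (fun z => _) = fun=> 0)//; apply/funext => z; rewrite big_nil.
rewrite (_ : (fun z => _) = lin (c i) (F i) (fun z => \sum_(i <- s) c i * F i z)).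
  exact: cl_lin.
by apply/funext => z; rewrite big_cons.
Qed.

Let cl_dominated (F : nat -> M * N -> C) f : L2 muX f ->
  (forall n, cl (F n)) -> (forall n x, normc (F n x) <= normc (f x)) ->
  (forall x, (fun n => normc (f x - F n x)) @ \oo --> 0) -> cl f.
Proof.
move=> Lf clF Ff cF; apply: cl_cl => // e e0.
have [n hn] := L2_dominated_near Lf (fun n => L2_meas (clF n).1) Ff cF e0.
by exists (F n).
Qed.

Let ind (S : set (M * N)) : M * N -> C := fun z => (\1_S z)%:C%C.

Let cl_rect A B S : @measurable _ (borel M) A -> @measurable _ (borel N) B ->
  (muM A < +oo)%E -> (muN B < +oo)%E -> @measurable _ X S -> cl (ind (S `&` (A `*` B))).
Proof.
move=> mA mB Aoo Boo mS.
have mAB : @measurable _ X (A `*` B).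
  by apply/(measurable_borel_prod scM scN); exact: (@measurableX _ _ (borel M) (borel N)).
have L2i (S' : set (M * N)) : @measurable _ X S' -> L2 muX (ind (S' `&` (A `*` B))).
  move=> mS'; apply: (@L2_dom _ _ _ _ _ (ind (A `*` B) : X -> C)).
  - split; rewrite /ind /=; last exact: measurable_cst.
    by apply: measurable_indic; exact: measurableI.
  - by apply: L2_grid; exact: grid_rect.
  - move=> z; rewrite /ind /= !expr0n !addr0 !sqrtr_sqr !ger0_norm ?indicE//.
    by rewrite ler_nat in_setI; case: (_ \in _); case: (_ \in _).
have : @measurable _ (borel M * borel N)%type S by apply/(measurable_borel_prod scM scN).
rewrite measurable_prod_measurableType.
move: S {mS}; apply: (@dynkin_induction _ (borel M * borel N)%type
   _ (fun S => cl (ind (S `&` (A `*` B))))).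
- exact: measurable_prod_measurableType.
- move=> _ _ [U mU [V mV <-]] [U' mU' [V' mV' <-]].
  exists (U `&` U'); first exact: measurableI.
  exists (V `&` V'); first exact: measurableI.
  by rewrite setXI.
- by rewrite setTI; apply: cl_grid; exact: grid_rect.
- move=> _ [U mU [V mV <-]]; rewrite -setXI; apply: cl_grid; apply: grid_rect.
  + exact: measurableI.
  + exact: measurableI.
  + by apply: le_lt_trans Aoo; apply: le_measure; rewrite ?inE//; exact: measurableI.
  + by apply: le_lt_trans Boo; apply: le_measure; rewrite ?inE//; exact: measurableI.
- move=> S mS clS.
  have -> : ind (~` S `&` (A `*` B)) =
      lin (-1) (ind (S `&` (A `*` B))) (ind (A `*` B)).
    apply/funext => z; rewrite /lin /ind !indicE !in_setI in_setC.
    by case: (z \in S); case: (z \in _); apply: complex_eq; rewrite !simpC /=; ring.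
  by apply: cl_lin => //; apply: cl_grid; exact: grid_rect.
- move=> F mF tF clF.
  have mU : @measurable _ X (\bigcup_k F k).
    by apply/(measurable_borel_prod scM scN); exact: bigcupT_measurable.
  have ptwE n z : \sum_(k <- iota 0 n) 1 * ind (F k `&` (A `*` B)) z =
      if `[< exists2 k, (k < n)%N & F k z >] then ind (\bigcup_k F k `&` (A `*` B)) z else 0.
    have vanish k : ~ F k z -> 1 * ind (F k `&` (A `*` B)) z = 0.
      by move=> nF; rewrite mul1r /ind indicE memNset //= => -[].
    case: ifP => [/asboolP[k kn Fk]|/negbT/asboolPn nF].
      rewrite (bigD1_seq k) ?iota_uniq ?mem_iota ?add0n //= big1_seq ?addr0.
        rewrite mul1r /ind !indicE !in_setI mem_set// [in RHS]mem_set//.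
        by exists k.
      move=> j /andP[jk _]; apply: vanish => Fj; move/eqP: jk; apply.
      by apply: (tF j k) => //; exists z.
    rewrite big1_seq // => k; rewrite mem_iota add0n /= => kn; apply: vanish => Fk.
    by apply: nF; exists k.
  apply: (cl_dominated (F := fun n z => \sum_(k <- iota 0 n) 1 * ind (F k `&` (A `*` B)) z)).
  + exact: L2i.
  + by move=> n; exact: (cl_sum _ (fun=> 1)).
  + move=> n z; rewrite ptwE; case: ifP => // _.
    by rewrite (_ : normc (0 : C) = 0) ?normc_ge0 //= expr0n addr0 sqrtr0.
  + move=> z; have n0 : normc (0 : C) = 0 by rewrite /= expr0n addr0 sqrtr0.
    apply/cvgrPdist_lt => e e0; have [[k Fk]|nF] := pselect (exists k, F k z).
      near=> n; rewrite ptwE ifT; first by rewrite subrr n0 subrr normr0.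
      by apply/asboolP; exists k => //; near: n; exact: nbhs_infty_gt.
    near=> n; rewrite ptwE ifF.
      rewrite /ind indicE memNset ?subrr ?n0 ?subrr ?normr0//= => -[[k _ Fk] _]; apply: nF.
      by exists k.
    by apply/negbTE/asboolPn => -[k _ Fk]; apply: nF; exists k.
Unshelve. all: by end_near.
Qed.


Let cl_nonneg A B (f : X -> R) : @measurable _ (borel M) A -> @measurable _ (borel N) B ->
  (muM A < +oo)%E -> (muN B < +oo)%E -> measurable_fun setT f ->
  L2 muX (fun z => (f z)%:C%C) -> (forall z, 0 <= f z) ->
  (forall z, ~ (A `*` B) z -> f z = 0) -> cl (fun z => (f z)%:C%C).
Proof.
move=> mA mB Aoo Boo mf Lf f0 fQ.
have [m [c [S [mS Sf cS]]]] := simple_approximation mf f0.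
have sE n z : \sum_(k <- index_enum 'I_(m n)) (c n k)%:C%C * ind (S n k `&` (A `*` B)) z =
    (\1_(A `*` B) z * \sum_(k < m n) c n k * \1_(S n k) z)%:C%C.
  rewrite mulr_sumr rmorph_sum; apply: eq_bigr => k _ /=.
  rewrite /ind -rmorphM /=; congr (_%:C%C); rewrite !indicE in_setI.
  by case: (z \in S n k); case: (z \in _) => /=; ring.
have sQ n z : \1_(A `*` B) z * \sum_(k < m n) c n k * \1_(S n k) z =
    \sum_(k < m n) c n k * \1_(S n k) z.
  have [ABz|nABz] := pselect ((A `*` B) z); first by rewrite indicE mem_set// mul1r.
  have /andP[h1 h2] := Sf n z; rewrite [X in X * _]indicE memNset// mul0r.
  by rewrite (fQ z nABz) in h2; apply/eqP; rewrite eq_le h1 h2.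
apply: (@cl_dominated (fun n z =>
  \sum_(k <- index_enum 'I_(m n)) (c n k)%:C%C * ind (S n k `&` (A `*` B)) z)) => //.
- by move=> n; apply: cl_sum => k; exact: cl_rect.
- move=> n z; rewrite sE sQ /= !expr0n !addr0 !sqrtr_sqr !ger0_norm//.
    by have /andP[] := Sf n z.
  by have /andP[] := Sf n z.
move=> z; under eq_fun do rewrite sE sQ -rmorphB /= expr0n addr0 sqrtr_sqr.
by have := cvg_norm (cvgB (cvg_cst (f z)) (cS z)); rewrite subrr normr0; apply.
Qed.

Let cl_supported A B (F : M * N -> C) : @measurable _ (borel M) A ->
  @measurable _ (borel N) B -> (muM A < +oo)%E -> (muN B < +oo)%E -> L2 muX F ->
  (forall z, ~ (A `*` B) z -> F z = 0) -> cl F.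
Proof.
move=> mA mB Aoo Boo LF FQ; have [mR mI] := L2_meas LF.
have pos (u : X -> R) : measurable_fun setT u -> (forall z, `|u z| <= normc (F z)) ->
    cl (fun z => (Num.max (u z) 0)%:C%C).
  move=> mu uF; have uF' z : `|Num.max (u z) 0| <= normc (F z).
    apply: le_trans (uF z); rewrite ger0_norm ?le_max ?lexx ?orbT//.
    by rewrite ge_max normr_ge0 ler_norm.
  apply: (cl_nonneg mA mB Aoo Boo).
  - exact: measurable_maxr.
  - apply: (@L2_dom _ _ _ _ _ (F : X -> C)) => //.
      by split => /=; [exact: measurable_maxr|exact: measurable_cst].
    by move=> z; rewrite /= expr0n addr0 sqrtr_sqr.
  - by move=> z; rewrite le_max lexx orbT.
  - move=> z /FQ Fz; apply/eqP; rewrite -normr_le0; apply: le_trans (uF' z) _.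
    by rewrite Fz /= expr0n addr0 sqrtr0.
have -> : F = lin 1 (fun z => (Num.max (Re (F z)) 0)%:C%C)
   (lin (-1) (fun z => (Num.max (- Re (F z)) 0)%:C%C)
   (lin 'i%C (fun z => (Num.max (Im (F z)) 0)%:C%C)
   (lin (- 'i%C) (fun z => (Num.max (- Im (F z)) 0)%:C%C) (fun=> 0)))).
  apply/funext => z; rewrite /lin.
  have h (x : R) : Num.max x 0 - Num.max (- x) 0 = x.
    by case: (leP x 0) => h1; case: (leP (- x) 0) => h2; lra.
  apply: complex_eq; rewrite !simpC /= ?ImD /=.
    by rewrite -[LHS](h (Re (F z))); ring.
  by rewrite -[LHS](h (Im (F z))); ring.
apply: cl_lin; first by apply: pos => // z; exact: Re_le_normc.
apply: cl_lin.
  by apply: pos => [|z]; [exact: measurableT_comp|rewrite normrN; exact: Re_le_normc].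
apply: cl_lin; first by apply: pos => // z; exact: Im_le_normc.
apply: cl_lin => //.
by apply: pos => [|z]; [exact: measurableT_comp|rewrite normrN; exact: Im_le_normc].
Qed.

Lemma rectangle_exhaustion : exists (A : nat -> set M) (B : nat -> set N),
  [/\ forall n, @measurable _ (borel M) (A n) /\ @measurable _ (borel N) (B n),
      forall n, (muM (A n) < +oo)%E /\ (muN (B n) < +oo)%E &
      forall z, \forall n \near \oo, (A n `*` B n) z].
Proof.
have [A [TA Ai mA]] := (sigma_finiteP _ _).1 sfM.
have [B [TB Bi mB]] := (sigma_finiteP _ _).1 sfN.
exists A, B; split=> [n|n|[x y]].
- by split; [exact: (mA n).1|exact: (mB n).1].
- by split; [exact: (mA n).2|exact: (mB n).2].
have [i _ Ax] : (\bigcup_i A i) x by rewrite -TA.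
have [j _ By] : (\bigcup_i B i) y by rewrite -TB.
exists (maxn i j) => // n /=; rewrite geq_max => /andP[ni nj]; split => /=.
  by move: Ax; apply/subsetPset/Ai.
by move: By; apply/subsetPset/Bi.
Qed.

(** The sets whose indicator is a limit of grid functions, inside a rectangle of
    finite measure, form a Dynkin system containing the rectangles, hence all
    Borel sets. Simple functions and dominated convergence do the rest. *)
Lemma grid_dense (F : M * N -> C) (e : R) : L2 muX F -> 0 < e ->
  exists2 G, grid G & nrm2 muX (sub F G) < e.
Proof.
move=> LF; suff: cl F by case=> _; apply.
have [A [B [mAB finAB exh]]] := rectangle_exhaustion.
have n0 : normc (0 : C) = 0 by rewrite /= expr0n addr0 sqrtr0.
have le n z : normc (F z * ind (A n `*` B n) z) <= normc (F z).
  by rewrite /ind indicE; case: (_ \in _); rewrite ?mulr1 ?mulr0 ?n0 ?normc_ge0.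
have m n : @measurable _ X (A n `*` B n).
  apply/(measurable_borel_prod scM scN); have [mA mB] := mAB n.
  exact: (@measurableX _ _ (borel M) (borel N)).
have Ln n : L2 muX (fun z => F z * ind (A n `*` B n) z).
  apply: (@L2_dom _ _ _ _ _ (F : X -> C)) => //.
  apply: cmeasurableM; first exact: (L2_meas LF).
  by split; [exact: measurable_indic|exact: measurable_cst].
apply: (@cl_dominated (fun n z => F z * ind (A n `*` B n) z)) => //.
- move=> n; have [[mA mB] [Aoo Boo]] := (mAB n, finAB n).
  apply: (cl_supported mA mB Aoo Boo) => // z nz.
  by rewrite /ind indicE memNset ?mulr0.
- move=> z; apply/cvgrPdist_lt => e' e0; have [k _ hk] := exh z.
  exists k => // n /hk Qz; rewrite /ind indicE mem_set// mulr1 subrr n0 subrr normr0.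
  exact: e0.
Qed.

(** Pick a point in every nonempty cell of the first variable: $b_i$ is the slice
    of [G] at that point, and 0 if the cell is empty. *)
Lemma grid_decomposition (G : M * N -> C) (m : R) : grid G ->
  (forall z, normc (G z) <= m) ->
  exists (J : finType) (A : J -> set M) (b : J -> N -> C) (B : set N),
  [/\ forall i, @measurable _ (borel M) (A i) /\ (muM (A i) < +oo)%E,
      @measurable _ (borel N) B /\ (muN B < +oo)%E,
      forall i, cmeasurable (b i : borel N -> C) /\
        forall y, normc (b i y) <= m /\ (~ B y -> b i y = 0),
      forall i j x, A i x -> A j x -> i = j &
      forall x y, G (x, y) = \sum_i (\1_(A i) x)%:C%C * b i y].
Proof.
move=> [J1 [J2 [p [q [c [A [B [mp mq [mA Aoo] mB GE]]]]]]]] Gm.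
pose D (i : J1) := [set x | p x = i] `&` A.
pose b i y : C := if pselect (exists x, D i x) is left h then G (projT1 (cid h), y) else 0.
have bE i x y : D i x -> b i y = G (x, y).
  move=> Dx; rewrite /b; case: pselect => [h|[]]; last by exists x.
  have /= [px _] := projT2 (cid h); case: Dx => /= px' _.
  by rewrite (GE _ y).1 (GE x y).1 px px'.
exists J1, D, b, B; split => //.
- move=> i; have mD : @measurable _ (borel M) (D i) by apply: measurableI.
  split => //; apply: le_lt_trans Aoo; apply: le_measure; rewrite ?inE//.
  exact: subIsetr.
- move=> i; split; last first.
    move=> y; rewrite /b; case: pselect => [h|_] /=; last first.
      split=> //; rewrite expr0n addr0 sqrtr0.
      exact: le_trans (normc_ge0 _) (Gm (point, y)).
    split=> // nB; apply/eqP; apply: contrapT => /negP G0; apply: nB.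
    by have [_ By] := (GE _ y).2 G0; exact: By.
  rewrite /b; case: pselect => [h|_]; last exact: cmeasurable_cst.
  set x := projT1 _.
  have mu (u : C -> R) : measurable_fun [set: borel N] (fun y => u (G (x, y))).
    rewrite (_ : (fun y => _) = fun y => \sum_(j : J2) u (c (p x) j) * \1_[set y | q y = j] y).
      apply: measurable_sum => j; apply: measurable_funM; first exact: measurable_cst.
      exact: measurable_indic.
    apply/funext => y; rewrite (GE x y).1 (bigD1 (q y))//= indicE mem_set// mulr1.
    rewrite big1 ?addr0// => j jq; rewrite indicE memNset ?mulr0//= => /esym/eqP.
    by rewrite (negbTE jq).
  by split; exact: mu.
- by move=> i j x [/= <- _] [/= <- _].
move=> x y; have [Ax|nAx] := pselect (A x).
  rewrite (bigD1 (p x))//= indicE mem_set// mul1r (bE (p x) x)// big1 ?addr0// => i ip.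
  by rewrite indicE memNset ?mul0r//= => -[/= pi _]; move: ip; rewrite pi eqxx.
rewrite big1 => [|i _]; last by rewrite indicE memNset ?mul0r//= => -[].
by apply/eqP; apply: contrapT => /negP /((GE x y).2)[].
Qed.

Lemma L2_ind (d : measure_display) (T : measurableType d) (mu : {measure set T -> \bar R})
    (A : set T) : measurable A -> (mu A < +oo)%E -> L2 mu (fun x => (\1_A x)%:C%C).
Proof.
move=> mA Aoo; apply/L2E; split.
  by split; [exact: measurable_indic|exact: measurable_cst].
rewrite /energy (_ : (\int[mu]_x _)%E = (\int[mu]_x (\1_A x)%:E)%E).
  by rewrite integral_indic// setIT.
apply: eq_integral => x _; rewrite sqr_normc /= expr0n addr0 indicE.
by case: (_ \in _); rewrite ?expr1n ?expr0n.
Qed.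

Lemma L2_bounded (d : measure_display) (T : measurableType d)
    (mu : {measure set T -> \bar R}) (B : set T) (f : T -> C) (m : R) :
  measurable B -> (mu B < +oo)%E -> cmeasurable f ->
  (forall y, normc (f y) <= m /\ (~ B y -> f y = 0)) -> L2 mu f.
Proof.
move=> mB Boo mf fm; have L := L2_scale m%:C%C (L2_ind mB Boo).
apply: (L2_dom mf L) => y; have [fy fB] := fm y; rewrite Normc.normcM indicE.
have n0 : normc (0 : C) = 0 by rewrite /= expr0n addr0 sqrtr0.
have [By|nB] := pselect (B y); last by rewrite fB// n0 mulr_ge0 ?normc_ge0.
rewrite mem_set// /= !expr0n !addr0 !sqrtr_sqr normr1 mulr1.
exact: le_trans fy (ler_norm _).
Qed.

End grid_functions.

(** * Unitary groups *)

(** The same device as [sigma_finite_bundle], for finite measures. *)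
Definition finite_bundle d (T : measurableType d) (R : realType)
    (mu : {measure set T -> \bar R}) (h : fin_num_fun mu) : set T -> \bar R := mu.

HB.instance Definition _ d (T : measurableType d) (R : realType)
    (mu : {measure set T -> \bar R}) (h : fin_num_fun mu) :=
  Measure.on (finite_bundle h).
HB.instance Definition _ d (T : measurableType d) (R : realType)
    (mu : {measure set T -> \bar R}) (h : fin_num_fun mu) :=
  Measure_isFinite.Build d T R (finite_bundle h) h.

Section bounded_operator.
Context {d : measure_display} {T : measurableType d} {R : realType}.
Variable mu : {measure set T -> \bar R}.
Local Notation C := R[i].
Local Notation Re := complex.Re.
Local Notation Im := complex.Im.
Local Notation normc := (@Normc.normc R).
Local Notation nrm2 := (nrm2 mu).
Implicit Types (f g h : T -> C).

Lemma eq0_of_normc_le (z : C) (k : R) : 0 <= k ->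
  (forall e : R, 0 < e -> normc z <= k * e) -> z = 0.
Proof.
move=> k0 h; apply: Normc.eq0_normc; apply/eqP; rewrite eq_le normc_ge0 andbT.
apply/ler_addgt0Pl => e e0; rewrite addr0.
apply: le_trans (h (e / (k + 1)) _) _; first by rewrite divr_gt0// ltr_wpDl.
by rewrite mulrCA ger_pMr// ler_pdivrMr ?mul1r ?lerDl// ltr_wpDl.
Qed.

(** A selfadjoint operator is closed, being equal to its adjoint. *)
Lemma selfadjoint_closed (A : unbounded_operator T R) F G : selfadjoint mu A ->
  L2 mu F -> L2 mu G ->
  (forall e : R, 0 < e -> exists2 u, dom A u &
     nrm2 (sub F u) <= e /\ nrm2 (sub G (A u)) <= e) ->
  dom A F /\ aeq mu (A F) G.
Proof.
move=> saA LF LG h.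
suff [DF _ AF] : graph mu A F G by [].
case: (saA) => _ _ gr; apply/gr; split => // u Du.
have [Lu LAu] := (op_L2d saA Du, op_L2 saA Du).
apply/eqP; rewrite -subr_eq0; apply/eqP.
apply: (@eq0_of_normc_le _ (Num.sqrt (nrm2 (A u)) + Num.sqrt (nrm2 u))).
  by rewrite addr_ge0 ?sqrtr_ge0.
move=> e e0; have [v Dv [Fv Gv]] := h (e ^+ 2) ltac:(by rewrite exprn_gt0).
have [Lv LAv] := (op_L2d saA Dv, op_L2 saA Dv).
have -> : inner mu (A u) F - inner mu u G =
    inner mu (A u) (sub F v) - inner mu u (sub G (A v)).
  by rewrite !inner_subr// (op_sym saA Du Dv); ring.
have sq (w : T -> C) : nrm2 w <= e ^+ 2 -> Num.sqrt (nrm2 w) <= e.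
  by move=> we; rewrite -(ger0_norm (ltW e0)) -sqrtr_sqr ler_wsqrtr.
apply: le_trans (le_normcD _ _) _; rewrite mulrDl; apply: lerD.
  apply: le_trans (normc_inner_le LAu (L2_sub LF Lv)) _.
  by rewrite ler_wpM2l ?sqrtr_ge0// sq.
rewrite normcN; apply: le_trans (normc_inner_le Lu (L2_sub LG LAv)) _.
by rewrite ler_wpM2l ?sqrtr_ge0// sq.
Qed.

Variable V : (T -> C) -> T -> C.
Hypothesis linV : linear_operator mu (L2 mu) V.

Lemma lop_inner_linl c f g h : L2 mu f -> L2 mu g -> L2 mu h ->
  inner mu (V (lin c f g)) h = c * inner mu (V f) h + inner mu (V g) h.
Proof.
move=> Lf Lg Lh; have [Lvf Lvg] := (lop_L2 linV Lf, lop_L2 linV Lg).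
rewrite -inner_linl//; apply: aeq_inner => //; last exact: (lop_lin linV).
- exact: (lop_L2 linV (L2_lin c Lf Lg)).
- exact: L2_lin.
Qed.

(** A bound on the quadratic form bounds the operator, by polarization. *)
Lemma quadratic_form_bound f :
  (forall g, L2 mu g -> `|Re (inner mu (V g) g)| <= nrm2 g /\
                        `|Im (inner mu (V g) g)| <= nrm2 g) ->
  L2 mu f -> nrm2 (V f) <= 4 * nrm2 f.
Proof.
move=> hQ Lf; have LV := lop_L2 linV Lf.
pose g := lin 2^-1 (V f) (fun=> 0); have Lg : L2 mu g by apply: L2_lin => //; exact: L2_0.
have bfg : inner mu (V f) g = (2^-1 * nrm2 (V f))%:C%C.
  rewrite /g inner_linr//; last exact: L2_0.
  rewrite (innerJ LV (L2_0 mu)) inner0l (inner_self LV).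
  by apply: complex_eq; rewrite !simpC /= ?oppr0; field.
have ng : nrm2 g = 4^-1 * nrm2 (V f).
  rewrite /g nrm2_lin//; last exact: L2_0.
  rewrite (innerJ LV (L2_0 mu)) inner0l /nrm2 inner0l sqr_normc !simpC /=.
  by field.
move: g Lg bfg ng => g Lg bfg ng.
have Q c : inner mu (V (lin c g f)) (lin c g f) =
    c * conjc c * inner mu (V g) g + c * inner mu (V g) f + conjc c * inner mu (V f) g
    + inner mu (V f) f.
  have Ll := L2_lin c Lg Lf; have [LVg LVl] := (lop_L2 linV Lg, lop_L2 linV Ll).
  by rewrite lop_inner_linl// !inner_linr//; ring.
have n c : nrm2 (lin c g f) = normc c ^+ 2 * nrm2 g + 2 * Re (c * inner mu g f) + nrm2 f.
  exact: nrm2_lin.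
have h c := hQ _ (L2_lin c Lg Lf).
have [/ler_normlP[h1 h1'] _] := h 1; have [/ler_normlP[h2 h2'] _] := h (-1).
have [_ /ler_normlP[h3 h3']] := h 'i%C; have [_ /ler_normlP[h4 h4']] := h (- 'i%C).
move: h1 h1' h2 h2' h3 h3' h4 h4'.
rewrite (Q 1) (Q (-1)) (Q 'i%C) (Q (- 'i%C)) (n 1) (n (-1)) (n 'i%C) (n (- 'i%C)).
rewrite bfg ng; have := nrm2_ge0 mu (V f); move: (nrm2 (V f)) (nrm2 f) => x y.
move: (inner mu (V g) g) (inner mu (V g) f) (inner mu (V f) f) (inner mu g f) => z1 z2 z3 z4.
by rewrite !sqr_normc !simpC /=; lra.
Qed.
End bounded_operator.

Section unitary_group.
Context {d : measure_display} {T : measurableType d} {R : realType}.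
Variable mu : {measure set T -> \bar R}.
Local Notation C := R[i].
Local Notation Re := complex.Re.
Local Notation Im := complex.Im.
Local Notation nrm2 := (nrm2 mu).
Variables (A : unbounded_operator T R) (E : set R -> (T -> C) -> T -> C).
Variable (U : R -> (T -> C) -> T -> C).
Hypothesis resA : spectral_resolution mu A E.
Hypothesis UE : forall t, linear_operator mu (L2 mu) (U t) /\
  forall f, L2 mu f -> inner mu (U t f) f =
    Complex (fine (\int[scalar_measure mu E f]_s (cos (t * s))%:E)%E)
            (fine (\int[scalar_measure mu E f]_s (sin (t * s))%:E)%E).
Local Notation sm := (spectral_measure mu E).

Let PE : projection_valued_measure mu E. Proof. by case: resA. Qed.

Lemma unitary_form t f : L2 mu f ->
  inner mu (U t f) f = Complex (\int[sm f]_s cos (t * s)) (\int[sm f]_s sin (t * s)).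
Proof.
by move=> Lf; rewrite (UE t).2// !(integral_scalar_measure PE).
Qed.

(** The quadratic form is bounded because cosine and sine are; polarization costs
    the factor 4. *)
Lemma unitary_bound t f : L2 mu f -> nrm2 (U t f) <= 4 * nrm2 f.
Proof.
apply: (quadratic_form_bound (UE t).1) => g Lg; rewrite unitary_form//=.
have n g0 : 0 <= nrm2 g0 by exact: nrm2_ge0.
have mt : measurable_fun setT (fun s : measurableTypeR R => t * s).
  by apply: measurable_funM; [exact: measurable_cst|exact: measurable_id].
have b (phi : R -> R) : measurable_fun setT phi -> (forall s, `|phi s| <= 1) ->
    `|\int[sm g]_s phi (t * s)| <= nrm2 g.
  move=> mphi p1; rewrite -[leRHS]mul1r.
  rewrite (_ : nrm2 g = fine (sm g setT)); last by rewrite spectral_measureT.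
  apply: ae_bounded_Rintegral => //; first exact: spectral_measure_fin.
    exact: (measurableT_comp mphi mt).
  exact: aeW.
split; apply: b.
- exact: measurable_cos.
- by move=> s; rewrite ler_norml cos_geN1 cos_le1.
- exact: measurable_sin.
- by move=> s; rewrite ler_norml sin_geN1 sin_le1.
Qed.

Lemma unitary_close t f g : L2 mu f -> L2 mu g ->
  nrm2 (sub (U t f) (U t g)) <= 4 * nrm2 (sub f g).
Proof.
move=> Lf Lg; have lU := (UE t).1; have Ls := L2_sub Lf Lg.
have [LUf LUg] := (lop_L2 lU Lf, lop_L2 lU Lg).
rewrite -(aeq_nrm2 (lop_L2 lU Ls) (L2_sub LUf LUg) (lop_sub lU Lf Lg)).
exact: unitary_bound.
Qed.

Local Notation cut n := (`[- (n%:R : R), n%:R]%classic : set R).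

(** On these vectors all powers of [A] are defined and moments are available. *)
Definition spectrally_bounded (f : T -> C) : Prop :=
  exists n : nat, concentrated mu E (cut n) f.

Lemma measurable_cut (n : nat) : measurable (cut n). Proof. exact: measurable_itv. Qed.

Lemma cut_le (n : nat) s : cut n s -> `|s| <= n%:R.
Proof. by rewrite /= in_itv /= ler_norml. Qed.

Lemma conc_mono (n m : nat) f : (n <= m)%N -> concentrated mu E (cut n) f ->
  concentrated mu E (cut m) f.
Proof.
move=> nm [Lf nf]; split=> //; have [mn mm] := (measurable_cut n, measurable_cut m).
have linm : linear_operator mu (L2 mu) (E (cut m)) by case: PE => + _ _ _ _; apply.
have LEn := pvm_L2 PE mn Lf.
apply: (aeq_trans (aeq_sym (lop_aeq linm LEn (L2_meas Lf) nf))).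
apply: aeq_trans nf; apply: aeq_trans (aeq_sym (pvm_I PE mm mn Lf)) _.
rewrite (_ : cut m `&` cut n = cut n); first exact: aeq_refl.
apply/seteqP; split => s /=; first by case.
have : n%:R <= m%:R :> R by rewrite ler_nat.
by rewrite !in_itv /= => ? /andP[? ?]; split; apply/andP; split; lra.
Qed.

Lemma spectrally_bounded_L2 f : spectrally_bounded f -> L2 mu f.
Proof. by case=> n []. Qed.

Lemma spectrally_bounded_lin c f g : spectrally_bounded f -> spectrally_bounded g ->
  spectrally_bounded (lin c f g).
Proof.
move=> [n fn] [m gm]; exists (maxn n m); apply: (conc_lin resA) => //.
- exact: (conc_mono (leq_maxl n m)).
- exact: (conc_mono (leq_maxr n m)).
Qed.

Lemma spectrally_bounded_dense f e : L2 mu f -> 0 < e ->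
  exists2 h, spectrally_bounded h & nrm2 (sub f h) < e.
Proof.
move=> Lf e0; pose S n : set (measurableTypeR R) := ~` cut n.
have mS n : measurable (S n) by apply: measurableC; exact: measurable_cut.
have niS : nonincreasing_seq S.
  move=> n m nm; apply/subsetPset; apply: subsetC => s /=; rewrite !in_itv /=.
  have : n%:R <= m%:R :> R by rewrite ler_nat.
  by move=> ? /andP[? ?]; apply/andP; split; lra.
have S0 : \bigcap_n S n = set0.
  apply/seteqP; split => // s /(_ (Num.truncn `|s|).+1 Logic.I); apply.
  by rewrite /= in_itv /= -ler_norml; apply/ltW; exact: truncnS_gt.
have cv : sm f (S n) @[n --> \oo] --> 0%E.
  rewrite -(@measure0 _ _ _ (sm f)) -S0; apply: nonincreasing_cvg_mu => //.
    apply: le_lt_trans (spectral_measure_fin PE Lf).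
    by apply: le_measure; rewrite ?inE.
  by rewrite S0.
have /fine_cvgP[_ /cvgrPdist_lt /(_ e e0)[n _ hn]] := cv.
exists (E (cut n) f); first by exists n; apply: (conc_pvm resA) => //; exact: measurable_cut.
have mn := measurable_cut n; have := hn n (leqnn n).
have [LE LEc] := (pvm_L2 PE mn Lf, pvm_L2 PE (mS n) Lf).
rewrite /= sub0r normrN spectral_measureE//=; last exact: mS.
move=> /(le_lt_trans (ler_norm _)); apply: le_lt_trans.
rewrite le_eqVlt; apply/orP; left; apply/eqP; apply: aeq_nrm2 => //; first exact: L2_sub.
apply: filterS (pvm_setC PE Lf mn) => s /(_ Logic.I) h _.
by rewrite /sub h /lin mul1r; ring.
Qed.

End unitary_group.

(** * The unitary group of a sum of operators *)

Section tensor_evolution.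
Variables (R : realType) (M N : ptopologicalType).
Hypotheses (scM : second_countable (T := M)) (scN : second_countable (T := N)).
Local Notation X := (borel (M * N)%type).
Variables (muM : {measure set (borel M) -> \bar R})
  (muN : {measure set (borel N) -> \bar R}) (muX : {measure set X -> \bar R}).
Hypotheses (sfM : sigma_finite setT muM) (sfN : sigma_finite setT muN).
Hypothesis rect : forall (A : set M) (B : set N),
  @measurable _ (borel M) A -> @measurable _ (borel N) B ->
  muX (A `*` B : set (M * N)) = (muM A * muN B)%E.
Local Notation C := R[i].
Local Notation normc := (@Normc.normc R).
Local Notation Re := complex.Re.
Local Notation Im := complex.Im.
Local Notation nM := (nrm2 muM).
Local Notation nN := (nrm2 muN).
Local Notation nX := (nrm2 muX).
Let L2t := L2_tensor scM scN sfM sfN rect.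
Let n2t := nrm2_tensor scM scN sfM sfN rect.
Let int := inner_tensor scM scN sfM sfN rect.

Variables (H : unbounded_operator (borel M) R) (K : unbounded_operator (borel N) R)
  (L : unbounded_operator X R).
Hypotheses (saH : selfadjoint muM H) (saK : selfadjoint muN K) (saL : selfadjoint muX L).
Hypothesis sumL : is_sum muM muN muX H K L.

(** A selfadjoint operator is closed, so the defining identity of the sum
    extends from cores to the full domains. *)
Lemma sum_tensor f g : dom H f -> dom K g ->
  dom L (tensor f g) /\
  aeq muX (L (tensor f g)) (lin 1 (tensor (H f) g) (tensor f (K g))).
Proof.
case: sumL => D1 [D2 [[D1d gd1] [D2d gd2] sL]] Df Dg.
have [Lf LHf] := (op_L2d saH Df, op_L2 saH Df).
have [Lg LKg] := (op_L2d saK Dg, op_L2 saK Dg).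
have close (d : measure_display) (T : measurableType d)
    (mu : {measure set T -> \bar R}) (A : unbounded_operator T R) (D : set (T -> C))
    (h : T -> C) (e : R) : selfadjoint mu A -> graph_dense mu A D -> dom A h -> 0 < e ->
    exists2 k, D k & nrm2 mu (sub h k) <= e /\ nrm2 mu (sub (A h) (A k)) <= e.
  move=> saA [Dd gd] Dh e0; have s0 : 0 < Num.sqrt e by rewrite sqrtr_gt0.
  have [k Dk hk] := gd _ _ Dh s0; have Dk' := Dd _ Dk.
  exists k => //; rewrite -(sqr_sqrtr (ltW e0)); split; apply/ltW/L2dist_lt => //;
    try exact: (op_L2d saA); try exact: (op_L2 saA).
    apply: le_lt_trans hk; rewrite leeDl//; exact: Lnorm_ge0.
  apply: le_lt_trans hk; rewrite leeDr//; exact: Lnorm_ge0.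
apply: (selfadjoint_closed saL).
- exact: L2t.
- by apply: L2_lin; exact: L2t.
move=> e e0.
have [h D1h [fh Hfh]] := close _ _ muM H D1 f (e / (16 * (nN g + nN (K g) + 1)))
  saH (conj D1d gd1) Df ltac:(by rewrite divr_gt0// mulr_gt0// ltr_wpDl// addr_ge0 ?nrm2_ge0).
have Dh := D1d _ D1h; have [Lh LHh] := (op_L2d saH Dh, op_L2 saH Dh).
have [k D2k [gk Kgk]] := close _ _ muN K D2 g (e / (16 * (nM h + nM (H h) + 1)))
  saK (conj D2d gd2) Dg ltac:(by rewrite divr_gt0// mulr_gt0// ltr_wpDl// addr_ge0 ?nrm2_ge0).
have Dk := D2d _ D2k; have [Lk LKk] := (op_L2d saK Dk, op_L2 saK Dk).
have [DLhk Lhk] := sL _ _ D1h D2k.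
have Lsf := L2_sub Lf Lh; have Lsg := L2_sub Lg Lk.
have LsH := L2_sub LHf LHh; have LsK := L2_sub LKg LKk.
have [[[g0 Kg0] h0] Hh0] := (nrm2_ge0 muN g, nrm2_ge0 muN (K g), nrm2_ge0 muM h, nrm2_ge0 muM (H h)).
have [fh0 Hfh0] := (nrm2_ge0 muM (sub f h), nrm2_ge0 muM (sub (H f) (H h))).
have [gk0 Kgk0] := (nrm2_ge0 muN (sub g k), nrm2_ge0 muN (sub (K g) (K k))).
have P1 : 0 < 16 * (nN g + nN (K g) + 1) by rewrite mulr_gt0 ?ltr_wpDl ?addr_ge0.
have P2 : 0 < 16 * (nM h + nM (H h) + 1) by rewrite mulr_gt0 ?ltr_wpDl ?addr_ge0.
rewrite ler_pdivlMr // in fh; rewrite ler_pdivlMr // in Hfh.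
rewrite ler_pdivlMr // in gk; rewrite ler_pdivlMr // in Kgk.
have lin1 F G : L2 muX F -> L2 muX G -> nX (lin 1 F G) <= 2 * nX F + 2 * nX G.
  by move=> LF LG; have := nrm2_lin_le 1 LF LG; rewrite sqr_normc /= expr1n expr0n addr0 mul1r.
exists (tensor h k) => //; split.
  rewrite (_ : sub _ _ = lin 1 (tensor (sub f h) g) (tensor h (sub g k))); last first.
    by apply/funext => z; rewrite /sub /lin /tensor; ring.
  apply: le_trans (lin1 _ _ (L2t Lsf Lg) (L2t Lh Lsg)) _.
  by rewrite !n2t//; nra.
pose W : X -> C := lin 1 (lin 1 (tensor (sub (H f) (H h)) g) (tensor (H h) (sub g k)))
  (lin 1 (tensor (sub f h) (K g)) (tensor h (sub (K g) (K k)))).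
have LW : L2 muX W by apply: L2_lin; apply: L2_lin; exact: L2t.
have Ls : L2 muX (sub (lin 1 (tensor (H f) g) (tensor f (K g))) (L (tensor h k))).
  by apply: L2_sub; [apply: L2_lin; exact: L2t|exact: (op_L2 saL)].
have sW : aeq muX (sub (lin 1 (tensor (H f) g) (tensor f (K g))) (L (tensor h k))) W.
  by apply: filterS Lhk => z /(_ Logic.I) e' _; rewrite /W /sub e' /lin /tensor; ring.
apply: le_trans (_ : nX W <= e); first by rewrite (aeq_nrm2 Ls LW sW).
apply: le_trans (lin1 _ _ _ _) _; try by apply: L2_lin; exact: L2t.
have := lin1 _ _ (L2t LsH Lg) (L2t LHh Lsg); have := lin1 _ _ (L2t Lsf LKg) (L2t Lh LsK).
by rewrite !n2t//; nra.
Qed.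

Variables (EH : set R -> (M -> C) -> M -> C) (EK : set R -> (N -> C) -> N -> C)
  (EL : set R -> (M * N -> C) -> M * N -> C).
Hypotheses (resH : spectral_resolution muM H EH) (resK : spectral_resolution muN K EK)
  (resL : spectral_resolution muX L EL).
Variables (UH : R -> (M -> C) -> M -> C) (UK : R -> (N -> C) -> N -> C)
  (UL : R -> (M * N -> C) -> M * N -> C).
Hypothesis UHE : forall t, linear_operator muM (L2 muM) (UH t) /\
  forall f, L2 muM f -> inner muM (UH t f) f =
    Complex (fine (\int[scalar_measure muM EH f]_s (cos (t * s))%:E)%E)
            (fine (\int[scalar_measure muM EH f]_s (sin (t * s))%:E)%E).
Hypothesis UKE : forall t, linear_operator muN (L2 muN) (UK t) /\
  forall f, L2 muN f -> inner muN (UK t f) f =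
    Complex (fine (\int[scalar_measure muN EK f]_s (cos (t * s))%:E)%E)
            (fine (\int[scalar_measure muN EK f]_s (sin (t * s))%:E)%E).
Hypothesis ULE : forall t, linear_operator muX (L2 muX) (UL t) /\
  forall f, L2 muX f -> inner muX (UL t f) f =
    Complex (fine (\int[scalar_measure muX EL f]_s (cos (t * s))%:E)%E)
            (fine (\int[scalar_measure muX EL f]_s (sin (t * s))%:E)%E).

Local Notation cut n := (`[- (n%:R : R), n%:R]%classic : set R).

(** [A] preserves the spectral support, and vectors of bounded spectral support
    lie in its domain. *)
Let iter_conc (d : measure_display) (T : measurableType d)
    (mu : {measure set T -> \bar R}) (A : unbounded_operator T R) E n f :
  selfadjoint mu A -> spectral_resolution mu A E -> concentrated mu E (cut n) f ->
  forall k, dom A (iter k A f) /\ concentrated mu E (cut n) (iter k A f).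
Proof.
move=> saA resA fn.
have dm h : concentrated mu E (cut n) h -> dom A h.
  move=> ch; apply: (conc_dom resA (ler0n R n) _ _ ch) => [|s].
    exact: measurable_cut.
  exact: cut_le.
elim=> [|k [D c]] /=; first by split=> //; exact: dm.
have c' : concentrated mu E (cut n) (A (iter k A f)).
  by apply: (conc_op saA resA _ D c); exact: measurable_cut.
by split=> //; exact: dm.
Qed.

(** With [k = 0] the vector $H^if\otimes K^jg$; in general the result of applying
    $H\otimes1+1\otimes K$ to it [k] times, expanded. *)
Fixpoint binomial_orbit f g (k i j : nat) : M * N -> C :=
  if k is k'.+1 then lin 1 (binomial_orbit f g k' i.+1 j) (binomial_orbit f g k' i j.+1)
  else tensor (iter i H f) (iter j K g).

(** On bounded vectors the moments of the spectral measure of a tensor are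
    given by the binomial expansion of $(H\otimes1+1\otimes K)^k$, like those of
    the convolution of the two spectral measures. *)
Lemma tensor_form t f g : spectrally_bounded muM EH f -> spectrally_bounded muN EK g ->
  inner muX (UL t (tensor f g)) (tensor f g) =
  inner muM (UH t f) f * inner muN (UK t g) g.
Proof.
move=> [n' fn'] [m' gm']; pose n := maxn n' m'.
have fn := conc_mono resH (leq_maxl n' m') fn'.
have gm := conc_mono resK (leq_maxr n' m') gm'.
have [Lf Lg] := (fn.1, gm.1).
have fH := iter_conc saH resH fn; have gK := iter_conc saK resK gm.
pose S := binomial_orbit f g.
have SP k : forall i j, dom L (S k i j) /\ aeq muX (L (S k i j)) (S k.+1 i j).
  have linL : linear_operator muX (dom L) L by case: saL.
  elim: k => [|k IH] i j; first exact: (sum_tensor (fH i).1 (gK j).1).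
  have [[D1 e1] [D2 e2]] := (IH i.+1 j, IH i j.+1); split; first exact: (lop_lind linL).
  by apply: aeq_trans (lop_lin linL 1 D1 D2) _; exact: aeq_lin.
have LS k i j : L2 muX (S k i j) := op_L2d saL (SP k i j).1.
have Lfg : L2 muX (tensor f g) by exact: L2t.
have Dv k : dom L (S k 0%N 0%N) by exact: (SP k 0%N 0%N).1.
have vS k : aeq muX (L (S k 0%N 0%N)) (S k.+1 0%N 0%N) by exact: (SP k 0%N 0%N).2.
have DH k : dom H (iter k H f) := (fH k).1.
have DK k : dom K (iter k K g) := (gK k).1.
have SH k : aeq muM (H (iter k H f)) (iter k.+1 H f) by exact: aeq_refl.
have SK k : aeq muN (K (iter k K g)) (iter k.+1 K g) by exact: aeq_refl.
have PH : projection_valued_measure muM EH by case: resH.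
have PK : projection_valued_measure muN EK by case: resK.
have PL : projection_valued_measure muX EL by case: resL.
have finm d' (T : measurableType d') (mu : {measure set T -> \bar R}) E h :
    projection_valued_measure mu E -> L2 mu h -> fin_num_fun (spectral_measure mu E h).
  move=> PE Lh B mB; rewrite ge0_fin_numE//.
  apply: le_lt_trans (spectral_measure_fin PE Lh).
  by apply: le_measure; rewrite ?inE.
pose m1 : {finite_measure set (measurableTypeR R) -> \bar R} :=
  finite_bundle (finm _ _ _ _ _ PH Lf).
pose m2 : {finite_measure set (measurableTypeR R) -> \bar R} :=
  finite_bundle (finm _ _ _ _ _ PK Lg).
have b1 : {ae m1, forall s : R, `|s| <= n%:R}.
  have [Z [mZ Z0 subZ]] := conc_null resH (@measurable_cut R n) fn.
  by exists Z; split=> // s /= ns; apply: subZ => /= cs; apply: ns; exact: cut_le.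
have b2 : {ae m2, forall s : R, `|s| <= n%:R}.
  have [Z [mZ Z0 subZ]] := conc_null resK (@measurable_cut R n) gm.
  by exists Z; split=> // s /= ns; apply: subZ => /= cs; apply: ns; exact: cut_le.
have [] := @convolution_cos_sin R m1 m2 n%:R (ler0n _ _) b1 b2
  (spectral_measure muX EL (tensor f g))
  (fun k i j => Re (inner muX (S k i j) (tensor f g))) _ _ _ _ _ t.
- exact: spectral_measure_fin.
- exact: (moment_integrable saL resL Dv vS).
- by move=> k; rewrite (moment saL resL Dv vS).
- by move=> k i j; rewrite /= inner_linl// mul1r ReD.
- move=> i j; rewrite /= int//; try exact: (op_L2d saH); try exact: (op_L2d saK).
  rewrite ReM (moment_Im saH DH SH i) mul0r subr0.
  by rewrite -(moment saH resH DH SH i) -(moment saK resK DK SK j).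
move=> c s; rewrite (unitary_form resL ULE)// c s.
rewrite (unitary_form resH UHE)// (unitary_form resK UKE)//.
by apply: complex_eq; rewrite !simpC /=; ring.
Qed.

Lemma tensor_approximation (D1 : set (M -> C)) (D2 : set (N -> C)) :
  D1 `<=` L2 muM -> D2 `<=` L2 muN ->
  (forall f e, L2 muM f -> 0 < e -> exists2 h, D1 h & nM (sub f h) < e) ->
  (forall g e, L2 muN g -> 0 < e -> exists2 k, D2 k & nN (sub g k) < e) ->
  forall f g e, L2 muM f -> L2 muN g -> 0 < e -> exists h k,
    [/\ D1 h, D2 k, nM (sub f h) < e, nN (sub g k) < e &
        nX (sub (tensor f g) (tensor h k)) < e].
Proof.
move=> D1L D2L d1 d2 f g e Lf Lg e0; have g0 := nrm2_ge0 muN g.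
have P1 : 0 < 4 * (nN g + 1) by rewrite mulr_gt0// ltr_wpDl.
have [h D1h fh] := d1 f (Num.min e (e / (4 * (nN g + 1)))) Lf
  ltac:(by rewrite lt_min e0 divr_gt0).
have Lh := D1L _ D1h; have h0 := nrm2_ge0 muM h.
have P2 : 0 < 4 * (nM h + 1) by rewrite mulr_gt0// ltr_wpDl.
have [k D2k gk] := d2 g (Num.min e (e / (4 * (nM h + 1)))) Lg
  ltac:(by rewrite lt_min e0 divr_gt0).
have Lk := D2L _ D2k; move: fh gk; rewrite !lt_min => /andP[fh fh'] /andP[gk gk'].
exists h, k; split => //.
have [Lfh Lgk] := (L2_sub Lf Lh, L2_sub Lg Lk).
rewrite (_ : sub _ _ = lin 1 (tensor (sub f h) g) (tensor h (sub g k))); last first.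
  by apply/funext => z; rewrite /sub /lin /tensor; ring.
have := nrm2_lin_le 1 (L2t Lfh Lg) (L2t Lh Lgk).
rewrite sqr_normc /= expr1n expr0n addr0 mul1r !n2t//.
have [fh0 gk0] := (nrm2_ge0 muM (sub f h), nrm2_ge0 muN (sub g k)).
rewrite ltr_pdivlMr// in fh'; rewrite ltr_pdivlMr// in gk'.
move: fh' gk'; rewrite !mulrDr !mulr1 => fh' gk'; nra.
Qed.

(** Tensors of vectors from dense sets span a dense subspace, because they
    approximate the tensors of indicators that grid functions consist of. *)
Lemma tensor_total (D1 : set (M -> C)) (D2 : set (N -> C)) w :
  D1 `<=` L2 muM -> D2 `<=` L2 muN ->
  (forall f e, L2 muM f -> 0 < e -> exists2 h, D1 h & nM (sub f h) < e) ->
  (forall g e, L2 muN g -> 0 < e -> exists2 k, D2 k & nN (sub g k) < e) ->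
  L2 muX w -> (forall h k, D1 h -> D2 k -> inner muX w (tensor h k) = 0) ->
  nX w = 0.
Proof.
move=> D1L D2L d1 d2 Lw worth.
have orth f g : L2 muM f -> L2 muN g -> inner muX w (tensor f g) = 0.
  move=> Lf Lg; apply: (@eq0_of_normc_le _ _ (Num.sqrt (nX w))); first exact: sqrtr_ge0.
  move=> e e0.
  have [h [k [D1h D2k _ _ hk]]] := tensor_approximation D1L D2L d1 d2 Lf Lg
    (exprn_gt0 2 e0).
  have [Lfg Lhk] := (L2t Lf Lg, L2t (D1L _ D1h) (D2L _ D2k)).
  have -> : inner muX w (tensor f g) = inner muX w (sub (tensor f g) (tensor h k)).
    by rewrite inner_subr// worth// subr0.
  apply: le_trans (normc_inner_le Lw (L2_sub Lfg Lhk)) _.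
  rewrite ler_wpM2l ?sqrtr_ge0// -(ger0_norm (ltW e0)) -sqrtr_sqr ler_wsqrtr//.
  exact: ltW.
apply: (@orth_dense _ _ _ muX (grid muM muN) w) => //.
- by move=> G; exact: (L2_grid scM scN rect).
- by move=> e e0; exact: (grid_dense scM scN sfM sfN rect).
move=> G gG; have [m _ Gm] := grid_bounded gG.
have [J [A [b [B [mA [mB Boo] bP _ GE]]]]] := grid_decomposition gG Gm.
have -> : G = fun z => \sum_(i <- index_enum J)
    tensor (fun x => (\1_(A i) x)%:C%C) (b i) z by apply/funext => -[x y]; exact: GE.
have Lt i : L2 muX (tensor (fun x => (\1_(A i) x)%:C%C) (b i)).
  apply: L2t; first by apply: L2_ind; [exact: (mA i).1|exact: (mA i).2].
  exact: (L2_bounded mB Boo (bP i).1 (bP i).2).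
suff : L2 muX (fun z => \sum_(i <- index_enum J)
    tensor (fun x => (\1_(A i) x)%:C%C) (b i) z) /\
  inner muX w (fun z => \sum_(i <- index_enum J)
    tensor (fun x => (\1_(A i) x)%:C%C) (b i) z) = 0 by case.
elim: (index_enum J) => [|i s [Ls IH]].
  rewrite (_ : (fun z => _) = fun=> 0); last by apply/funext => z; rewrite big_nil.
  have L0 := L2_0 muX; split => //.
  by rewrite innerJ// inner0l; apply: complex_eq; rewrite /= ?oppr0.
rewrite (_ : (fun z => _) = lin 1 (tensor (fun x => (\1_(A i) x)%:C%C) (b i))
    (fun z => \sum_(j <- s) tensor (fun x => (\1_(A j) x)%:C%C) (b j) z)); last first.
  by apply/funext => z; rewrite big_cons /lin mul1r.
split; first exact: L2_lin.
rewrite inner_linr// IH orth//; first by rewrite mulr0 addr0.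
  by apply: L2_ind; [exact: (mA i).1|exact: (mA i).2].
exact: (L2_bounded mB Boo (bP i).1 (bP i).2).
Qed.

Let lH t : linear_operator muM (L2 muM) (UH t). Proof. exact: (UHE t).1. Qed.
Let lK t : linear_operator muN (L2 muN) (UK t). Proof. exact: (UKE t).1. Qed.
Let lL t : linear_operator muX (L2 muX) (UL t). Proof. exact: (ULE t).1. Qed.
Let PM := spectrally_bounded muM EH.
Let PN := spectrally_bounded muN EK.
Let bM := @spectrally_bounded_L2 _ _ _ muM EH.
Let bN := @spectrally_bounded_L2 _ _ _ muN EK.

(** Both sides are sesquilinear in [f, f'] and in [g, g'], hence determined by
    their diagonals. *)
Lemma tensor_form_polarized t f f' g g' : PM f -> PM f' -> PN g -> PN g' ->
  inner muX (UL t (tensor f g)) (tensor f' g') =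
  inner muM (UH t f) f' * inner muN (UK t g) g'.
Proof.
have polM k : PN k -> forall f f', PM f -> PM f' ->
    inner muX (UL t (tensor f k)) (tensor f' k) = inner muM (UH t f) f' * inner muN (UK t k) k.
  move=> Pg; have Lg := bN Pg; apply: polarization.
  - exact: (spectrally_bounded_lin resH).
  - move=> c h h' l /bM Lh /bM Lh' /bM Ll; rewrite tensor_linl.
    by rewrite (lop_inner_linl (lL t))//; exact: L2t.
  - move=> c h h' l /bM Lh /bM Lh' /bM Ll; rewrite tensor_linl inner_linr//; try exact: L2t.
    by apply: (lop_L2 (lL t)); exact: L2t.
  - by move=> c h h' l /bM Lh /bM Lh' /bM Ll; rewrite (lop_inner_linl (lH t))//; ring.
  - move=> c h h' l /bM Lh /bM Lh' /bM Ll; rewrite inner_linr//; first by ring.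
    exact: (lop_L2 (lH t)).
  - by move=> h Ph; exact: tensor_form.
move=> Pf Pf'; have [Lf Lf'] := (bM Pf, bM Pf'); move: g g'.
apply: (@polarization _ _ PN (fun g g' => inner muX (UL t (tensor f g)) (tensor f' g'))
  (fun g g' => inner muM (UH t f) f' * inner muN (UK t g) g')).
- exact: (spectrally_bounded_lin resK).
- move=> c h h' l /bN Lh /bN Lh' /bN Ll; rewrite tensor_linr.
  by rewrite (lop_inner_linl (lL t))//; exact: L2t.
- move=> c h h' l /bN Lh /bN Lh' /bN Ll; rewrite tensor_linr inner_linr//; try exact: L2t.
  by apply: (lop_L2 (lL t)); exact: L2t.
- by move=> c h h' l /bN Lh /bN Lh' /bN Ll; rewrite (lop_inner_linl (lK t))//; ring.
- move=> c h h' l /bN Lh /bN Lh' /bN Ll; rewrite inner_linr//; first by ring.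
  exact: (lop_L2 (lK t)).
- by move=> h Ph; exact: polM.
Qed.

Let tensor_evolution_bounded t f g : PM f -> PN g ->
  nX (sub (UL t (tensor f g)) (tensor (UH t f) (UK t g))) = 0.
Proof.
move=> Pf Pg; have [Lf Lg] := (bM Pf, bN Pg).
have LL := lop_L2 (lL t) (L2t Lf Lg).
have LT := L2t (lop_L2 (lH t) Lf) (lop_L2 (lK t) Lg).
apply: (tensor_total bM bN (spectrally_bounded_dense resH) (spectrally_bounded_dense resK)).
  exact: L2_sub.
move=> h k Ph Pk; have Lhk := L2t (bM Ph) (bN Pk).
rewrite inner_subl// tensor_form_polarized// int ?subrr//.
- exact: (lop_L2 (lH t)).
- exact: bM.
- exact: (lop_L2 (lK t)).
- exact: bN.
Qed.

(** By density of bounded vectors and boundedness of the groups. *)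
Theorem tensor_evolution t f g : L2 muM f -> L2 muN g ->
  aeq muX (UL t (tensor f g)) (tensor (UH t f) (UK t g)).
Proof.
move=> Lf Lg; have LL := lop_L2 (lL t) (L2t Lf Lg).
have [LUf LUg] := (lop_L2 (lH t) Lf, lop_L2 (lK t) Lg).
have LT := L2t LUf LUg.
apply/aeq_nrm2P => //; apply/eqP; rewrite eq_le nrm2_ge0 andbT.
apply/ler_addgt0Pl => e e0; rewrite addr0.
have [f0 g0] := (nrm2_ge0 muM f, nrm2_ge0 muN g).
have P : 0 < 300 * (nN g + nM f + 1) :=
  mulr_gt0 (ltr0Sn R 299) (ltr_wpDl (addr_ge0 g0 f0) ltr01).
pose dl := Num.min 1 (e / (300 * (nN g + nM f + 1))).
have dl0 : 0 < dl by rewrite lt_min ltr01 divr_gt0.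
have [dl1 dle] : dl <= 1 /\ dl * (300 * (nN g + nM f + 1)) <= e.
  by rewrite -ler_pdivlMr// /dl; split; rewrite ge_min lexx ?orbT.
have [h [k [Ph Pk fh gk hk]]] := tensor_approximation bM bN
  (spectrally_bounded_dense resH) (spectrally_bounded_dense resK) Lf Lg dl0.
have [Lh Lk] := (bM Ph, bN Pk).
have [LUh LUk] := (lop_L2 (lH t) Lh, lop_L2 (lK t) Lk).
have [LLhk LThk] := (lop_L2 (lL t) (L2t Lh Lk), L2t LUh LUk).
have h1 := nrm2_triangle LL LLhk LT; have h2 := nrm2_triangle LLhk LThk LT.
rewrite tensor_evolution_bounded// mulr0 add0r in h2.
have h3 := unitary_close resL ULE t (L2t Lf Lg) (L2t Lh Lk).
have Lsf := L2_sub LUh LUf; have Lsg := L2_sub LUk LUg.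
have h4 : nX (sub (tensor (UH t h) (UK t k)) (tensor (UH t f) (UK t g))) <=
    2 * (nM (sub (UH t h) (UH t f)) * nN (UK t g)) +
    2 * (nM (UH t h) * nN (sub (UK t k) (UK t g))).
  rewrite (_ : sub _ _ = lin 1 (tensor (sub (UH t h) (UH t f)) (UK t g))
     (tensor (UH t h) (sub (UK t k) (UK t g)))); last first.
    by apply/funext => z; rewrite /sub /lin /tensor; ring.
  have := nrm2_lin_le 1 (L2t Lsf LUg) (L2t LUh Lsg).
  by rewrite sqr_normc /= expr1n expr0n addr0 mul1r !n2t.
have h5 := unitary_close resH UHE t Lh Lf; have h6 := unitary_close resK UKE t Lk Lg.
have h7 := unitary_bound resH UHE t Lh; have h8 := unitary_bound resK UKE t Lg.
rewrite nrm2_subC// in fh; rewrite nrm2_subC// in gk.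
have h9 := nrm2_triangle Lh Lf (L2_0 muM).
have subr0f (T : Type) (u : T -> C) : sub u (fun=> 0) = u by apply/funext => x; rewrite /sub subr0.
rewrite !subr0f in h9.
have x0 := nrm2_ge0 muM (sub (UH t h) (UH t f)); have x0' := nrm2_ge0 muM (UH t h).
have y0 := nrm2_ge0 muN (sub (UK t k) (UK t g)); have y0' := nrm2_ge0 muN (UK t g).
move: h1 h2 h3 h4 h5 h6 h7 h8 h9 fh gk hk x0 x0' y0 y0' f0 g0 dl0 dl1 dle.
move: dl (nM f) (nN g) (nM h) (nM (sub h f)) (nN (sub k g)) (nM (sub (UH t h) (UH t f)))
  (nM (UH t h)) (nN (sub (UK t k) (UK t g))) (nN (UK t g))
  (nX (sub (tensor f g) (tensor h k))) (nX (sub (UL t (tensor f g)) (UL t (tensor h k))))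
  (nX (sub (UL t (tensor h k)) (tensor (UH t f) (UK t g))))
  (nX (sub (tensor (UH t h) (UK t k)) (tensor (UH t f) (UK t g))))
  (nX (sub (UL t (tensor f g)) (tensor (UH t f) (UK t g)))).
move=> dl F G Hh HF KG x x' y y' u1 u2 u3 u4 u5.
move=> h1 h2 h3 h4 h5 h6 h7 h8 h9 fh gk hk x0 x0' y0 y0' f0 g0 dl0 dl1 dle.
have b1 : x * y' <= (4 * dl) * (4 * G) by apply: ler_pM; lra.
have b2 : x' * y <= (4 * (2 + 2 * F)) * (4 * dl) by apply: ler_pM; lra.
by nra.
Qed.

End tensor_evolution.

(** * Bounds in $L^p$ *)

Section Lp_bounds.
Context {d : measure_display} {T : measurableType d} {R : realType}.
Variable mu : {measure set T -> \bar R}.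
Local Notation C := R[i].
Local Notation normc := (@Normc.normc R).

Definition power_integral (p : R) (f : T -> C) : \bar R :=
  (\int[mu]_x (normc (f x) `^ p)%:E)%E.

(** The statement that the $L^p$ norm is at most [c], without the root. *)
Definition Lp_bound (p : \bar R) (c : R) (f : T -> C) : Prop :=
  match p with
  | p%:E => (power_integral p f <= (c `^ p)%:E)%E
  | +oo%E => {ae mu, forall x, normc (f x) <= c}
  | -oo%E => False
  end.

Lemma Lnorm_leP (p c : R) (f : T -> R) : 0 < p -> 0 <= c -> (forall x, 0 <= f x) ->
  (Lnorm mu p%:E (EFin \o f) <= c%:E)%E <-> (\int[mu]_x (f x `^ p)%:E <= (c `^ p)%:E)%E.
Proof.
move=> p0 c0 f0; have p0' := ltW p0.
have -> : (\int[mu]_x (f x `^ p)%:E = Lnorm mu p%:E (EFin \o f) `^ p)%E.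
  rewrite (poweR_Lnorm _ _ (lt0r_neq0 p0)); apply: eq_integral => x _ /=.
  by rewrite ger0_norm.
have N0 := Lnorm_ge0 mu p%:E (EFin \o f).
rewrite -poweR_EFin; split => h.
  by apply: gt0_ler_poweR => //; rewrite in_itv /= ?leey ?andbT ?N0 ?lee_fin.
have -> : c%:E = ((c%:E `^ p) `^ p^-1)%E.
  by rewrite -poweRrM mulfV ?gt_eqF// poweRe1.
have {1}-> : Lnorm mu p%:E (EFin \o f) = ((Lnorm mu p%:E (EFin \o f) `^ p) `^ p^-1)%E.
  by rewrite -poweRrM mulfV ?gt_eqF// poweRe1.
have I (x : \bar R) : (0 <= x)%E -> x \in `[0%E, +oo%E]%R by move=> x0; rewrite in_itv /= x0 leey.
by apply: gt0_ler_poweR; rewrite ?invr_ge0//; apply: I; exact: poweR_ge0.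
Qed.

Lemma cLnorm_leP (p : \bar R) (c : R) f : (1 <= p)%E -> 0 <= c ->
  (cLnorm mu p f <= c%:E)%E <-> Lp_bound p c f.
Proof.
case: p => [p||]//=; rewrite ?lee_fin => p1 c0.
  apply: Lnorm_leP => //; first exact: lt_le_trans p1.
  by move=> x; exact: normc_ge0.
rewrite /cLnorm unlock /Lnorm; case: ifPn => [mu0|].
  split=> [/ess_supP|h]; last (apply/ess_supP; move: h); apply: filterS => x /=;
    by rewrite lee_fin ger0_norm ?normc_ge0.
rewrite -leNgt => mu0; have muT : mu setT = 0%E by apply/eqP; rewrite eq_le mu0 measure_ge0.
split=> _; last by rewrite lee_fin.
by exists setT.
Qed.

Lemma measurable_powR_normc (p : R) (f : T -> C) : cmeasurable f ->
  measurable_fun setT (fun x => normc (f x) `^ p).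
Proof.
by move=> mf; apply: (measurableT_comp (measurable_powR p)); exact: measurable_normc.
Qed.

Lemma Lp_bound_aeq p c f g : cmeasurable f -> cmeasurable g -> aeq mu f g ->
  Lp_bound p c f -> Lp_bound p c g.
Proof.
move=> mf mg fg; case: p => [p||[]].
  rewrite /Lp_bound /power_integral (ae_eq_integral (fun x => (normc (g x) `^ p)%:E))//.
  - by apply/measurable_EFinP; exact: measurable_powR_normc.
  - by apply/measurable_EFinP; exact: measurable_powR_normc.
  - by apply: filterS fg => x e /e ->.
by move=> h; apply: filterS2 fg h => x /(_ Logic.I) ->.
Qed.

Lemma minkowski_sum (p : R) (I : Type) (s : seq I) (f : I -> T -> R) (D : I -> R) :
  1 <= p -> (forall i, measurable_fun setT (f i)) -> (forall i x, 0 <= f i x) ->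
  (forall i, 0 <= D i) ->
  (forall i, (\int[mu]_x (f i x `^ p)%:E <= (D i `^ p)%:E)%E) ->
  (\int[mu]_x ((\sum_(i <- s) f i x) `^ p)%:E <= ((\sum_(i <- s) D i) `^ p)%:E)%E.
Proof.
move=> p1 mf f0 D0 fD; have p0 : 0 < p by exact: lt_le_trans p1.
have s0 (s' : seq I) x : 0 <= \sum_(i <- s') f i x by apply: sumr_ge0.
have D0' (s' : seq I) : 0 <= \sum_(i <- s') D i by apply: sumr_ge0.
apply/Lnorm_leP => //; elim: s => [|i s IH].
  rewrite big_nil (_ : EFin \o _ = cst 0%E) ?Lnorm0 ?eqe ?gt_eqF//.
  by apply/funext => x /=; rewrite big_nil.
rewrite (_ : (EFin \o _) = EFin \o (f i \+ (fun x => \sum_(j <- s) f j x))); last first.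
  by apply/funext => x /=; rewrite big_cons.
apply: le_trans (minkowski_EFin _ _ _ _) _ => //; first exact: measurable_sum.
by rewrite big_cons EFinD; apply: leeD => //; apply/Lnorm_leP.
Qed.


End Lp_bounds.

Section linear_sums.
Context {d : measure_display} {T : measurableType d} {R : realType}.
Variable mu : {measure set T -> \bar R}.
Local Notation C := R[i].
Variable V : (T -> C) -> T -> C.
Hypothesis linV : linear_operator mu (L2 mu) V.

Lemma L2_sum (I : Type) (s : seq I) (c : I -> C) (f : I -> T -> C) :
  (forall i, L2 mu (f i)) -> L2 mu (fun x => \sum_(i <- s) c i * f i x).
Proof.
move=> Lf; elim: s => [|i s IH].
  by rewrite (_ : (fun x => _) = fun=> 0); [exact: L2_0|apply/funext => x; rewrite big_nil].
rewrite (_ : (fun x => _) = lin (c i) (f i) (fun x => \sum_(j <- s) c j * f j x)).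
  exact: L2_lin.
by apply/funext => x; rewrite big_cons.
Qed.

Lemma lop_sum (I : Type) (s : seq I) (c : I -> C) (f : I -> T -> C) :
  (forall i, L2 mu (f i)) ->
  aeq mu (V (fun x => \sum_(i <- s) c i * f i x)) (fun x => \sum_(i <- s) c i * V (f i) x).
Proof.
move=> Lf; elim: s => [|i s IH].
  rewrite (_ : (fun x => _) = fun=> 0); last by apply/funext => x; rewrite big_nil.
  rewrite (_ : (fun x => \sum_(j <- _) _) = fun=> 0); last by apply/funext => x; rewrite big_nil.
  exact: (lop_zero linV).
rewrite (_ : (fun x => _) = lin (c i) (f i) (fun x => \sum_(j <- s) c j * f j x)); last first.
  by apply/funext => x; rewrite big_cons.
apply: aeq_trans (lop_lin linV (c i) (Lf i) (L2_sum s c Lf)) _.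
by apply: filterS IH => x h _; rewrite /lin h// big_cons.
Qed.

End linear_sums.

(** * The estimate on grid functions *)

Definition step_fun (R : realType) (T : Type) (J : finType) (A : J -> set T) (z : J -> R[i]) :
  T -> R[i] := fun x => \sum_i z i * (\1_(A i) x)%:C%C.

Section step_values.
Context {T : Type} {R : realType}.
Local Notation C := R[i].
Local Notation normc := (@Normc.normc R).
Variables (J : finType) (A : J -> set T).
Hypothesis disjA : forall i j x, A i x -> A j x -> i = j.
Local Notation step := (@step_fun R T J A).

Lemma step_in z i x : A i x -> step z x = z i.
Proof.
move=> Ax; rewrite /step_fun (bigD1 i)//= indicE mem_set// mulr1 big1 ?addr0// => j ji.
by rewrite indicE memNset ?mulr0// => Aj; move: ji; rewrite (disjA Aj Ax) eqxx.
Qed.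

Lemma step_out z x : (forall i, ~ A i x) -> step z x = 0.
Proof.
by move=> nA; rewrite /step_fun big1// => j _; rewrite indicE memNset ?mulr0//; exact: nA.
Qed.

Lemma normc0 : normc 0 = 0. Proof. by rewrite /= expr0n addr0 sqrtr0. Qed.

Lemma powR_normc_step (p : R) z x : 0 < p ->
  normc (step z x) `^ p = \sum_i normc (z i) `^ p * \1_(A i) x.
Proof.
move=> p0; have [[i Ax]|nA] := pselect (exists i, A i x).
  rewrite (step_in _ Ax) (bigD1 i)//= indicE mem_set// mulr1 big1 ?addr0// => j ji.
  by rewrite indicE memNset ?mulr0// => Aj; move: ji; rewrite (disjA Aj Ax) eqxx.
rewrite step_out; last by move=> i Ax; apply: nA; exists i.
rewrite normc0 powR0 ?gt_eqF// big1// => j _.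
by rewrite indicE memNset ?mulr0// => Aj; apply: nA; exists j.
Qed.

End step_values.

Section step_functions.
Context {d : measure_display} {T : measurableType d} {R : realType}.
Variable mu : {measure set T -> \bar R}.
Local Notation C := R[i].
Local Notation normc := (@Normc.normc R).
Variables (J : finType) (A : J -> set T).
Hypothesis mA : forall i, measurable (A i) /\ (mu (A i) < +oo)%E.
Hypothesis disjA : forall i j x, A i x -> A j x -> i = j.

Local Notation step := (@step_fun R T J A).

Lemma L2_step z : L2 mu (step z).
Proof. by apply: L2_sum => i; apply: L2_ind; [exact: (mA i).1|exact: (mA i).2]. Qed.

Lemma power_integral_step (p : R) z : 0 < p ->
  power_integral mu p (step z) = (\sum_i fine (mu (A i)) * normc (z i) `^ p)%:E.
Proof.
move=> p0; rewrite /power_integral.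
under eq_integral => x _ do rewrite (powR_normc_step disjA _ _ p0) -sumEFin.
rewrite ge0_integral_sum//; first last.
- by move=> i x _; rewrite lee_fin mulr_ge0 ?powR_ge0.
- move=> i; apply/measurable_EFinP; apply: measurable_funM; first exact: measurable_cst.
  by apply: measurable_indic; exact: (mA i).1.
rewrite -sumEFin; apply: eq_bigr => i _; have [mAi Aoo] := mA i.
under eq_integral => x _ do rewrite EFinM.
rewrite ge0_integralZl_EFin ?powR_ge0//; last by apply/measurable_EFinP; exact: measurable_indic.
by rewrite integral_indic// setIT muleC EFinM fineK// ge0_fin_numE.
Qed.

End step_functions.

Section grid_estimate.
Variables (R : realType) (M N : ptopologicalType).
Hypotheses (scM : second_countable (T := M)) (scN : second_countable (T := N)).
Local Notation X := (borel (M * N)%type).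
Variables (muM : {measure set (borel M) -> \bar R})
  (muN : {measure set (borel N) -> \bar R}) (muX : {measure set X -> \bar R}).
Hypotheses (sfM : sigma_finite setT muM) (sfN : sigma_finite setT muN).
Hypothesis rect : forall (A : set M) (B : set N),
  @measurable _ (borel M) A -> @measurable _ (borel N) B ->
  muX (A `*` B : set (M * N)) = (muM A * muN B)%E.
Local Notation C := R[i].
Local Notation normc := (@Normc.normc R).

Let filterM : Filter (nbhs (almost_everywhere muM)).
Proof. exact: (ae_filter_ringOfSetsType muM). Qed.
Let filterN : Filter (nbhs (almost_everywhere muN)).
Proof. exact: (ae_filter_ringOfSetsType muN). Qed.
Let filterX : Filter (nbhs (almost_everywhere muX)).
Proof. exact: (ae_filter_ringOfSetsType muX). Qed.
#[local] Existing Instance filterM.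
#[local] Existing Instance filterN.
#[local] Existing Instance filterX.

(** By Tonelli, the exceptional set is null because almost all of its slices
    are. *)
Lemma ae_slices (W : M * N -> C) (k : R) : cmeasurable (W : X -> C) ->
  {ae muN, forall y, {ae muM, forall x, normc (W (x, y)) <= k}} ->
  {ae muX, forall z, normc (W z) <= k}.
Proof.
move=> mW h; pose S : set X := [set z | k < normc (W z)].
have mS : measurable S.
  rewrite (_ : S = (fun z : X => normc (W z)) @^-1` `]k, +oo[%classic); last first.
    by apply/seteqP; split => z /=; rewrite in_itv /= andbT.
  by rewrite -[X in measurable X]setTI; exact: measurable_normc.
have mf : measurable_fun [set: X] (fun z => (\1_S z : R)%:E).
  by apply/measurable_EFinP; exact: measurable_indic.
have f0 (z : M * N) : (0 <= (\1_S z : R)%:E)%E by rewrite lee_fin.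
have [_ _ _ I] := borel_tonelli scM scN sfM sfN rect mf f0.
exists S; split => //; last by move=> z /= /negP; rewrite -ltNge.
have null (d : measure_display) (T : measurableType d) (mu : {measure set T -> \bar R})
    (g : T -> \bar R) : (forall x, 0 <= g x)%E -> {ae mu, forall x, (g x <= 0)%E} ->
    (\int[mu]_x g x <= 0)%E.
  move=> g0 [Z [mZ Z0 gZ]].
  apply: (@le_trans _ _ (\int[mu]_x (+oo * (\1_Z x)%:E))%E).
    apply: nonneg_integral_le => // x; rewrite indicE.
    have [Zx|nZ] := pselect (Z x); first by rewrite mem_set// mule1 leey.
    by rewrite memNset// mule0; apply: contrapT => gx; apply: nZ; exact: gZ.
  rewrite ge0_integralZl//; last by apply/measurable_EFinP; exact: measurable_indic.
  by rewrite integral_indic// setIT [X in (_ * X)%E]Z0 mule0.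
apply/eqP; rewrite eq_le measure_ge0 andbT.
have := integral_indic muX measurableT mS; rewrite setIT => <-.
rewrite I; apply: (null) => [y|]; first by apply: integral_ge0.
apply: filterS h => y hy; apply: (null) => //.
apply: filterS hy => x hx; rewrite /= indicE memNset// /S /=; apply/negP.
by rewrite -leNgt.
Qed.

Variables (VM : (M -> C) -> M -> C) (VN : (N -> C) -> N -> C)
  (VX : (M * N -> C) -> M * N -> C).
Hypotheses (linM : linear_operator muM (L2 muM) VM)
  (linN : linear_operator muN (L2 muN) VN) (linX : linear_operator muX (L2 muX) VX).
Hypothesis VXE : forall (f : M -> C) (g : N -> C), L2 muM f -> L2 muN g ->
  aeq muX (VX (tensor f g)) (tensor (VM f) (VN g)).
Variables (k1 k2 : R).
Hypotheses (k1_ge0 : 0 <= k1) (k2_ge0 : 0 <= k2).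

Section decomposed.
Variables (J : finType) (A : J -> set M) (b : J -> N -> C) (B : set N) (m : R).
Hypothesis mA : forall i, @measurable _ (borel M) (A i) /\ (muM (A i) < +oo)%E.
Hypothesis mB : @measurable _ (borel N) B /\ (muN B < +oo)%E.
Hypothesis bP : forall i, cmeasurable (b i : borel N -> C) /\
  forall y, normc (b i y) <= m /\ (~ B y -> b i y = 0).
Hypothesis disjA : forall i j x, A i x -> A j x -> i = j.
Variable G : M * N -> C.
Hypothesis GE : forall x y, G (x, y) = \sum_i (\1_(A i) x)%:C%C * b i y.

Let u i := VM (fun x => (\1_(A i) x)%:C%C).
Let v i := VN (b i).
Let W : M * N -> C := fun z => \sum_i 1 * tensor (u i) (v i) z.

Let L2A i : L2 muM (fun x => (\1_(A i) x)%:C%C).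
Proof. by apply: L2_ind; [exact: (mA i).1|exact: (mA i).2]. Qed.
Let L2b i : L2 muN (b i).
Proof. exact: (L2_bounded mB.1 mB.2 (bP i).1 (bP i).2). Qed.
Let L2u i : L2 muM (u i). Proof. exact: (lop_L2 linM). Qed.
Let L2v i : L2 muN (v i). Proof. exact: (lop_L2 linN). Qed.

Let slice_step (y : N) : (fun x : M => G (x, y)) = step_fun A (fun i => b i y).
Proof. by apply/funext => x; rewrite GE; apply: eq_bigr => i _; rewrite mulrC. Qed.

Let LW : L2 muX W.
Proof. by apply: L2_sum => i; exact: (L2_tensor scM scN sfM sfN rect). Qed.

Let LG : L2 muX G.
Proof.
rewrite (_ : G = fun z => \sum_i 1 * tensor (fun x => (\1_(A i) x)%:C%C) (b i) z).
  by apply: L2_sum => i; exact: (L2_tensor scM scN sfM sfN rect).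
by apply/funext => -[x y]; rewrite GE; apply: eq_bigr => i _; rewrite mul1r.
Qed.

Let VG : aeq muX W (VX G).
Proof.
rewrite (_ : G = fun z => \sum_i 1 * tensor (fun x => (\1_(A i) x)%:C%C) (b i) z); last first.
  by apply/funext => -[x y]; rewrite GE; apply: eq_bigr => i _; rewrite mul1r.
apply: aeq_sym; apply: aeq_trans (lop_sum linX _ (fun=> 1) _) _ => [i|].
  exact: (L2_tensor scM scN sfM sfN rect).
have h : {ae muX, forall z, forall i, VX (tensor (fun x => (\1_(A i) x)%:C%C) (b i)) z =
    tensor (u i) (v i) z}.
  apply: filter_forall => i; apply: filterS (VXE (L2A i) (L2b i)) => z; exact.
by apply: filterS h => z hz _; apply: eq_bigr => i _; rewrite hz.
Qed.

(** For fixed [y], the function $W(\cdot,y)$ is the image of a step function. *)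
Let slice (y : N) : aeq muM (VM (step_fun A (fun i => v i y))) (fun x => W (x, y)).
Proof.
apply: aeq_trans (lop_sum linM _ _ L2A) _.
rewrite (_ : (fun x => W (x, y)) = fun x => \sum_i v i y * u i x); first exact: aeq_refl.
by apply/funext => x; apply: eq_bigr => i _; rewrite mul1r /tensor mulrC.
Qed.

Let meas_slice (y : N) : cmeasurable ((fun x => W (x, y)) : borel M -> C).
Proof.
apply: L2_meas; rewrite (_ : (fun x => W (x, y)) = fun x => \sum_i v i y * u i x).
  exact: L2_sum.
by apply/funext => x; apply: eq_bigr => i _; rewrite mul1r /tensor mulrC.
Qed.

Let slice_bound p q (y : N) c :
  (forall f c, L2 muM f -> 0 <= c -> Lp_bound muM q c f -> Lp_bound muM p (k1 * c) (VM f)) ->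
  0 <= c -> Lp_bound muM q c (step_fun A (fun i => v i y)) ->
  Lp_bound muM p (k1 * c) (fun x => W (x, y)).
Proof.
move=> hM c0 hc; have Ls := L2_step mA (fun i => v i y).
apply: Lp_bound_aeq (slice y) _ => //; first exact: (L2_meas (lop_L2 linM Ls)).
exact: hM.
Qed.

(** When the target norm is the supremum norm, it suffices to bound almost every
    slice. *)
Let estimate_slices q c :
  (forall f c, L2 muM f -> 0 <= c -> Lp_bound muM q c f -> Lp_bound muM +oo (k1 * c) (VM f)) ->
  0 <= c -> {ae muN, forall y, Lp_bound muM q c (step_fun A (fun i => v i y))} ->
  Lp_bound muX +oo (k1 * c) (VX G).
Proof.
move=> hM c0 h; apply: Lp_bound_aeq (L2_meas LW) _ VG _.
  exact: (L2_meas (lop_L2 linX LG)).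
apply: ae_slices; first exact: (L2_meas LW).
by apply: filterS h => y hy; exact: (slice_bound hM c0 hy).
Qed.

Lemma estimate_infty_infty : 0 <= m ->
  (forall f c, L2 muM f -> 0 <= c -> Lp_bound muM +oo c f -> Lp_bound muM +oo (k1 * c) (VM f)) ->
  (forall g c, L2 muN g -> 0 <= c -> Lp_bound muN +oo c g -> Lp_bound muN +oo (k2 * c) (VN g)) ->
  Lp_bound muX +oo (k1 * k2 * m) (VX G).
Proof.
move=> m0 hM hN; rewrite -mulrA; apply: (estimate_slices hM); first by rewrite mulr_ge0.
have h : {ae muN, forall y, forall i, normc (v i y) <= k2 * m}.
  apply: filter_forall => i; apply: hN => //; apply: aeW => y.
  by have [] := (bP i).2 y.
apply: filterS h => y hy; apply: aeW => x.
have [[i Ax]|nA] := pselect (exists i, A i x); first by rewrite (step_in disjA _ Ax).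
rewrite step_out ?normc0 ?mulr_ge0// => i Ax; apply: nA; by exists i.
Qed.

Section finite_exponent.
Variable q : R.
Hypothesis q1 : 1 <= q.
Let q0 : 0 < q. Proof. exact: lt_le_trans q1. Qed.
Let w i := fine (muM (A i)).
Let beta i := fine (power_integral muN q (b i)).

Let w_ge0 i : 0 <= w i. Proof. exact: fine_ge0. Qed.
Let beta_ge0 i : 0 <= beta i.
Proof. by apply: fine_ge0; apply: integral_ge0 => y _; rewrite lee_fin powR_ge0. Qed.

(** The $b_i$ are bounded with support in a set of finite measure. *)
Let betaE i : power_integral muN q (b i) = (beta i)%:E.
Proof.
rewrite fineK// ge0_fin_numE; last by apply: integral_ge0 => y _; rewrite lee_fin powR_ge0.
apply: (@le_lt_trans _ _ (\int[muN]_y ((`|m| `^ q)%:E * (\1_B y)%:E))%E).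
  apply: nonneg_integral_le => y; first by rewrite lee_fin powR_ge0.
  have [by_m bB] := (bP i).2 y; rewrite indicE.
  have [By|nB] := pselect (B y); last by rewrite bB// normc0 powR0 ?gt_eqF// memNset// mule0.
  rewrite mem_set// mule1 lee_fin ge0_ler_powR ?nnegrE ?normc_ge0 ?(ltW q0)//.
  exact: le_trans by_m (ler_norm _).
rewrite ge0_integralZl_EFin ?powR_ge0//; last first.
  by apply/measurable_EFinP; apply: measurable_indic; exact: mB.1.
rewrite integral_indic ?setIT; last exact: mB.1; last by [].
by rewrite lte_mul_pinfty ?lee_fin ?powR_ge0//; exact: mB.2.
Qed.

Let power_integral_grid : power_integral muX q G = (\sum_i w i * beta i)%:E.
Proof.
have mG : measurable_fun [set: X] (fun z => (normc (G z) `^ q)%:E).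
  by apply/measurable_EFinP; apply: measurable_powR_normc; exact: (L2_meas LG).
have G0 (z : M * N) : (0 <= (normc (G z) `^ q)%:E)%E by rewrite lee_fin powR_ge0.
have [_ _ _ I] := borel_tonelli scM scN sfM sfN rect mG G0.
rewrite /power_integral I.
transitivity (\int[muN]_y \sum_i ((w i)%:E * (normc (b i y) `^ q)%:E))%E.
  apply: eq_integral => y _; have := power_integral_step mA disjA (fun i => b i y) q0.
  rewrite -slice_step /power_integral => ->.
  by rewrite -sumEFin; apply: eq_bigr => i _; rewrite EFinM.
have mb i : measurable_fun [set: borel N] (fun y => (normc (b i y) `^ q)%:E).
  by apply/measurable_EFinP; apply: measurable_powR_normc; exact: (bP i).1.
rewrite ge0_integral_sum//.
- rewrite -sumEFin; apply: eq_bigr => i _.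
  rewrite ge0_integralZl_EFin//; first by rewrite -/(power_integral muN q (b i)) betaE.
  by move=> y _; rewrite lee_fin powR_ge0.
- move=> i; apply: emeasurable_funM => //.
- by move=> i y _; rewrite mule_ge0 ?lee_fin ?powR_ge0.
Qed.

Let gam i := beta i `^ q^-1.
Let gamE i : gam i `^ q = beta i.
Proof. by rewrite /gam -powRrM mulVf ?gt_eqF// powRr1. Qed.
Let gam_ge0 i : 0 <= gam i. Proof. exact: powR_ge0. Qed.

Let bound_b i : Lp_bound muN q%:E (gam i) (b i).
Proof. by rewrite /= betaE gamE. Qed.

Variable c : R.
Hypothesis c0 : 0 <= c.
Hypothesis Gc : Lp_bound muX q%:E c G.

Let sum_le : \sum_i w i * beta i <= c `^ q.
Proof. by move: Gc; rewrite /= power_integral_grid lee_fin. Qed.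

(** As below, with a supremum in place of the outer norm. *)
Lemma estimate_finite_infty :
  (forall f c, L2 muM f -> 0 <= c -> Lp_bound muM q%:E c f -> Lp_bound muM +oo (k1 * c) (VM f)) ->
  (forall g c, L2 muN g -> 0 <= c -> Lp_bound muN q%:E c g -> Lp_bound muN +oo (k2 * c) (VN g)) ->
  Lp_bound muX +oo (k1 * k2 * c) (VX G).
Proof.
move=> hM hN; rewrite -mulrA; apply: (estimate_slices hM); first by rewrite mulr_ge0.
have h : {ae muN, forall y, forall i, normc (v i y) <= k2 * gam i}.
  by apply: filter_forall => i; exact: hN.
apply: filterS h => y hy; rewrite /= (power_integral_step mA disjA)// lee_fin.
rewrite powRM//; apply: (@le_trans _ _ (k2 `^ q * \sum_i w i * beta i)); last first.
  by rewrite ler_wpM2l ?powR_ge0.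
rewrite mulr_sumr; apply: ler_sum => i _; rewrite mulrCA ler_wpM2l//.
rewrite -gamE -powRM// ge0_ler_powR ?nnegrE ?normc_ge0 ?(ltW q0)//.
exact: mulr_ge0.
Qed.

(** The first estimate on each slice bounds the $L^p$ norm of the slice by that of
    a step function, that is by $(\sum_iw_i|v_i(y)|^q)^{1/q}$. Minkowski's
    inequality with exponent $p/q\ge1$ moves the norm in [y] inside the sum, where
    the second estimate applies to each $v_i$. *)
Lemma estimate_finite_finite p : q <= p ->
  (forall f c, L2 muM f -> 0 <= c -> Lp_bound muM q%:E c f -> Lp_bound muM p%:E (k1 * c) (VM f)) ->
  (forall g c, L2 muN g -> 0 <= c -> Lp_bound muN q%:E c g -> Lp_bound muN p%:E (k2 * c) (VN g)) ->
  Lp_bound muX p%:E (k1 * k2 * c) (VX G).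
Proof.
move=> qp hM hN; have p0 : 0 < p by exact: lt_le_trans qp.
apply: Lp_bound_aeq (L2_meas LW) _ VG _; first exact: (L2_meas (lop_L2 linX LG)).
have mW : measurable_fun [set: X] (fun z => (normc (W z) `^ p)%:E).
  by apply/measurable_EFinP; apply: measurable_powR_normc; exact: (L2_meas LW).
have W0 (z : M * N) : (0 <= (normc (W z) `^ p)%:E)%E by rewrite lee_fin powR_ge0.
have [_ _ _ I] := borel_tonelli scM scN sfM sfN rect mW W0.
rewrite /= /power_integral I.
pose s := p / q; have s1 : 1 <= s by rewrite ler_pdivlMr// mul1r.
have qs : q * s = p by rewrite /s mulrC divfK ?gt_eqF.
pose f i y := w i * normc (v i y) `^ q.
have f0 i y : 0 <= f i y by rewrite mulr_ge0 ?powR_ge0.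
have sf0 y : 0 <= \sum_i f i y by apply: sumr_ge0.
have mf i : measurable_fun [set: borel N] (f i).
  apply: measurable_funM; first exact: measurable_cst.
  by apply: measurable_powR_normc; exact: (L2_meas (L2v i)).
apply: (@le_trans _ _ (\int[muN]_y ((k1 `^ p)%:E * ((\sum_i f i y) `^ s)%:E))%E).
  apply: nonneg_integral_le => y.
    by apply: integral_ge0 => x _; rewrite lee_fin powR_ge0.
  have c1 : 0 <= (\sum_i f i y) `^ q^-1 by exact: powR_ge0.
  have := slice_bound hM c1 _; rewrite /= /power_integral => /(_ y) h.
  have -> : ((k1 `^ p)%:E * ((\sum_i f i y) `^ s)%:E)%E =
      ((k1 * (\sum_i f i y) `^ q^-1) `^ p)%:E.
    by rewrite powRM// -powRrM -EFinM /s [q^-1 * p]mulrC.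
  apply: h; rewrite -powRrM mulVf ?gt_eqF// powRr1//.
  by have := power_integral_step mA disjA (fun i => v i y) q0; rewrite /power_integral => ->.
rewrite ge0_integralZl_EFin ?powR_ge0//; first last.
- apply/measurable_EFinP; apply: (measurableT_comp (measurable_powR s)).
  exact: measurable_sum.
- by move=> y _; rewrite lee_fin powR_ge0.
have Df i : (\int[muN]_y (f i y `^ s)%:E <= ((w i * (k2 * gam i) `^ q) `^ s)%:E)%E.
  have := hN _ _ (L2b i) (gam_ge0 i) (bound_b i); rewrite /= /power_integral => h.
  under eq_integral => y _ do rewrite /f powRM ?powR_ge0// -powRrM qs EFinM.
  have mv : measurable_fun [set: borel N] (fun y => (normc (v i y) `^ p)%:E).
    by apply/measurable_EFinP; apply: measurable_powR_normc; exact: (L2_meas (L2v i)).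
  have v0 y : setT y -> (0 <= (normc (v i y) `^ p)%:E)%E by move=> _; rewrite lee_fin powR_ge0.
  rewrite (ge0_integralZl_EFin muN measurableT v0 mv (powR_ge0 (w i) s)).
  rewrite (powRM s (w_ge0 i) (powR_ge0 (k2 * gam i) q)) -(powRrM (k2 * gam i)) qs EFinM.
  by apply: lee_wpmul2l => //; rewrite lee_fin powR_ge0.
have D0 i : 0 <= w i * (k2 * gam i) `^ q by rewrite mulr_ge0 ?powR_ge0.
have := minkowski_sum (index_enum J) s1 mf f0 D0 Df => h.
apply: le_trans (lee_wpmul2l _ h) _; first by rewrite lee_fin powR_ge0.
rewrite -EFinM lee_fin -mulrA powRM ?mulr_ge0// ler_wpM2l ?powR_ge0//.
rewrite -qs powRrM ge0_ler_powR ?nnegrE ?powR_ge0 ?sumr_ge0//; last first.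
  rewrite powRM//; apply: (@le_trans _ _ (k2 `^ q * \sum_i w i * beta i)); last first.
    by rewrite ler_wpM2l ?powR_ge0.
  by rewrite mulr_sumr; apply: ler_sum => i _; rewrite powRM// gamE mulrCA.
exact: le_trans s1.
Qed.

End finite_exponent.
End decomposed.

End grid_estimate.

(** * Approximation *)

Lemma cvg_powR (R : realType) (p l : R) (u : nat -> R) : 0 < p ->
  (forall n, 0 <= u n) -> u @ \oo --> l -> (fun n => u n `^ p) @ \oo --> l `^ p.
Proof.
move=> p0 u0 ul; have l0 : 0 <= l.
  by rewrite -(cvg_lim _ ul)//; apply: limr_ge; [apply/cvg_ex; exists l|exact: nearW].
have [l1|] := ltrP 0 l; last first.
  move=> l1; have {l1 l0} l0 : l = 0 by apply/eqP; rewrite eq_le l1.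
  rewrite l0 powR0 ?gt_eqF//; apply/cvgrPdist_lt => e e0.
  have e1 : 0 < e `^ p^-1 by exact: powR_gt0.
  move/cvgrPdist_lt: ul => /(_ _ e1); apply: filterS => n.
  rewrite l0 !sub0r !normrN !ger0_norm ?powR_ge0// => h.
  have := @gt0_ltr_powR _ p p0 (u n) (e `^ p^-1).
  rewrite !nnegrE u0 powR_ge0 -powRrM mulVf ?gt_eqF// powRr1 ?(ltW e0)//.
  exact.
have E (a : R) : 0 < a -> a `^ p = expR (p * ln a) by move=> a0; rewrite /powR gt_eqF.
rewrite E//.
have : (fun n => expR (p * ln (u n))) @ \oo --> expR (p * ln l).
  apply: (continuous_cvg _ (@continuous_expR R _)).
  apply: cvgM; first exact: cvg_cst.
  exact: (continuous_cvg _ (continuous_ln l1)).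
apply: cvg_trans; apply: near_eq_cvg.
have : \forall n \near \oo, 0 < u n by apply: (cvgr_gt l).
by apply: filterS => n un; rewrite E.
Qed.

Section lower_semicontinuity.
Context {d : measure_display} {T : measurableType d} {R : realType}.
Variable mu : {measure set T -> \bar R}.
Local Notation C := R[i].
Local Notation normc := (@Normc.normc R).
Local Notation nrm2 := (nrm2 mu).

(** Fast convergence in $L^2$ implies convergence almost everywhere, because
    the sum of the squares is integrable. *)
Lemma fast_L2_ae_cvg (h : nat -> T -> C) : (forall n, L2 mu (h n)) ->
  (forall n, nrm2 (h n) <= (2 ^ n.+1)%:R^-1) ->
  {ae mu, forall x, (fun n => (normc (h n x) ^+ 2)%:E) @ \oo --> 0%E}.
Proof.
move=> Lh hn; pose g n x := (normc (h n x) ^+ 2)%:E.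
have g0 n x : (0 <= g n x)%E by rewrite lee_fin sqr_ge0.
have mg n : measurable_fun setT (g n).
  by apply/measurable_EFinP; apply: measurable_normc2; exact: (L2_meas (Lh n)).
have I : (\int[mu]_x \sum_(0 <= n <oo) g n x < +oo)%E.
  rewrite integral_nneseries//.
  apply: (@le_lt_trans _ _ (\sum_(0 <= n <oo) (1 / (2 ^ (n + 0.+1))%:R : R)%:E)%E).
    apply: lee_nneseries => [n _ _|n _]; first exact: integral_ge0.
    by rewrite -/(energy mu (h n)) energyE// lee_fin addn1 mul1r.
  by rewrite (cvg_lim _ (@cvg_geometric_eseries_half R 1 0))// ltry.
have /integrable_ae : mu.-integrable setT (fun x => \sum_(0 <= n <oo) g n x)%E.
  apply/integrableP; split; first by apply: ge0_emeasurable_sum.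
  by under eq_integral => x _ do rewrite gee0_abs ?nneseries_ge0//.
move=> /(_ measurableT); apply: filterS => x /(_ Logic.I) fx.
have s : (\sum_(0 <= n <oo) g n x < +oo)%E by rewrite ltey_eq fx.
have tail := nneseries_tail_cvg s (fun n _ => g0 n x).
apply: (squeeze_cvge _ (cvg_cst 0%E) tail); apply: nearW => n; rewrite -/(g n x) g0/=.
have := @nneseries_lim_ge _ (fun k => g k x) xpredT n n.+1 (fun k _ _ => g0 k x).
by rewrite big_nat1.
Qed.

(** Fatou's lemma along a sequence that converges almost everywhere. *)
Lemma Lp_bound_lsc p k (G : nat -> T -> C) H : (1 <= p)%E -> 0 <= k ->
  (forall n, L2 mu (G n)) -> L2 mu H -> (forall n, Lp_bound mu p k (G n)) ->
  (forall n, nrm2 (sub H (G n)) <= (2 ^ n.+1)%:R^-1) -> Lp_bound mu p k H.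
Proof.
move=> p1 k0 LG LH Gk HG.
have Ls n : L2 mu (sub H (G n)) by exact: L2_sub.
have cv : {ae mu, forall x, (fun n => normc (G n x)) @ \oo --> normc (H x)}.
  apply: filterS (fast_L2_ae_cvg Ls HG) => x /fine_cvgP[_ /cvgrPdist_lt hx].
  apply/cvgrPdist_lt => e e0; have := hx (e ^+ 2) ltac:(by rewrite exprn_gt0).
  apply: filterS => n /=.
  rewrite sub0r normrN ger0_norm ?sqr_ge0// ltr_sqr ?nnegrE ?normc_ge0 ?(ltW e0)// => hn.
  apply: le_lt_trans hn; rewrite ler_norml; apply/andP; split.
    rewrite lerNl opprB lerBlDr addrC.
    have -> : G n x = H x + (- (sub H (G n) x)) by rewrite /sub; ring.
    by apply: le_trans (le_normcD _ _) _; rewrite normcN.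
  rewrite lerBlDr addrC.
  have {1}-> : H x = G n x + sub H (G n) x by rewrite /sub; ring.
  exact: le_normcD.
case: p p1 Gk => [p||]//=; rewrite ?lee_fin => p1 Gk; last first.
  have h : {ae mu, forall x, forall n, normc (G n x) <= k}.
    exact: ae_foralln.
  apply: filterS2 cv h => x cx hx; rewrite -(cvg_lim _ cx)//.
  by apply: limr_le; [apply/cvg_ex; eexists; exact: cx|exact: nearW].
have p0 : 0 < p by exact: lt_le_trans p1.
have mG n : measurable_fun setT (fun x => (normc (G n x) `^ p)%:E).
  by apply/measurable_EFinP; apply: measurable_powR_normc; exact: (L2_meas (LG n)).
have mH : measurable_fun setT (fun x => (normc (H x) `^ p)%:E).
  by apply/measurable_EFinP; apply: measurable_powR_normc; exact: (L2_meas LH).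
have g0 n x : setT x -> (0 <= (normc (G n x) `^ p)%:E)%E by rewrite lee_fin powR_ge0.
rewrite /power_integral; apply: (@le_trans _ _ (limn_einf (fun n =>
    \int[mu]_x (normc (G n x) `^ p)%:E)%E)).
  apply: le_trans (fatou mu measurableT mG g0); rewrite le_eqVlt; apply/orP; left; apply/eqP.
  apply: ae_eq_integral => //.
    apply: (emeasurable_fun_cvg
        (fun m x => einfs (fun n => (normc (G n x) `^ p)%:E) m)) => [m|x _].
      exact: (measurable_fun_einfs mG).
    by rewrite limn_einf_lim; exact: is_cvg_einfs.
  apply: filterS cv => x cx _.
  have c : (fun n => (normc (G n x) `^ p)%:E) @ \oo --> (normc (H x) `^ p)%:E.
    apply: cvg_EFin; first exact: nearW.
    by apply: cvg_powR => // n; exact: normc_ge0.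
  by rewrite (cvg_limn_einf_sup c).1.
rewrite limn_einf_lim; apply: lime_le; first exact: is_cvg_einfs.
apply: nearW => n; apply: le_trans (Gk n).
by apply: ereal_inf_lbound; exists n => //=.
Qed.

End lower_semicontinuity.

Section clipping.
Variable R : realType.
Local Notation C := R[i].
Local Notation normc := (@Normc.normc R).

Definition clip (k : R) (z : C) : C := if normc z <= 2 * k then z else 0.

Lemma clip0 k : clip k 0 = 0. Proof. by rewrite /clip; case: ifP. Qed.

Lemma normc_clip k z : 0 <= k -> normc (clip k z) <= 2 * k.
Proof. by move=> k0; rewrite /clip; case: ifP => //; rewrite normc0 mulr_ge0. Qed.

(** A value [z] that is clipped is farther than [k] from the disk of radius
    [k], so clipping approximants loses nothing. *)
Lemma clip_close k w z : normc w <= k -> normc (w - clip k z) <= normc (w - z).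
Proof.
move=> wk; rewrite /clip; case: ifPn => //; rewrite -ltNge subr0 => h.
have : normc z <= normc w + normc (w - z).
  have {1}-> : z = w + - (w - z) by ring.
  by apply: le_trans (le_normcD _ _) _; rewrite normcN.
by lra.
Qed.

End clipping.

Lemma nrm2_mono (d : measure_display) (T : measurableType d) (R : realType)
    (mu : {measure set T -> \bar R}) (f g : T -> R[i]) : L2 mu f -> L2 mu g ->
  (forall x, Normc.normc (f x) <= Normc.normc (g x)) -> nrm2 mu f <= nrm2 mu g.
Proof.
move=> Lf Lg fg; rewrite -lee_fin -(energyE Lf) -(energyE Lg).
apply: nonneg_integral_le => x; first by rewrite lee_fin sqr_ge0.
by rewrite lee_fin ler_sqr ?nnegrE ?normc_ge0.
Qed.

Lemma cmeasurable_cut (d : measure_display) (T : measurableType d) (R : realType)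
    (S : set T) (f : T -> R[i]) : measurable S -> cmeasurable f ->
  cmeasurable (fun x => (\1_S x)%:C%C * f x).
Proof.
move=> mS mf; apply: cmeasurableM => //.
by split; [exact: measurable_indic|exact: measurable_cst].
Qed.

Lemma normc_cut (T : Type) (R : realType) (S : set T) (f : T -> R[i]) x :
  Normc.normc ((\1_S x)%:C%C * f x) <= Normc.normc (f x).
Proof.
rewrite indicE; case: (_ \in _); first by rewrite mul1r.
by rewrite mul0r normc0 normc_ge0.
Qed.

Lemma measurable_sublevel (d : measure_display) (T : measurableType d) (R : realType)
    (f : T -> R[i]) (k : R) : cmeasurable f -> measurable [set x | Normc.normc (f x) <= k].
Proof.
move=> mf; rewrite (_ : [set x | _] = (fun x => Normc.normc (f x)) @^-1` `]-oo, k]%classic).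
  by rewrite -[X in measurable X]setTI; exact: measurable_normc.
by apply/seteqP; split => x /=; rewrite in_itv.
Qed.

Section approximation.
Variables (R : realType) (M N : ptopologicalType).
Hypotheses (scM : second_countable (T := M)) (scN : second_countable (T := N)).
Local Notation X := (borel (M * N)%type).
Variables (muM : {measure set (borel M) -> \bar R})
  (muN : {measure set (borel N) -> \bar R}) (muX : {measure set X -> \bar R}).
Hypotheses (sfM : sigma_finite setT muM) (sfN : sigma_finite setT muN).
Hypothesis rect : forall (A : set M) (B : set N),
  @measurable _ (borel M) A -> @measurable _ (borel N) B ->
  muX (A `*` B : set (M * N)) = (muM A * muN B)%E.
Local Notation C := R[i].
Local Notation normc := (@Normc.normc R).
Local Notation nX := (nrm2 muX).
Let Lgrid := L2_grid scM scN rect.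

(** Clip at height [2 * c] an approximant of the function [F], made pointwise
    bounded by changing it on a null set. *)
Lemma approximation_infty (F : M * N -> C) (c e : R) : 0 <= c -> 0 < e -> L2 muX F ->
  Lp_bound muX +oo c F ->
  exists G, [/\ grid muM muN G, nX (sub F G) < e & forall z, normc (G z) <= 2 * c].
Proof.
move=> c0 e0 LF Fc; pose S : set X := [set z | normc (F z) <= c].
have mF := L2_meas LF; have mS : measurable S by exact: measurable_sublevel.
pose F' : X -> C := fun z => (\1_S z)%:C%C * F z.
have LF' : L2 muX F'.
  by apply: (L2_dom _ LF) => [|z]; [exact: cmeasurable_cut|exact: normc_cut].
have F'c z : normc (F' z) <= c.
  rewrite /F' indicE; have [Sz|nS] := pselect (S z); first by rewrite mem_set// mul1r.
  by rewrite memNset// mul0r normc0.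
have FF' : aeq muX F F'.
  by apply: filterS Fc => z Fz _; rewrite /F' indicE mem_set ?mul1r.
have [G0 gG0 hG0] := grid_dense scM scN sfM sfN rect LF' e0.
have gG : grid muM muN (fun z => clip c (G0 z)) by apply: grid_map; rewrite ?clip0.
exists (fun z => clip c (G0 z)); split => //; last by move=> z; exact: normc_clip.
have [LG LG0] := (Lgrid gG, Lgrid gG0).
apply: le_lt_trans hG0; have [Ls Ls'] := (L2_sub LF LG, L2_sub LF' LG).
rewrite (aeq_nrm2 Ls Ls'); last by apply: aeq_sub => //; exact: aeq_refl.
by apply: nrm2_mono => //; [exact: L2_sub|move=> z; exact: clip_close].
Qed.

(** On a set of finite measure a bounded function that is small in $L^2$ is
    small in every $L^q$ with finite [q]. *)
Let small_power_integral (d : measure_display) (T : measurableType d)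
    (mu : {measure set T -> \bar R}) (Q : set T) (D : T -> C) (q k dl : R) :
  1 <= q -> 0 < dl -> 0 <= k -> measurable Q -> (mu Q < +oo)%E -> L2 mu D ->
  (forall x, normc (D x) <= k /\ (~ Q x -> D x = 0)) ->
  (power_integral mu q D <=
     (dl `^ q * fine (mu Q) + k `^ q / dl ^+ 2 * nrm2 mu D)%:E)%E.
Proof.
move=> q1 dl0 k0 mQ Qoo LD Dk; have q0 : 0 < q by exact: lt_le_trans q1.
have P : 0 <= k `^ q / dl ^+ 2 by rewrite divr_ge0 ?powR_ge0 ?sqr_ge0.
apply: (@le_trans _ _ (\int[mu]_x ((dl `^ q)%:E * (\1_Q x)%:E +
    (k `^ q / dl ^+ 2)%:E * (normc (D x) ^+ 2)%:E))%E).
  apply: nonneg_integral_le => x; first by rewrite lee_fin powR_ge0.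
  rewrite -!EFinM -EFinD lee_fin; have [Dxk DQ] := Dk x; rewrite indicE.
  have [Qx|nQ] := pselect (Q x); last first.
    by rewrite DQ// normc0 powR0 ?gt_eqF// memNset// mulr0 add0r expr0n mulr0.
  rewrite mem_set// mulr1; have [h|h] := leP (normc (D x)) dl.
    apply: (@le_trans _ _ (dl `^ q)); last by rewrite lerDl mulr_ge0 ?sqr_ge0.
    by rewrite ge0_ler_powR ?nnegrE ?normc_ge0 ?(ltW q0) ?(ltW dl0).
  apply: (@le_trans _ _ (k `^ q)).
    by rewrite ge0_ler_powR ?nnegrE ?normc_ge0 ?(ltW q0).
  apply: (@le_trans _ _ (k `^ q / dl ^+ 2 * normc (D x) ^+ 2)); last first.
    by rewrite lerDr powR_ge0.
  rewrite -mulrA ler_peMr ?powR_ge0// mulrC ler_pdivlMr ?exprn_gt0// mul1r.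
  by rewrite ler_sqr ?nnegrE ?normc_ge0 ?(ltW dl0) ?(ltW h).
have m2 : measurable_fun setT (fun x => (normc (D x) ^+ 2)%:E).
  by apply/measurable_EFinP; apply: measurable_normc2; exact: (L2_meas LD).
have mi : measurable_fun setT (fun x => (\1_Q x : R)%:E).
  by apply/measurable_EFinP; exact: measurable_indic.
rewrite ge0_integralD//; first last.
- by apply: emeasurable_funM => //; exact: measurable_cst.
- by move=> x _; rewrite mule_ge0 ?lee_fin ?sqr_ge0.
- by apply: emeasurable_funM => //; exact: measurable_cst.
- by move=> x _; rewrite mule_ge0 ?lee_fin ?powR_ge0.
rewrite !ge0_integralZl_EFin ?powR_ge0//; last first.
  by move=> x _; rewrite lee_fin sqr_ge0.
have -> : (\int[mu]_x (\1_Q x)%:E = (fine (mu Q))%:E)%E.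
  by rewrite integral_indic// setIT fineK// ge0_fin_numE.
by rewrite -/(energy mu D) energyE// -!EFinM -EFinD.
Qed.

(** Cut off [F] at a large height and outside a large rectangle, approximate
    the result in $L^2$, and clip the approximant in the same way. *)
Lemma approximation_finite (F : M * N -> C) (q c e : R) : 1 <= q -> 0 < c -> 0 < e ->
  L2 muX F -> Lp_bound muX q%:E c F ->
  exists G, [/\ grid muM muN G, nX (sub F G) < e & Lp_bound muX q%:E (2 * c) G].
Proof.
move=> q1 c0 e0 LF Fc; have q0 : 0 < q by exact: lt_le_trans q1.
have mF := L2_meas LF.
have [A [B [mAB finAB exh]]] := rectangle_exhaustion sfM sfN.
pose Q n : set X := A n `*` B n; pose S n : set X := Q n `&` [set z | normc (F z) <= n%:R].
have mQ n : measurable (Q n).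
  apply/(measurable_borel_prod scM scN); have [mA mB] := mAB n.
  exact: (@measurableX _ _ (borel M) (borel N)).
have mS n : measurable (S n) by apply: measurableI => //; exact: measurable_sublevel.
have Qoo n : (muX (Q n) < +oo)%E.
  have [mA mB] := mAB n; have [Aoo Boo] := finAB n.
  by rewrite rect// lte_mul_pinfty// ge0_fin_numE.
pose F' n : X -> C := fun z => (\1_(S n) z)%:C%C * F z.
have [n Fn] : exists n, nX (sub F (F' n)) < e / 4.
  apply: L2_dominated_near => //.
  - by move=> n; exact: cmeasurable_cut.
  - by move=> n z; exact: normc_cut.
  - move=> z; apply/cvgrPdist_lt => e1 e10.
    have : \forall k \near \oo, normc (F z) <= k%:R by exact: nbhs_infty_ger.
    apply: filterS2 (exh z) => k Qk Fk.
    by rewrite /F' indicE mem_set// mul1r subrr normc0 subrr normr0.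
  - by rewrite divr_gt0.
have LF' : L2 muX (F' n).
  by apply: (L2_dom _ LF) => [|z]; [exact: cmeasurable_cut|exact: normc_cut].
have F'n z : normc (F' n z) <= n%:R.
  rewrite /F' indicE; have [Sz|nS] := pselect (S n z).
    by rewrite mem_set// mul1r; exact: Sz.2.
  by rewrite memNset// mul0r normc0.
have F'Q z : ~ Q n z -> F' n z = 0.
  by move=> nQ; rewrite /F' indicE memNset ?mul0r// => -[].
pose V := fine (muX (Q n)); have V0 : 0 <= V by exact: fine_ge0.
have V1 : 0 < 2 * (V + 1) by rewrite mulr_gt0// ltr_wpDl.
pose dl := c * (2 * (V + 1))^-1 `^ q^-1.
have dl0 : 0 < dl by apply: mulr_gt0 => //; apply: powR_gt0; rewrite invr_gt0.
have dlV : dl `^ q * V <= c `^ q / 2.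
  rewrite /dl powRM ?(ltW c0) ?powR_ge0// -powRrM mulVf ?gt_eqF// powRr1 ?invr_ge0 ?(ltW V1)//.
  rewrite -mulrA ler_wpM2l ?powR_ge0// mulrC ler_pdivrMr//; lra.
pose k : R := 3 * n%:R; have k0 : 0 <= k by rewrite mulr_ge0.
pose a := k `^ q / dl ^+ 2; have a0 : 0 <= a by rewrite divr_ge0 ?powR_ge0 ?sqr_ge0.
have cq0 : 0 < c `^ q by exact: powR_gt0.
pose eta := Num.min (e / 4) (c `^ q / 2 / (a + 1)).
have eta0 : 0 < eta by rewrite lt_min !divr_gt0// ltr_wpDl.
have [G0 gG0 hG0] := grid_dense scM scN sfM sfN rect LF' eta0.
pose G z := clip n%:R (G0 z) * (\1_(Q n) z)%:C%C.
have gG : grid muM muN G.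
  apply: (@grid_map2 _ _ _ muM muN (fun z w => clip n%:R z * w)) => //.
    by rewrite mulr0.
  have [mA mB] := mAB n; have [Aoo Boo] := finAB n.
  exact: (@grid_rect R M N muM muN (A n) (B n) mA mB Aoo Boo).
have LG := Lgrid gG; have LD := L2_sub LF' LG.
have DQ z : ~ Q n z -> sub (F' n) G z = 0.
  by move=> nQ; rewrite /sub /G F'Q// indicE memNset// mulr0 subr0.
have D_le z : normc (sub (F' n) G z) <= normc (sub (F' n) G0 z).
  have [Qz|nQ] := pselect (Q n z); last by rewrite DQ// normc0 normc_ge0.
  by rewrite /sub /G indicE mem_set// mulr1; exact: clip_close.
have D_k z : normc (sub (F' n) G z) <= k.
  have [Qz|nQ] := pselect (Q n z); last by rewrite DQ// normc0.
  rewrite /sub /G indicE mem_set// mulr1; apply: le_trans (le_normcD _ _) _.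
  rewrite normcN; have := normc_clip (G0 z) (ler0n R n); have := F'n z.
  by rewrite /k; lra.
have nD : nX (sub (F' n) G) < eta.
  by apply: le_lt_trans hG0; apply: nrm2_mono => //; apply: L2_sub => //; exact: Lgrid.
have [nD1 nD2] : nX (sub (F' n) G) < e / 4 /\ a * nX (sub (F' n) G) <= c `^ q / 2.
  move: nD; rewrite /eta lt_min => /andP[-> h]; split => //.
  rewrite ltr_pdivlMr ?ltr_wpDl// in h; apply: le_trans (ltW h).
  by rewrite mulrDr mulr1 mulrC lerDl nrm2_ge0.
exists G; split => //.
  by apply: le_lt_trans (nrm2_triangle LF LF' LG) _; lra.
have ID : (power_integral muX q (sub (F' n) G) <= (c `^ q)%:E)%E.
  apply: le_trans (small_power_integral q1 dl0 k0 (mQ n) (Qoo n) LD _) _.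
    by move=> z; split; [exact: D_k|exact: DQ].
  by rewrite lee_fin -/V -/a; lra.
pose f (b : bool) (z : X) := if b then normc (F' n z) else normc (sub (F' n) G z).
have := @minkowski_sum _ X R muX q bool [:: true; false] f (fun=> c) q1 _ _ _ _.
rewrite /= unlock /= addr0 => h.
apply: le_trans (le_trans _ (h _ _ _ _)) _.
- apply: nonneg_integral_le => z; first by rewrite lee_fin powR_ge0.
  rewrite lee_fin ge0_ler_powR ?nnegrE ?(ltW q0) ?addr_ge0 ?normc_ge0//.
  have {1}-> : G z = F' n z + - sub (F' n) G z by rewrite /sub; ring.
  by rewrite /f addr0; apply: le_trans (le_normcD _ _) _; rewrite normcN.
- by case; apply: measurable_normc; [exact: (L2_meas LF')|exact: (L2_meas LD)].
- by case=> z; exact: normc_ge0.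
- by move=> _; exact: ltW.
- case; last exact: ID.
  apply: le_trans Fc; apply: nonneg_integral_le => z.
    by rewrite lee_fin powR_ge0.
  by rewrite lee_fin ge0_ler_powR ?nnegrE ?normc_ge0 ?(ltW q0)//; exact: normc_cut.
by rewrite /= mulr_natl mulr2n.
Qed.

End approximation.

(** * The estimate on the product *)

Section product_estimate.
Variables (R : realType) (M N : ptopologicalType).
Hypotheses (scM : second_countable (T := M)) (scN : second_countable (T := N)).
Local Notation X := (borel (M * N)%type).
Variables (muM : {measure set (borel M) -> \bar R})
  (muN : {measure set (borel N) -> \bar R}) (muX : {measure set X -> \bar R}).
Hypotheses (sfM : sigma_finite setT muM) (sfN : sigma_finite setT muN).
Hypothesis rect : forall (A : set M) (B : set N),
  @measurable _ (borel M) A -> @measurable _ (borel N) B ->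
  muX (A `*` B : set (M * N)) = (muM A * muN B)%E.
Local Notation C := R[i].
Local Notation normc := (@Normc.normc R).
Local Notation nX := (nrm2 muX).
Variables (VM : (M -> C) -> M -> C) (VN : (N -> C) -> N -> C)
  (VX : (M * N -> C) -> M * N -> C).
Hypotheses (linM : linear_operator muM (L2 muM) VM)
  (linN : linear_operator muN (L2 muN) VN) (linX : linear_operator muX (L2 muX) VX).
Hypothesis VXE : forall (f : M -> C) (g : N -> C), L2 muM f -> L2 muN g ->
  aeq muX (VX (tensor f g)) (tensor (VM f) (VN g)).
Hypothesis VX_close : forall F G : M * N -> C, L2 muX F -> L2 muX G ->
  nX (sub (VX F) (VX G)) <= 4 * nX (sub F G).
Variables (k1 k2 : R) (p q : \bar R).
Hypotheses (k1_ge0 : 0 <= k1) (k2_ge0 : 0 <= k2) (q1 : (1 <= q)%E) (qp : (q <= p)%E).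
Hypothesis hM : forall (f : M -> C) c, L2 muM f -> 0 <= c -> Lp_bound muM q c f ->
  Lp_bound muM p (k1 * c) (VM f).
Hypothesis hN : forall (g : N -> C) c, L2 muN g -> 0 <= c -> Lp_bound muN q c g ->
  Lp_bound muN p (k2 * c) (VN g).

Lemma grid_estimate G c : 0 <= c -> grid muM muN G -> Lp_bound muX q c G ->
  (q = +oo%E -> forall z, normc (G z) <= c) -> Lp_bound muX p (k1 * k2 * c) (VX G).
Proof.
move=> c0 gG; case: q q1 qp hM hN => [q'||]//= q1' qp' hM' hN' Gc Goo.
  have [m _ Gm] := grid_bounded gG.
  have [J [A [b [B [mA mB bP disjA GE]]]]] := grid_decomposition gG Gm.
  case: p qp' hM' hN' => [p'||]//= qp' hM' hN'.
    exact: (estimate_finite_finite scM scN sfM sfN rect linM linN linX VXE k1_ge0 k2_ge0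
      mA mB bP disjA GE _ c0 Gc).
  exact: (estimate_finite_infty scM scN sfM sfN rect linM linN linX VXE k2_ge0
      mA mB bP disjA GE _ c0 Gc).
have [J [A [b [B [mA mB bP disjA GE]]]]] := grid_decomposition gG (Goo erefl).
case: p qp' hM' hN' => [p'||]//= _ hM' hN'.
exact: (estimate_infty_infty scM scN sfM sfN rect linM linN linX VXE k2_ge0
      mA mB bP disjA GE c0).
Qed.

Let p1 : (1 <= p)%E. Proof. exact: le_trans q1 qp. Qed.

Let estimate_zero F : L2 muX F -> Lp_bound muX q 0 F -> Lp_bound muX p 0 (VX F).
Proof.
move=> LF F0; have L0 := L2_0 muX.
have FE : aeq muX F (fun=> 0).
  case: q q1 F0 => [q'||]//= q1' F0; last first.
    apply: filterS F0 => z Fz _; apply: Normc.eq0_normc; apply/eqP.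
    by rewrite eq_le Fz normc_ge0.
  have q0 : 0 < q' by move: q1'; rewrite lee_fin; exact: lt_le_trans.
  have mF : measurable_fun [set: X] (fun z => (normc (F z) `^ q')%:E).
    by apply/measurable_EFinP; apply: measurable_powR_normc; exact: (L2_meas LF).
  have := (ae_eq_integral_abs muX measurableT mF).1.
  have -> : (\int[muX]_z `|(normc (F z) `^ q')%:E| = 0)%E.
    under eq_integral => z _ do rewrite gee0_abs ?lee_fin ?powR_ge0//.
    apply/eqP; rewrite eq_le integral_ge0 ?andbT; last first.
      by move=> z _; rewrite lee_fin powR_ge0.
    by move: F0; rewrite powR0 ?gt_eqF.
  move=> /(_ erefl); apply: filterS => z /(_ Logic.I) [/eqP h] _.
  by apply: Normc.eq0_normc; move: h; rewrite powR_eq0 => /andP[/eqP].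
have h : aeq muX (fun=> 0) (VX F).
  apply: aeq_sym; apply: aeq_trans (lop_aeq linX LF (L2_meas L0) FE) _.
  exact: (lop_zero linX).
apply: Lp_bound_aeq (L2_meas L0) (L2_meas (lop_L2 linX LF)) h _.
case: p p1 => [p'||//] p1'; last by apply: aeW => z; rewrite normc0.
have p0 : p' != 0 by rewrite gt_eqF//; move: p1'; rewrite lee_fin; exact: lt_le_trans.
by rewrite /Lp_bound /power_integral normc0 !powR0// integral0.
Qed.

Let approximation F c e : 0 < c -> 0 < e -> L2 muX F -> Lp_bound muX q c F ->
  exists G, [/\ grid muM muN G, nX (sub F G) < e &
    Lp_bound muX p (k1 * k2 * (2 * c)) (VX G)].
Proof.
move=> c0 e0 LF Fc; have c0' := ltW c0.
have [G [gG FG Gc Goo]] : exists G, [/\ grid muM muN G, nX (sub F G) < e,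
    Lp_bound muX q (2 * c) G & q = +oo%E -> forall z, normc (G z) <= 2 * c].
  case: q q1 Fc => [q'||]//= q1' Fc.
    have [G [gG FG Gc]] := approximation_finite scM scN sfM sfN rect q1' c0 e0 LF Fc.
    by exists G.
  have [G [gG FG Gc]] := approximation_infty scM scN sfM sfN rect c0' e0 LF Fc.
  by exists G; split=> //; exact: aeW.
by exists G; split=> //; apply: grid_estimate => //; rewrite mulr_ge0.
Qed.

(** Grid functions are dense, and by Fatou's lemma bounds in $L^p$ pass to
    limits in $L^2$. *)
Theorem product_estimate F c : 0 <= c -> L2 muX F -> Lp_bound muX q c F ->
  Lp_bound muX p (2 * (k1 * k2) * c) (VX F).
Proof.
rewrite le_eqVlt => /orP[/eqP<-|c0] LF Fc; first by rewrite mulr0; exact: estimate_zero.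
have e0 n : 0 < (4 * (2 ^ n.+1)%:R)^-1 :> R by rewrite invr_gt0 mulr_gt0// ltr0n expn_gt0.
have [G hG] := choice (fun n => approximation c0 (e0 n) LF Fc).
have LG n : L2 muX (G n) by apply: (L2_grid scM scN rect); have [] := hG n.
rewrite -mulrA mulrCA.
apply: (@Lp_bound_lsc _ _ _ muX p _ (fun n => VX (G n))) => //.
- by rewrite !mulr_ge0// ltW.
- by move=> n; exact: (lop_L2 linX).
- exact: (lop_L2 linX).
- by move=> n; have [] := hG n.
move=> n; apply: le_trans (VX_close LF (LG n)) _.
have [_ /ltW h _] := hG n; rewrite -ler_pdivlMl//; apply: le_trans h _.
by rewrite invfM.
Qed.

End product_estimate.

Theorem theorem1p4 (R : realType) (M N : ptopologicalType)
    (gM : riemannian_data R M) (gN : riemannian_data R N)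
    (muM : {measure set (borel M) -> \bar R})
    (muN : {measure set (borel N) -> \bar R})
    (muX : {measure set (borel (M * N)%type) -> \bar R})
    (H : unbounded_operator (borel M) R)
    (K : unbounded_operator (borel N) R)
    (L : unbounded_operator (borel (M * N)%type) R)
    (expH : R -> (M -> R[i]) -> M -> R[i])
    (expK : R -> (N -> R[i]) -> N -> R[i])
    (expL : R -> (M * N -> R[i]) -> M * N -> R[i])
    (I : set R) (a b : R) (r rt : \bar R) :
  oriented_riemannian_manifold gM ->
  oriented_riemannian_manifold gN ->
  is_volume_measure gM muM ->
  is_volume_measure gN muN ->
  is_volume_measure (riemannian_product gM gN) muX ->
  selfadjoint muM H ->
  selfadjoint muN K ->
  selfadjoint muX L ->
  is_sum muM muN muX H K L ->
  is_unitary_group muM H expH ->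
  is_unitary_group muN K expK ->
  is_unitary_group muX L expL ->
  is_interval I -> 0 <= a -> 0 <= b -> (1 <= rt)%E -> (rt <= r)%E ->
  dispersive_estimate muM expH I a r rt ->
  dispersive_estimate muN expK I b r rt ->
  dispersive_estimate muX expL I (a + b) r rt.
Proof.
move=> manM manN volM volN volX saH saK saL sumL [EH resH UHE] [EK resK UKE] [EL resL ULE].
move=> _ a0 b0 rt1 rtr [Ka hM] [Kb hN].
have [_ scM [atM _] metM] := manM; have [_ scN [atN _] metN] := manN.
have sfM : sigma_finite setT muM := volume_sigma_finite atM metM volM scM.
have sfN : sigma_finite setT muN := volume_sigma_finite atN metN volN scN.
have rect := volume_rectangle manM manN volM volN volX.
have r1 : (1 <= r)%E := le_trans rt1 rtr.
have bound d (T : measurableType d) (mu : {measure set T -> \bar R}) U (k c : R) t f e :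
    (forall t f, I t -> t != 0 -> L2 mu f -> cLp mu rt f ->
      (cLnorm mu r (U t f) <= (k * `|t| `^ (- c))%:E * cLnorm mu rt f)%E) ->
    I t -> t != 0 -> 0 <= e -> L2 mu f -> Lp_bound mu rt e f ->
    Lp_bound mu r (Num.max k 0 * `|t| `^ (- c) * e) (U t f).
  move=> hU It t0 e0 Lf fe.
  have k0 : 0 <= Num.max k 0 * `|t| `^ (- c) by rewrite mulr_ge0 ?powR_ge0// le_max lexx orbT.
  have {}fe : (cLnorm mu rt f <= e%:E)%E by apply/cLnorm_leP.
  apply/cLnorm_leP => //; first by rewrite mulr_ge0.
  apply: le_trans (hU t f It t0 Lf _) _.
    by split; [exact: (L2_meas Lf)|exact: le_lt_trans fe (ltry _)].
  rewrite [leRHS]EFinM; apply: le_trans (lee_wpmul2l _ fe); last by rewrite lee_fin.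
  apply: lee_wpmul2r; first exact: Lnorm_ge0.
  by rewrite lee_fin ler_wpM2r ?powR_ge0// le_max lexx.
exists (2 * (Num.max Ka 0 * Num.max Kb 0)) => t F It t0 LF [mF Foo].
have F0 : (0 <= cLnorm muX rt F)%E by exact: Lnorm_ge0.
pose c := fine (cLnorm muX rt F); have c0 : 0 <= c by exact: fine_ge0.
have cE : c%:E = cLnorm muX rt F by rewrite fineK// ge0_fin_numE.
have Fc : Lp_bound muX rt c F by apply/cLnorm_leP => //; rewrite cE.
have ka0 : 0 <= Num.max Ka 0 * `|t| `^ (- a) by rewrite mulr_ge0 ?powR_ge0// le_max lexx orbT.
have kb0 : 0 <= Num.max Kb 0 * `|t| `^ (- b) by rewrite mulr_ge0 ?powR_ge0// le_max lexx orbT.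
have tens f g : L2 muM f -> L2 muN g ->
    aeq muX (expL t (tensor f g)) (tensor (expH t f) (expK t g)).
  exact: (tensor_evolution scM scN sfM sfN rect saH saK saL sumL resH resK resL UHE UKE ULE).
have := product_estimate scM scN sfM sfN rect (UHE t).1 (UKE t).1 (ULE t).1 tens
  (unitary_close resL ULE t) ka0 kb0 rt1 rtr
  (fun f e Lf e0 => bound _ _ muM expH Ka a t f e hM It t0 e0 Lf)
  (fun g e Lg e0 => bound _ _ muN expK Kb b t g e hN It t0 e0 Lg) c0 LF Fc.
have powt : `|t| `^ (- (a + b)) = `|t| `^ (- a) * `|t| `^ (- b).
  by rewrite opprD powRD// normr_eq0 t0 implybT.
move=> h; rewrite -cE -EFinM; apply/cLnorm_leP => //.
  by rewrite !mulr_ge0// ?powR_ge0// le_max lexx orbT.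
rewrite powt; move: h; congr (Lp_bound _ _ _ _); ring.
Qed.
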